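(* Let $Q$ be a transition kernel on $(\mathsf X,\mathscr X)$ that is $\pi$-reversible for a probability measure $\pi$, and let $g:\mathsf X\to\mathbb R$ satisfy $\int g^2\,d\pi<\infty$. Let $\gamma(k)=\mathrm{Cov}_\pi(g(X_0),g(X_{|k|}))$, $k\in\mathbb Z$, where $\{X_t\}$ is the Markov chain with kernel $Q$ and $X_0\sim\pi$. 1. There is a finite regular (positive) measure $F$ on $\mathbb R$ such that $$\gamma(k)=\int_{\sigma(Q_0)}x^{|k|}F(dx)\qquad\text{for all }k\in\mathbb Z,$$ where $\sigma(Q_0)$ is the spectrum of the operator $Q_0$ on $L^2(\pi)$. Moreover, $\sigma(Q_0)$ lies on the real axis and $\sigma(Q_0)\subseteq[-1,1]$. 2. Let $\Gamma(k)=\gamma(2k)+\gamma(2k+1)$ for $k\in\mathbb N$. There is a finite regular (positive) measure $G$ on $\mathbb R$ such that $$\Gamma(k)=\int_{\sigma(Q_0^2)}x^{k}G(dx)\qquad\text{for all }k\in\mathbb N,$$ and $\sigma(Q_0^2)\subseteq[0,1]$. 3. If, additionally, the chain is $\psi$-irreducible, aperiodic, positive Harris recurrent, and geometrically ergodic, then there exists $0<\delta_0\le 1$ such that $\sigma(Q_0)\subseteq[-1+\delta_0,1-\delta_0]$ and $\sigma(Q_0^2)\subseteq[0,(1-\delta_0)^2]$.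
   Context: $\mathsf X$ is a complete separable metric space with Borel $\sigma$-algebra $\mathscr X$; $\mathbb N=\{0,1,2,\dots\}$; convention $0^0=1$. For a kernel $Q$, $Qf(x)=\int Q(x,dy)f(y)$, regarded as an operator on $L^2(\pi)$ with inner product $\langle f,h\rangle_\pi=\int fh\,d\pi$. $Q$ is $\pi$-reversible if $\langle f_1,Qf_2\rangle_\pi=\langle Qf_1,f_2\rangle_\pi$ for all $f_1,f_2\in L^2(\pi)$. The operator $Q_0$ on $L^2(\pi)$ is $Q_0f=Qf-E_\pi[f(X_0)]f_0$, where $f_0\equiv 1$. The spectrum of an operator $T$ on $L^2(\pi)$ is $\sigma(T)=\{\lambda\in\mathbb C: (T-\lambda I)^{-1}\text{ does not exist or is unbounded}\}$. Geometric ergodicity: there are $\rho<1$ and a non-negative (finite) function $V$ on $\mathsf X$ with $\|Q^n(x,\cdot)-\pi\|_{\mathrm{TV}}\le V(x)\rho^n$ for all $x\in\mathsf X$ and all $n$. $\psi$-irreducibility, aperiodicity and positive Harris recurrence are in the sense of Meyn and Tweedie. *)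

(* Defs.v *)
From HB Require Import structures.
From mathcomp Require Import all_boot all_order all_algebra.
From mathcomp Require Import all_classical all_reals all_analysis.
From mathcomp Require Import complex.
Set Implicit Arguments.
Unset Strict Implicit.
Unset Printing Implicit Defensive.
Import Order.TTheory GRing.Theory Num.Theory.
Import numFieldNormedType.Exports.
Local Open Scope classical_set_scope.
Local Open Scope ring_scope.

#[short(type="completeMetricType")]
HB.structure Definition CompleteMetric (R : numDomainType) :=
  { S of Metric R S & Complete S }.

Definition separable (S : topologicalType) :=
  exists2 D : set S, countable D & dense D.

Notation borel S := (g_sigma_algebraType (@open S)).

Definition regular_measure (R : realType)
    (mu : {measure set (measurableTypeR R) -> \bar R}) :=
  forall A : set (measurableTypeR R), measurable A ->
    mu A = ereal_inf [set mu U | U in [set U : set R | open U /\ A `<=` U]] /\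
    mu A = ereal_sup [set mu K | K in [set K : set R | compact K /\ K `<=` A]].

Section L2_operators.
Context d (T : measurableType d) (R : realType) (pi : probability T R).

(* Elements of L^2(pi) are represented by square-integrable functions, real
   ones by [Lfun pi 2]; equality in L^2(pi) is pi-a.e. equality. *)
Definition inner (f h : T -> R) : R := \int[pi]_x (f x * h x).

Definition cL2 (f : T -> R[i]) :=
  ((fun x => complex.Re (f x)) \in Lfun pi 2%:E) /\
  ((fun x => complex.Im (f x)) \in Lfun pi 2%:E).

Definition cL2norm (f : T -> R[i]) : \bar R :=
  Lnorm pi 2%:E (fun x => (Normc.normc (f x))%:E).

(* The spectrum is a set of complex numbers, so real operators are extended
   C-linearly to complex-valued functions. *)
Definition complexify (A : (T -> R) -> (T -> R)) (f : T -> R[i]) : T -> R[i] :=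
  fun x => (A (fun y => complex.Re (f y)) x +i*
            A (fun y => complex.Im (f y)) x)%C.

(* Linearity of [B] and its compatibility with a.e. equality follow from
   these clauses when [A] is linear and compatible with a.e. equality. *)
Definition has_bounded_inverse (A : (T -> R[i]) -> (T -> R[i])) :=
  exists B : (T -> R[i]) -> (T -> R[i]),
    [/\ forall f, cL2 f -> cL2 (B f),
        exists M : R, forall f, cL2 f -> (cL2norm (B f) <= M%:E * cL2norm f)%E,
        forall f, cL2 f -> {ae pi, forall x, B (A f) x = f x}
      & forall f, cL2 f -> {ae pi, forall x, A (B f) x = f x}].

Definition spectrum (A : (T -> R) -> (T -> R)) : set R[i] :=
  [set l | ~ has_bounded_inverse (fun f x => complexify A f x - l * f x)].

Variable Q : R.-pker T ~> T.

Definition kernel_op (f : T -> R) : T -> R := fun x => \int[Q x]_y f y.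

Definition reversible :=
  forall f1 f2 : T -> R, f1 \in Lfun pi 2%:E -> f2 \in Lfun pi 2%:E ->
    inner f1 (kernel_op f2) = inner (kernel_op f1) f2.

Definition centered_op (f : T -> R) : T -> R :=
  fun x => kernel_op f x - \int[pi]_y f y.

End L2_operators.

Section markov_chains.
Context d (T : measurableType d) (R : realType) (Q : R.-pker T ~> T).

(* [history X n] is the sigma-algebra generated by X_0, ..., X_n, and the last
   clause below says that Q(X_n, A) is a version of the conditional
   probability of {X_{n+1} \in A} given it. *)
Definition history d' (Omega : measurableType d')
    (X : nat -> {mfun Omega >-> T}) (n : nat) : set (set Omega) :=
  <<s [set H | exists i B, [/\ (i <= n)%N, measurable B & H = X i @^-1` B]] >>.

Definition markov_chain (mu : set T -> \bar R) d' (Omega : measurableType d')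
    (P : probability Omega R) (X : nat -> {mfun Omega >-> T}) :=
  (forall A, measurable A -> P (X 0%N @^-1` A) = mu A) /\
  (forall n H A, history X n H -> measurable A ->
     P (H `&` X n.+1 @^-1` A) = (\int[P]_(w in H) Q (X n w) A)%E).

(* The last conjunct is P_x(tau_A < oo) > 0 with tau_A the first time n >= 1
   at which X_n is in A; the law of a chain started at x does not depend on
   its realization. *)
Definition irreducible_wrt (phi : set T -> \bar R) :=
  forall A, measurable A -> (0 < phi A)%E ->
  forall x d' (Omega : measurableType d') (P : probability Omega R) X,
    @markov_chain \d_x d' Omega P X ->
    (0 < P (\bigcup_(n in [set n | (0 < n)%N]) (X n @^-1` A)))%E.

(* psi is a maximal irreducibility measure. *)
Definition psi_irreducible (psi : {measure set T -> \bar R}) :=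
  [/\ psi setT != 0%E, irreducible_wrt psi &
      forall phi : {measure set T -> \bar R},
        irreducible_wrt phi <-> phi `<< psi].

Definition is_cycle (psi : set T -> \bar R) (p : nat) (D : nat -> set T) :=
  [/\ forall i, (i < p)%N -> measurable (D i),
      trivIset [set i | (i < p)%N] D,
      forall i x, (i < p)%N -> D i x -> Q x (D (i.+1 %% p)%N) = 1%E
    & psi (~` \bigcup_(i in [set i | (i < p)%N]) D i) = 0%E].

(* The period is the largest p > 0 for which a p-cycle exists; there always
   is a 1-cycle. *)
Definition aperiodic (psi : set T -> \bar R) :=
  forall p D, (0 < p)%N -> is_cycle psi p D -> p = 1%N.

Definition harris_recurrent (psi : set T -> \bar R) :=
  forall A, measurable A -> (0 < psi A)%E ->
  forall x, A x ->
  forall d' (Omega : measurableType d') (P : probability Omega R) X,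
    @markov_chain \d_x d' Omega P X ->
    P (lim_sup_set (fun n => X n @^-1` A)) = 1%E.

Definition invariant (mu : {measure set T -> \bar R}) :=
  forall A, measurable A -> mu A = (\int[mu]_x Q x A)%E.

Definition positive := exists mu : probability T R, invariant mu.

Fixpoint kernel_iter (n : nat) : R.-spker T ~> T :=
  if n is m.+1 then mkcomp_noparam Q (kernel_iter m)
  else kdirac (@measurable_id _ T setT).

(* Total variation norm of mu - nu, normalized so that it equals the supremum
   of |mu(f) - nu(f)| over measurable f with |f| <= 1. *)
Definition tv_norm (mu nu : set T -> \bar R) : \bar R :=
  (ereal_sup [set mu A - nu A | A in measurable] -
   ereal_inf [set mu A - nu A | A in measurable])%E.

Definition geometrically_ergodic (pi : probability T R) :=
  exists (rho : R) (V : T -> R),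
    [/\ rho < 1, forall x, 0 <= V x &
        forall n x, (tv_norm (kernel_iter n x) pi <= (V x * rho ^+ n)%:E)%E].

End markov_chains.

Definition autocov d (T : measurableType d) d' (Omega : measurableType d')
    (R : realType) (P : probability Omega R) (X : nat -> {mfun Omega >-> T})
    (g : T -> R) (k : int) : \bar R :=
  covariance P (fun w => g (X 0%N w)) (fun w => g (X `|k|%N w)).

(* Main.v *)
(* Q0 = centered_op is a self-adjoint contraction of L^2(pi), and gamma(k) is
   <h, Q0^k h> for h = g - pi(g). The functional p |-> <h, p(Q0) h> on
   polynomials is nonnegative on p^2, (1 + X) p^2 and (1 - X) p^2, so by the
   solution of the Hausdorff moment problem it is integration against a finite
   measure F on [-1, 1]; hence ||p(Q0) u|| <= sup |p| ||u||, the sup being over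
   any set that carries all these measures.
   If Q0 - l is bounded below by c, the weights (1 - (x - l)^2 / M)^n, which
   peak at l, show that F does not charge ]l - c, l + c[. So F is carried by
   the set of l where Q0 - l is not bounded below. That set is the spectrum:
   away from it (x - l)^2 is bounded below, and the inverse of (Q0 - l)^2 is a
   limit of polynomials in Q0 given by a Neumann series. The same applies to
   Q0^2 and, with (x - a)^2 + b^2 instead of (x - l)^2, to l = a + i b.
   For a geometrically ergodic chain, <v, Q0^(2n) v> = O(r^(2n)) for the
   indicators v of a family of sets whose combinations are dense, so that no F
   charges {r < |x|}. *)
Require Import Defs.
From HB Require Import structures.
From mathcomp Require Import all_boot all_order all_algebra.
From mathcomp Require Import all_classical all_reals all_analysis.
From mathcomp Require Import measurable_realfun.
From mathcomp Require Import complex.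
From mathcomp Require Import zify ring lra.
Set Implicit Arguments.
Unset Strict Implicit.
Unset Printing Implicit Defensive.
Import Order.TTheory GRing.Theory Num.Theory.
Import numFieldNormedType.Exports.
Local Open Scope classical_set_scope.
Local Open Scope ring_scope.

(** * The Hausdorff moment problem *)

(** The moment problem stands in for the spectral theorem: it asks only for positivity on
    polynomials, and the sets that carry the resulting measures are determined afterwards. These
    measures depend on the vector, so facts about the operator itself are phrased as bounds on all
    polynomials in it, uniformly over vectors. [Gamma k] equals <h, (1 + Q0) Q0^(2k) h>. So G is not
    the measure of Q0^2 at h: it represents p |-> <h, p(Q0^2) (1 + Q0) h>, and it is positive
    because 1 + Q0 >= 0. Covariances are governed by Q, the spectra by Q0. The two operators agree
    on functions of mean zero, and the iterates of h keep mean zero. For geometric ergodicity the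
    test sets A are sets on which V is bounded: <1_A, Q^(2n) 1_A> - pi(A)^2 is the integral over A
    of Q^(2n)(x, A) - pi(A), so a pointwise one-sided bound on A suffices. As V need not be
    measurable, its sublevel sets are replaced by measurable hulls. *)

Section bernstein.
Context (R : realType) (L : {scalar {poly R}}).
Hypothesis L_sqr : forall p, 0 <= L (p ^+ 2).
Hypothesis L_Xsqr : forall p, 0 <= L ('X * p ^+ 2).
Hypothesis L_Ysqr : forall p, 0 <= L ((1 - 'X) * p ^+ 2).

Definition bern n i : {poly R} := 'X^i * (1 - 'X) ^+ (n - i).

(** Even parts of the exponents go into a square, leaving a factor 1, X, 1 - X or X (1 - X). The
    last one reduces to the others since X (1 - X) = X (1 - X)^2 + (1 - X) X^2. *)
Lemma monomial_pos i j : 0 <= L ('X^i * (1 - 'X) ^+ j).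
Proof.
have dbl (q : {poly R}) k : q ^+ k = q ^+ (odd k) * (q ^+ k./2) ^+ 2.
  by rewrite -exprM muln2 -exprD odd_double_half.
rewrite (dbl 'X i) (dbl (1 - 'X) j).
set a := _ ^+ i./2; set b := _ ^+ j./2.
case: (odd i); case: (odd j); rewrite /= ?expr0 ?expr1.
- have -> : 'X * a ^+ 2 * ((1 - 'X) * b ^+ 2) =
    'X * ((1 - 'X) * (a * b)) ^+ 2 + (1 - 'X) * ('X * (a * b)) ^+ 2 :> {poly R} by ring.
  by rewrite linearD addr_ge0.
- by rewrite mul1r -mulrA -exprMn.
- by rewrite mul1r mulrCA -exprMn.
- by rewrite !mul1r -exprMn.
Qed.

(* The law on the points [i / n] that these weights define has moments tending
   to those of [L]. *)
Definition bern_weight n i : R := L (bern n i) *+ 'C(n, i).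

Lemma bern_weight_ge0 n i : 0 <= bern_weight n i.
Proof. by rewrite mulrn_wge0// monomial_pos. Qed.

(** Binomial moments of the weights are exact, unlike power moments: expand ((1 - X) + X)^(n - k) =
    1, multiply by X^k, and use C(n, i + k) C(i + k, k) = C(n, k) C(n - k, i). *)
Lemma bern_weight_moment_binomial n k : (k <= n)%N ->
  \sum_(i < n.+1) ('C(i, k)%:R / 'C(n, k)%:R) * bern_weight n i = L 'X^k.
Proof.
move=> kn.
have -> : 'X^k = \sum_(i < n.+1) ('C(i, k)%:R / 'C(n, k)%:R) *: (bern n i *+ 'C(n, i)).
  have Cnk : 'C(n, k)%:R != 0 :> R by rewrite pnatr_eq0 -lt0n bin_gt0.
  rewrite -(big_mkord xpredT (fun i => ('C(i, k)%:R / 'C(n, k)%:R) *: (bern n i *+ 'C(n, i)))).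
  rewrite (@big_cat_nat _ _ _ k) //=; last exact: leqW.
  rewrite big1_seq ?add0r; last first.
    move=> i /=; rewrite mem_index_iota => /andP[_ ik].
    by rewrite bin_small// mul0r scale0r.
  rewrite -{2}(add0n k) big_addn big_mkord subSn//.
  have := exprDn (1 - 'X : {poly R}) 'X (n - k).
  rewrite subrK expr1n => /(congr1 (fun p => 'X^k * p)).
  rewrite mulr1 mulr_sumr => ->; apply: eq_bigr => i _.
  have ikn : (i + k <= n)%N.
    by have := ltn_ord i; rewrite ltnS leq_subRL// addnC.
  have bE : ('C(n, i + k) * 'C(i + k, k) = 'C(n, k) * 'C(n - k, i))%N.
    have ink : (i <= n - k)%N by rewrite -ltnS.
    have f0 : (0 < k`! * i`! * (n - (i + k))`!)%N by rewrite !muln_gt0 !fact_gt0.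
    apply/eqP; rewrite -(eqn_pmul2r f0); apply/eqP.
    have e1 := bin_fact ikn.
    have e2 := bin_fact (leq_addl i k); rewrite addnK in e2.
    have e3 := bin_fact kn.
    have e4 := bin_fact ink; rewrite -subnDA (addnC k) in e4.
    transitivity ('C(n, i + k) * ('C(i + k, k) * (k`! * i`!) * (n - (i + k))`!))%N; first by lia.
    rewrite e2 e1 -e3 -e4; lia.
  rewrite mulrnAr /bern addnC exprD -!mulrA -subnDA (mulrC ('X^i)).
  set Z := 'X^k * _; rewrite -(scaler_nat _ Z) -(scaler_nat 'C(n, k + i) Z) scalerA; congr (_ *: _).
  rewrite (addnC k i) mulrAC -natrM mulnC bE natrM mulrC mulKf//.
by rewrite linear_sum; apply: eq_bigr => i _; rewrite linearZ /= raddfMn.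
Qed.

Lemma bern_weight_sum n : \sum_(i < n.+1) bern_weight n i = L 1.
Proof.
rewrite -(expr0 'X) -(bern_weight_moment_binomial (leq0n n)).
by apply: eq_bigr => i _; rewrite !bin0 divr1 mul1r.
Qed.

(** The ratio of binomials is the product of (i - j) / (n - j) over j < k; each new factor costs at
    most k / (n - k) against i / n, whence the bound k * k. *)
Lemma bin_ratio_approx n k i : (k < n)%N -> (i <= n)%N ->
  `|(i%:R / n%:R) ^+ k - 'C(i, k)%:R / 'C(n, k)%:R| <= (k * k)%:R / (n - k)%:R :> R.
Proof.
elim: k => [|k IH] kn iN.
  by rewrite !bin0 divr1 expr0 subrr normr0 mul0n mul0r.
have kn' := ltnW kn.
have n0 : 0 < n%:R :> R by rewrite ltr0n (leq_trans _ kn).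
have nk0 : 0 < (n - k)%:R :> R by rewrite ltr0n subn_gt0.
have nk10 : 0 < (n - k.+1)%:R :> R by rewrite ltr0n subn_gt0.
have C0 : 0 < 'C(n, k)%:R :> R by rewrite ltr0n bin_gt0 ltnW.
have C10 : 0 < 'C(n, k.+1)%:R :> R by rewrite ltr0n bin_gt0 ltnW.
have kS0 : 0 < k.+1%:R :> R by rewrite ltr0n.
have rec m : k.+1%:R * 'C(m, k.+1)%:R = (m - k)%:R * 'C(m, k)%:R :> R.
  by rewrite -!natrM mul_bin_left.
have ratioE : 'C(i, k.+1)%:R / 'C(n, k.+1)%:R =
    ('C(i, k)%:R / 'C(n, k)%:R) * ((i - k)%:R / (n - k)%:R) :> R.
  have -> : 'C(i, k.+1)%:R = (i - k)%:R * 'C(i, k)%:R / k.+1%:R :> R.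
    by rewrite -rec mulrAC mulfV ?mul1r// gt_eqF.
  have -> : 'C(n, k.+1)%:R = (n - k)%:R * 'C(n, k)%:R / k.+1%:R :> R.
    by rewrite -rec mulrAC mulfV ?mul1r// gt_eqF.
  by field; rewrite !gt_eqF.
have q01 : 0 <= ('C(i, k)%:R / 'C(n, k)%:R : R) <= 1.
  rewrite divr_ge0//= ler_pdivrMr// mul1r ler_nat.
  exact: leq_bin2l.
have r01 : 0 <= (i%:R / n%:R : R) <= 1.
  by rewrite divr_ge0//= ler_pdivrMr// mul1r ler_nat.
have dlt : 'C(i, k)%:R / 'C(n, k)%:R * `|i%:R / n%:R - (i - k)%:R / (n - k)%:R| <= k%:R / (n - k)%:R :> R.
  (* For [i < k] the subtraction [i - k] is truncated to 0, but then ['C(i, k)] vanishes as well. *)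
  have [ik|ki] := ltnP i k.
    by rewrite bin_small// !mul0r divr_ge0.
  apply: (@le_trans _ _ (1 * `|i%:R / n%:R - (i - k)%:R / (n - k)%:R|)).
    by rewrite ler_wpM2r//; case/andP: q01.
  rewrite mul1r.
  have -> : i%:R / n%:R - (i - k)%:R / (n - k)%:R = (k%:R * (n - i)%:R / n%:R) / (n - k)%:R :> R.
    move: nk0; rewrite !natrB// ?(ltnW kn')// => nk0.
    by field; rewrite !gt_eqF.
  rewrite ger0_norm; last by rewrite divr_ge0// divr_ge0// mulr_ge0.
  rewrite ler_pM2r ?invr_gt0// -mulrA ler_piMr// ler_pdivrMr// mul1r ler_nat.
  exact: leq_subr.
have IH' := IH kn' iN.
rewrite ratioE exprSr.
set a := (i%:R / n%:R) ^+ k in IH' *; set b := 'C(i, k)%:R / 'C(n, k)%:R in IH' q01 dlt *.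
set r := i%:R / n%:R in r01 dlt *; set t := (i - k)%:R / (n - k)%:R in dlt *.
have -> : a * r - b * t = (a - b) * r + b * (r - t) by ring.
apply: (le_trans (ler_normD _ _)); rewrite (normrM (a - b)) (normrM b).
rewrite (ger0_norm (proj1 (andP r01))) (ger0_norm (proj1 (andP q01))).
have h1 : `|a - b| * r <= (k * k)%:R / (n - k)%:R.
  by apply: le_trans IH'; rewrite ler_piMr//; case/andP: r01.
apply: (le_trans (lerD h1 dlt)); rewrite -mulrDl.
rewrite ler_pM//.
- by rewrite -natrD ler_nat addnC -mulnS leq_mul2r leqnSn orbT.
- by rewrite lef_pV2// ler_nat leq_sub2l.
Qed.

Lemma bern_weight_moment_cvg k :
  (fun n => \sum_(i < n.+1) (i%:R / n%:R) ^+ k * bern_weight n i) @ \oo --> L 'X^k.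
Proof.
apply/cvgrPdist_le => e e0.
have L10 : 0 <= L 1 by rewrite -(bern_weight_sum 0) sumr_ge0// => i _; exact: bern_weight_ge0.
near=> n.
have kn : (k < n)%N by near: n; exact: nbhs_infty_gt.
rewrite -(bern_weight_moment_binomial (ltnW kn)) -sumrB.
apply: (@le_trans _ _ (\sum_(i < n.+1) ((k * k)%:R / (n - k)%:R) * bern_weight n i)).
  apply: (le_trans (ler_norm_sum _ _ _)); apply: ler_sum => i _.
  rewrite -mulrBl normrM (ger0_norm (bern_weight_ge0 _ _)) ler_wpM2r ?bern_weight_ge0//.
  by rewrite distrC bin_ratio_approx// -ltnS.
rewrite -mulr_sumr bern_weight_sum mulrAC ler_pdivrMr ?ltr0n ?subn_gt0// mulrC -ler_pdivrMl//.
rewrite natrB; last exact: ltnW.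
rewrite lerBrDr; near: n; exact: nbhs_infty_ger.
Unshelve. all: by end_near.
Qed.

End bernstein.

(** * Rounding powers to an equidistant grid *)

Section steps.
Context (R : realType).
Implicit Types (y v : R) (t q : nat -> R).

(** Induction on [n]: a node with [t n.+1 < y] makes the left side nonpositive, and any other node
    adds its full increment to both sides. *)
Lemma steps_lower t q n y v : {homo q : i j / (i <= j)%N >-> i <= j} ->
  (forall j, t j < y -> q j <= v) -> q 0%N <= v ->
  q n - v <= \sum_(j < n) (q j.+1 - q j) * (y <= t j.+1)%R%:R.
Proof.
move=> qnd qv q0; elim: n => [|n IH]; first by rewrite big_ord0 subr_le0.
rewrite big_ord_recr /=; have [yt|ty] := leP y (t n.+1).
  by rewrite mulr1; lra.
rewrite mulr0 addr0; apply: (@le_trans _ _ 0); first by rewrite subr_le0 qv.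
by apply: sumr_ge0 => j _; rewrite mulr_ge0 ?ler0n// subr_ge0 qnd.
Qed.

Lemma steps_upper t q n y v : {homo q : i j / (i <= j)%N >-> i <= j} ->
  (forall j, y <= t j -> v <= q j) -> v <= q n ->
  \sum_(j < n) (q j.+1 - q j) * (y <= t j)%R%:R <= q n - v.
Proof.
move=> qnd qv vq.
(* The maximum with 0 is needed by the induction: before the nodes reach [y], the sum is 0 while
   [q n - v] may be negative. *)
have [h vqn] : \sum_(j < n) (q j.+1 - q j) * (y <= t j)%R%:R <= Num.max (q n - v) 0 /\ v <= q n.
  split=> //; elim: n {vq} => [|n IH]; first by rewrite big_ord0 le_max lexx orbT.
  have qS := qnd n n.+1 (leqnSn n).
  rewrite big_ord_recr /=; have [yt|ty] := leP y (t n).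
    rewrite mulr1; have := qv _ yt => vqn.
    move: IH; rewrite max_l ?subr_ge0// => IH.
    by rewrite le_max; apply/orP; left; lra.
  rewrite mulr0 addr0; apply: (le_trans IH).
  by rewrite ge_max !le_max lexx orbT andbT lerD2r qS.
by move: h; rewrite max_l// subr_ge0.
Qed.

Definition node N j : R := j%:R / N%:R.

Lemma node_homo N k : {homo (fun j => node N j ^+ k) : i j / (i <= j)%N >-> i <= j}.
Proof.
move=> i j ij; apply: lerXn2r; rewrite ?nnegrE ?divr_ge0//.
by rewrite ler_wpM2r ?invr_ge0// ler_nat.
Qed.

Lemma node_step N k j : (0 < N)%N -> (j < N)%N ->
  node N j.+1 ^+ k - node N j ^+ k <= k%:R / N%:R.
Proof.
move=> N0 jN; have N0' : 0 < N%:R :> R by rewrite ltr0n.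
elim: k => [|k IH]; first by rewrite !expr0 subrr mul0r.
have nd1 : node N j.+1 - node N j = N%:R^-1.
  by rewrite /node -mulrBl -natrB// subSnn mul1r.
have b i : (i <= N)%N -> 0 <= node N i <= 1.
  by move=> iN; rewrite divr_ge0//= ler_pdivrMr// mul1r ler_nat.
have /andP[a0 a1] := b _ jN; have /andP[b0 b1] := b _ (ltnW jN).
have -> : node N j.+1 ^+ k.+1 - node N j ^+ k.+1 =
  node N j.+1 * (node N j.+1 ^+ k - node N j ^+ k) + (node N j.+1 - node N j) * node N j ^+ k.
  by rewrite !exprS; ring.
have h1 : node N j.+1 * (node N j.+1 ^+ k - node N j ^+ k) <= k%:R / N%:R.
  apply: le_trans IH; rewrite ler_piMl// subr_ge0.
  exact: (@node_homo N k _ _ (leqnSn j)).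
have -> : k.+1%:R / N%:R = k%:R / N%:R + N%:R^-1 :> R by rewrite -natr1 mulrDl mul1r.
apply: lerD => //.
by rewrite nd1 ler_piMr ?invr_ge0// exprn_ile1.
Qed.

(** The sum telescopes from the node just left of [y] up to 1. It is written with the indicators of
    [y <= t] because their mean is a distribution function at [t]. *)
Lemma node_lower N k y : (0 < N)%N -> 0 <= y <= 1 ->
  1 - \sum_(j < N) (node N j.+1 ^+ k - node N j ^+ k) * (y <= node N j.+1)%R%:R <= y ^+ k.
Proof.
move=> N0 /andP[y0 y1].
have NN : node N N = 1 by rewrite /node divff// pnatr_eq0 -lt0n.
rewrite lerBlDr -lerBlDl -{1}(expr1n _ k) -{1}NN.
apply: (@steps_lower (node N) (fun j => node N j ^+ k)).
- exact: node_homo.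
- by move=> j jy; apply: lerXn2r; rewrite ?nnegrE ?divr_ge0// ltW.
- by apply: lerXn2r; rewrite ?nnegrE// /node mul0r.
Qed.

Lemma node_upper N k y : (0 < N)%N -> 0 <= y <= 1 ->
  y ^+ k <= 1 - \sum_(j < N) (node N j.+1 ^+ k - node N j ^+ k) * (y <= node N j)%R%:R.
Proof.
move=> N0 /andP[y0 y1].
have NN : node N N = 1 by rewrite /node divff// pnatr_eq0 -lt0n.
rewrite lerBrDr addrC -lerBrDr -{2}(expr1n _ k) -{2}NN.
apply: (@steps_upper (node N) (fun j => node N j ^+ k)).
- exact: node_homo.
- by move=> j jy; apply: lerXn2r; rewrite ?nnegrE ?divr_ge0.
- by rewrite NN expr1n exprn_ile1.
Qed.

End steps.

(** Compactness then yields limits for all [t] along one and the same ultrafilter. *)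
Lemma ultra_fmap T U (f : T -> U) (F : set_system T) :
  UltraFilter F -> UltraFilter (f @ F).
Proof.
move=> FU; have PF := @ultra_proper _ _ FU.
split; first exact: fmap_proper_filter.
move=> G GF sFG; apply/seteqP; split=> [A GA|A]; last exact: sFG.
have [//|FAc] := in_ultra_setVsetC (f @^-1` A) FU.
have /sFG GAc : (f @ F) (~` A) by [].
exfalso; apply: (@filter_not_empty _ G GF); rewrite -(setICr A); exact: filterI.
Qed.

(** * A limit of the distribution functions *)

Section distribution.
Context (R : realType) (L : {scalar {poly R}}).
Hypothesis L_sqr : forall p, 0 <= L (p ^+ 2).
Hypothesis L_Xsqr : forall p, 0 <= L ('X * p ^+ 2).
Hypothesis L_Ysqr : forall p, 0 <= L ((1 - 'X) * p ^+ 2).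

Let w := bern_weight L.
Let w_ge0 n i : 0 <= w n i. Proof. exact: bern_weight_ge0. Qed.

Definition bern_cdf n (t : R) : R :=
  \sum_(i < n.+1) w n i * (i%:R / n%:R <= t)%R%:R.

(* A limit along an ultrafilter replaces Helly's selection theorem. The sums
   are Abel summations of [x ^+ k], rounded down or up to multiples of [1 / N],
   against the law with distribution function [G]. *)
Lemma limit_cdf : exists G : R -> R,
  [/\ nondecreasing G, forall t, t < 0 -> G t = 0, forall t, 1 <= t -> G t = L 1 &
   forall N k, (0 < N)%N ->
     L 1 - \sum_(j < N) (node R N j.+1 ^+ k - node R N j ^+ k) * G (node R N j.+1) <= L 'X^k
     <= L 1 - \sum_(j < N) (node R N j.+1 ^+ k - node R N j ^+ k) * G (node R N j)].
Proof.
have [U [UU ooU]] := @ultraFilterLemma nat \oo _.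
have PU : ProperFilter U by exact: ultra_proper.
have L1E n : \sum_(i < n.+1) w n i = L 1 by exact: bern_weight_sum.
have cdf_bound n t : 0 <= bern_cdf n t <= L 1.
  rewrite sumr_ge0/= => [|i _]; last by rewrite mulr_ge0.
  rewrite -(L1E n); apply: ler_sum => i _.
  by rewrite ler_piMr// lern1 leq_b1.
have cv t : exists g : R, bern_cdf^~ t @ U --> g.
  have cpt := @segment_compact R 0 (L 1).
  move: cpt; rewrite compact_ultra => /(_ (bern_cdf^~ t @ U) (ultra_fmap _ UU))[].
    change (U (bern_cdf^~ t @^-1` `[0, L 1])).
    by apply: filterS filterT => n _ /=; rewrite in_itv/=; exact: cdf_bound.
  by move=> g [_ Hg]; exists g.
have /choice[G HG] := cv.
have nat0 (n : nat) : 0 <= (n%:R : R) by [].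
exists G; split.
- move=> s t st; apply: ler_cvg_to (HG s) (HG t) _.
  apply: nearW => n; apply: ler_sum => i _; rewrite ler_wpM2l//.
  case: (leP _ s) => [is_|_]; last exact: ler0n.
  by rewrite (le_trans is_).
- move=> t t0; apply: (cvg_unique _ (HG t)) => //.
  apply: cvg_near_cst; apply: nearW => n.
  rewrite /bern_cdf big1// => i _.
  by rewrite leNgt (lt_le_trans t0) ?divr_ge0//= mulr0.
- move=> t t1; apply: (cvg_unique _ (HG t)) => //.
  apply: cvg_near_cst; apply: nearW => n.
  rewrite /bern_cdf -(L1E n); apply: eq_bigr => i _.
  rewrite (le_trans _ t1) ?mulr1//.
  (* At [n = 0] the only point is 0 / 0, which is 0 by the convention on inverses. *)
  case: n i => [|n] i; first by rewrite invr0 mulr0.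
  by rewrite ler_pdivrMr ?ltr0n// mul1r ler_nat -ltnS.
move=> N k N0.
have mom : (fun n => \sum_(i < n.+1) (i%:R / n%:R) ^+ k * w n i) @ U --> L 'X^k.
  by move=> A /(bern_weight_moment_cvg L_sqr L_Xsqr L_Ysqr) /=; exact: ooU.
have cvs (s : nat -> R) : (fun n => L 1 - \sum_(j < N)
    (node R N j.+1 ^+ k - node R N j ^+ k) * bern_cdf n (s j)) @ U -->
    L 1 - \sum_(j < N) (node R N j.+1 ^+ k - node R N j ^+ k) * G (s j).
  apply: cvgB; first exact: cvg_cst.
  apply: (@cvg_big _ _ +%R 0 xpredT).
    exact: add_continuous.
  by move=> j _; apply: cvgM; [exact: cvg_cst|exact: HG].
have swap n (s : nat -> R) : L 1 - \sum_(j < N)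
    (node R N j.+1 ^+ k - node R N j ^+ k) * bern_cdf n (s j) =
  \sum_(i < n.+1) (1 - \sum_(j < N) (node R N j.+1 ^+ k - node R N j ^+ k) *
     (i%:R / n%:R <= s j)%R%:R) * w n i.
  under [RHS]eq_bigr do rewrite mulrBl mul1r.
  rewrite sumrB L1E; congr (_ - _).
  under [RHS]eq_bigr do rewrite mulr_suml.
  rewrite exchange_big /=; apply: eq_bigr => j _.
  by rewrite /bern_cdf mulr_sumr; apply: eq_bigr => i _; ring.
have in01 n (i : 'I_n.+1) : 0 <= (i%:R / n%:R : R) <= 1.
  rewrite divr_ge0//=; case: n i => [|n] i; first by rewrite invr0 mulr0.
  by rewrite ler_pdivrMr ?ltr0n// mul1r ler_nat -ltnS.
apply/andP; split.
- apply: ler_cvg_to (cvs (fun j => node R N j.+1)) mom _.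
  apply: nearW => n /=; rewrite (swap n (fun j => node R N j.+1)); apply: ler_sum => i _.
  by rewrite ler_wpM2r// node_lower.
- apply: ler_cvg_to mom (cvs (fun j => node R N j)) _.
  apply: nearW => n /=; rewrite (swap n (fun j => node R N j)); apply: ler_sum => i _.
  by rewrite ler_wpM2r// node_upper.
Qed.

End distribution.

Section finite_measure_pack.
Context d (T : measurableType d) (R : realType).

Lemma finite_measureW (mu : {measure set T -> \bar R}) : (mu setT < +oo)%E ->
  exists nu : {finite_measure set T -> \bar R}, forall A, nu A = mu A.
Proof.
move=> muT.
by exists (mfrestr measurableT muT) => A; rewrite /= /mfrestr /mrestr setIT.
Qed.

End finite_measure_pack.

(** * Right-continuous modification *)

Section right_limit.
Context (R : realType) (G : R -> R) (G_nd : nondecreasing G).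

(** A limit of distribution functions need not be right-continuous, as a Stieltjes measure requires.
    The modification lies above [G] and below every later value of [G]. *)
Definition right_inf (t : R) : R := inf (G @` `]t, +oo[).

Lemma right_inf_has_inf t : has_inf (G @` `]t, +oo[).
Proof.
split; first by exists (G (t + 1)), (t + 1) => //=; rewrite in_itv/= andbT ltrDl.
by exists (G t) => _ [s /= + <-]; rewrite in_itv/= andbT => /ltW /G_nd.
Qed.

Lemma right_inf_ge t : G t <= right_inf t.
Proof.
apply: lb_le_inf; first by case: (right_inf_has_inf t).
by move=> _ [s /= + <-]; rewrite in_itv/= andbT => /ltW /G_nd.
Qed.

Lemma right_inf_le s t : t < s -> right_inf t <= G s.
Proof.
move=> ts; apply: ge_inf; first by case: (right_inf_has_inf t).
by exists s => //=; rewrite in_itv/= andbT.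
Qed.

Lemma right_inf_nd : nondecreasing right_inf.
Proof.
move=> s t; rewrite le_eqVlt => /predU1P[->//|st].
exact: le_trans (right_inf_le st) (right_inf_ge t).
Qed.

Lemma right_inf_rc : right_continuous right_inf.
Proof.
move=> t; apply/cvgrPdist_le => e e0.
have [_ [s /= + <-] Gse] := inf_adherent e0 (right_inf_has_inf t).
rewrite in_itv/= andbT => ts.
near=> x.
have tx : t < x by near: x; exact: nbhs_right_gt.
have xs : x < s by near: x; exact: nbhs_right_lt.
rewrite distrC ger0_norm ?subr_ge0; last exact: right_inf_nd (ltW tx).
rewrite lerBlDl; apply: (le_trans (right_inf_le xs)); exact: ltW.
Unshelve. all: by end_near.
Qed.

End right_limit.

Section itv_integrable.
Context (R : realType).

Lemma continuous_itv_integrable (nu : {finite_measure set (measurableTypeR R) -> \bar R})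
    (a b : R) (f : R -> R) : continuous f ->
  nu.-integrable `[a, b] (EFin \o f).
Proof.
move=> cf.
apply: measurable_bounded_integrable => //.
- by rewrite ltey_eq fin_num_measure.
- by apply: measurable_funTS; exact: continuous_measurable_fun.
have : compact (f @` `[a, b]).
  apply: continuous_compact; last exact: segment_compact.
  exact: continuous_subspaceT.
move=> /compact_bounded [M [Mr h]]; exists M; split=> // y My x xab.
by apply: (h y My); exists x.
Qed.

End itv_integrable.

Lemma stieltjes_measure_exists (R : realType) (F : R -> R) :
  nondecreasing F -> right_continuous F ->
  exists mu : {measure set (measurableTypeR R) -> \bar R},
    forall a b : R, a <= b -> mu `]a, b]%classic = (F b - F a)%:E.
Proof.
move=> Fnd Frc.
pose f : cumulative R R := HB.pack_for (cumulative R R) F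
  (isCumulative.Build R _ R F Fnd Frc).
exists (lebesgue_stieltjes_measure f) => a b ab.
change ((wlength f)^*%mu `]a, b]%classic = (F b - F a)%:E).
rewrite measurable_mu_extE//; last exact: is_ocitv.
change (wlength f `]a, b]%classic = (F b - F a)%:E).
by rewrite wlength_itv_bnd.
Qed.

(** * The representing measure on the unit interval *)

Section hausdorff.
Context (R : realType) (L : {scalar {poly R}}).
Hypothesis L_sqr : forall p, 0 <= L (p ^+ 2).
Hypothesis L_Xsqr : forall p, 0 <= L ('X * p ^+ 2).
Hypothesis L_Ysqr : forall p, 0 <= L ((1 - 'X) * p ^+ 2).

(** Integrals of the step functions are the sums of [limit_cdf] with [F] in place of [G]. Exchanging
    the two amounts to a shift by at most one node, an error of order 1 / N that vanishes as the
    grid is refined. *)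
Theorem hausdorff_moment :
  exists nu : {finite_measure set (measurableTypeR R) -> \bar R},
    nu (~` `[0, 1]) = 0%E /\
    forall k, \int[nu]_(x in `[0, 1]) (x ^+ k) = L 'X^k.
Proof.
have [G [G_nd G0 G1 GL]] := limit_cdf L_sqr L_Xsqr L_Ysqr.
have Fnd := right_inf_nd G_nd.
have [mu mu_itv] := stieltjes_measure_exists Fnd (right_inf_rc G_nd).
pose F := right_inf G; rewrite -/F in Fnd mu_itv.
have L1_ge0 : 0 <= L 1 by have := L_sqr 1; rewrite expr1n.
have F0 t : t < 0 -> F t = 0.
  move=> t0; apply/eqP; rewrite eq_le; apply/andP; split.
    rewrite -(G0 (t / 2)); last by rewrite pmulr_llt0// invr_gt0.
    by apply: right_inf_le => //; rewrite ltr_pdivlMr//; lra.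
  by rewrite -(G0 t)// right_inf_ge.
have F1 t : 1 <= t -> F t = L 1.
  move=> t1; apply/eqP; rewrite eq_le; apply/andP; split.
    rewrite -(G1 (t + 1)); last by lra.
    by apply: right_inf_le => //; lra.
  by rewrite -(G1 t)// right_inf_ge.
have mI : measurable (`[0, 1]%classic : set (measurableTypeR R)) by exact: measurable_itv.
have null_cover (E : nat -> set (measurableTypeR R)) (A : set (measurableTypeR R)) : measurable A ->
    (forall n, measurable (E n) /\ mu (E n) = 0%E) ->
    A `<=` \bigcup_n E n -> mu A = 0%E.
  move=> mA E0 AE; apply: measure_negligible => //.
  apply: (negligibleS AE); apply: negligible_bigcup => n.
  by have [mE e0] := E0 n; apply/negligibleP.
have mneg : mu `]-oo, 0[%classic = 0%E.
  (* Masses are known only for intervals closed on the right, so the open half-line is exhausted by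
     intervals that stay away from 0, where [F] may jump. *)
  apply: (null_cover (fun n => `](- (n%:R + 1)), (- n.+1%:R^-1)]%classic)) => [|n|x].
  - exact: measurable_itv.
  - split; first exact: measurable_itv.
    have h : 0 < (n.+1%:R^-1 : R) <= 1 by rewrite invr_gt0 ltr0n/= invf_le1 ?ltr0n// ler1n.
    have hm : - (n%:R + 1) <= -1 :> R by rewrite lerN2 lerDr.
    have hu : - n.+1%:R^-1 < 0 :> R by rewrite oppr_lt0; case/andP: h.
    rewrite mu_itv; last by rewrite (le_trans hm)// lerN2; case/andP: h.
    rewrite (F0 (- n.+1%:R^-1))// (F0 (- (n%:R + 1))) ?subrr//.
  rewrite /= in_itv/= => x0.
  (* Both summands are positive, so a single bound serves the two endpoints. *)
  pose n := Num.bound (- x + - x^-1).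
  have xi0 : x^-1 < 0 by rewrite invr_lt0.
  have hn : - x + - x^-1 < n%:R by apply: archi_boundP; lra.
  exists n => //=; rewrite in_itv/=; apply/andP; split; first by lra.
  rewrite lerNr -[leRHS]invrK invrN lef_pV2 ?posrE ?ltr0n//; last by lra.
  by rewrite -natr1; lra.
have mpos : mu `]1, +oo[%classic = 0%E.
  apply: (null_cover (fun n => `]1, n.+1%:R]%classic)) => [|n|x].
  - exact: measurable_itv.
  - split; first exact: measurable_itv.
    by rewrite mu_itv ?F1 ?subrr// ler1n.
  rewrite /= in_itv/= andbT => x1.
  exists (Num.bound x) => //=; rewrite in_itv/= x1/=.
  have : x < (Num.bound x)%:R by apply: archi_boundP; lra.
  by move=> /ltW /le_trans; apply; rewrite ler_nat.
have mcompl : mu (~` `[0, 1]%classic) = 0%E.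
  rewrite setCitv/= measureU0//; exact: measurable_itv.
have m01 (b : R) : 0 <= b -> mu `[0, b]%classic = (F b)%:E.
  (* A possible atom at 0 must be counted; starting from -1 includes it and adds only a null set. *)
  move=> b0; transitivity (mu `](-1), b]%classic).
    have -> : `](-1), b]%classic = `[0, b]%classic `|` `](-1), 0[%classic :> set R.
      apply/seteqP; split=> x /=; rewrite !in_itv/=.
        by move=> /andP[x1 xb]; have [x0|x0] := ltP x 0; [right; rewrite x1|left].
      by move=> [/andP[x0 xb]|/andP[x1 x0]]; apply/andP; split=> //; lra.
    rewrite measureU0//; apply: (subset_measure0 _ _ _ mneg) => //; [exact: measurable_itv..|].
    by move=> x /=; rewrite !in_itv/= => /andP[].
  by rewrite mu_itv ?(F0 (-1)) ?subr0//; lra.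
have [nu nuE] : exists nu : {finite_measure set (measurableTypeR R) -> \bar R}, forall A, nu A = mu A.
  apply: finite_measureW.
  rewrite -(setUv `[0, 1]%classic) (measureU0 mI (measurableC mI) mcompl).
  by rewrite m01// ltry.
exists nu; split; first by rewrite nuE.
move=> k.
have step1 (t : R) : 0 <= t <= 1 ->
    nu.-integrable `[0, 1] (EFin \o (fun x : R => (x <= t)%R%:R)) /\
    \int[nu]_(x in `[0, 1]) (x <= t)%R%:R = F t.
  move=> /andP[t0 t1].
  have indE x : (x <= t)%R%:R = \1_(`]-oo, t]) x :> R.
    by rewrite indicE mem_setE in_itv/=.
  split.
    under [X in _.-integrable _ X]funext do rewrite /= indE.
    apply: measurable_bounded_integrable => //.
    - by rewrite ltey_eq fin_num_measure.
    - exists 1; split=> // y y1 x _; rewrite /= indicE.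
      by case: (_ \in _); rewrite /= ?normr1 ?normr0; lra.
  under eq_Rintegral do rewrite indE.
  rewrite /Rintegral integral_indic//.
  transitivity (fine (mu (`]-oo, t]%classic `&` `[0, 1]%classic))); first by congr fine; exact: nuE.
  rewrite (_ : _ `&` _ = `[0, t]%classic) ?m01//.
  apply/seteqP; split=> x /=; rewrite !in_itv/=; first by move=> [xt /andP[-> _]].
  by move=> /andP[-> xt]; split=> //; rewrite (le_trans xt).
have stepn n (c s : nat -> R) : (forall j, (j < n)%N -> 0 <= s j <= 1) ->
    nu.-integrable `[0, 1] (EFin \o (fun x : R => \sum_(j < n) c j * (x <= s j)%R%:R)) /\
    \int[nu]_(x in `[0, 1]) \sum_(j < n) c j * (x <= s j)%R%:R = \sum_(j < n) c j * F (s j).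
  elim: n => [|n IH] sn.
    under [X in _.-integrable _ X]funext do rewrite /= big_ord0.
    split; first exact: integrable0.
    under eq_Rintegral do rewrite big_ord0.
    by rewrite big_ord0 Rintegral_cst// mul0r.
  have [|i1 e1] := IH; first by move=> j jn; apply: sn; exact: ltnW.
  have [i2 e2] := step1 _ (sn n (ltnSn n)).
  have i2' : nu.-integrable `[0, 1] (EFin \o (fun x : R => c n * (x <= s n)%R%:R)).
    by apply: (integrableZl mI (c n)) i2.
  under [X in _.-integrable _ X]funext do rewrite /= big_ord_recr/= EFinD.
  split; first exact: (integrableD mI i1 i2').
  under eq_Rintegral do rewrite big_ord_recr/=.
  by rewrite RintegralD// e1 RintegralZl// e2 big_ord_recr.
have step (N : nat) (s : nat -> R) : (forall j, (j < N)%N -> 0 <= s j <= 1) ->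
    let h := fun x : R => 1 - \sum_(j < N) (node R N j.+1 ^+ k - node R N j ^+ k) * (x <= s j)%R%:R in
    nu.-integrable `[0, 1] (EFin \o h) /\
    \int[nu]_(x in `[0, 1]) h x =
      L 1 - \sum_(j < N) (node R N j.+1 ^+ k - node R N j ^+ k) * F (s j).
  move=> sN h; have [i1 e1] := stepn N (fun j => node R N j.+1 ^+ k - node R N j ^+ k) s sN.
  have i0 : nu.-integrable `[0, 1] (EFin \o (fun x : R => 1)).
    by apply: continuous_itv_integrable; exact: cst_continuous.
  split.
    rewrite /h; under [X in _.-integrable _ X]funext do rewrite /= EFinB.
    exact: (integrableB mI i0 i1).
  rewrite /h RintegralB// e1 Rintegral_cst// mul1r; congr (_ - _).
  transitivity (fine (mu `[0, 1]%classic)); first by congr fine; exact: nuE.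
  by rewrite m01// F1.
have iX : nu.-integrable `[0, 1] (EFin \o (fun x : R => x ^+ k)).
  by apply: continuous_itv_integrable; exact: exprn_continuous.
set I := \int[nu]_(x in _) _.
have nodeb N j : (0 < N)%N -> (j <= N)%N -> 0 <= node R N j <= 1.
  move=> N0 jN; rewrite divr_ge0//= ler_pdivrMr ?ltr0n// mul1r.
  by rewrite ler_nat.
have key N : (0 < N)%N -> `|I - L 'X^k| <= k%:R / N%:R * (2 * L 1).
  move=> N0; have /andP[gl gu] := GL N k N0.
  have [iu eu] := step N (node R N) (fun j jN => nodeb _ _ N0 (ltnW jN)).
  have [il el] := step N (fun j => node R N j.+1) (fun j jN => nodeb _ _ N0 jN).
  have Iu : I <= L 1 - \sum_(j < N) (node R N j.+1 ^+ k - node R N j ^+ k) * F (node R N j).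
    rewrite -eu; apply: le_Rintegral => // x; rewrite /= in_itv/= => x01.
    exact: node_upper.
  have Il : L 1 - \sum_(j < N) (node R N j.+1 ^+ k - node R N j ^+ k) * F (node R N j.+1) <= I.
    rewrite -el; apply: le_Rintegral => // x; rewrite /= in_itv/= => x01.
    exact: node_lower.
  (* [F] at the nodes, shifted by one and started at 0, so that [H j <= G (node j) <= H j.+1] with
     [H j.+1 = F (node j)]: both functions are squeezed between terms of one telescoping
     sequence. *)
  pose H i := if i is i'.+1 then F (node R N i') else 0.
  have F_ge0 t : 0 <= F t.
    have [t0|t0] := ltP t 0; first by rewrite F0.
    by rewrite -(F0 (-1)); [apply: Fnd; lra|lra].
  have F_leL1 t : F t <= L 1.
    have [t0|t0] := leP 1 t; first by rewrite F1.
    by rewrite -(F1 1)//; apply: Fnd; exact: ltW.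
  have nodeS j : node R N j < node R N j.+1.
    by rewrite ltr_pM2r ?invr_gt0 ?ltr0n// ltr_nat.
  have Hnd i : H i <= H i.+1.
    by case: i => [|i] //=; apply: Fnd; exact/ltW.
  have HG j : H j <= G (node R N j).
    case: j => [|j] /=; last exact: right_inf_le.
    rewrite -(G0 (-1)); last by lra.
    by apply: G_nd; rewrite /node mul0r; lra.
  have GH j : G (node R N j) <= H j.+1 by exact: right_inf_ge.
  (* Each power increment is at most [k / N], and the differences [H j.+2 - H j] add up to at most
     [2 * L 1]. *)
  have tele (a b : nat -> R) : (forall j, (j < N)%N -> a j - b j <= H j.+2 - H j) ->
      \sum_(j < N) (node R N j.+1 ^+ k - node R N j ^+ k) * a j -
      \sum_(j < N) (node R N j.+1 ^+ k - node R N j ^+ k) * b j <= k%:R / N%:R * (2 * L 1).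
    move=> ab; rewrite -sumrB.
    apply: (@le_trans _ _ (\sum_(j < N) k%:R / N%:R * ((H j.+2 + H j.+1) - (H j.+1 + H j)))).
      apply: ler_sum => j _; rewrite -mulrBr.
      have n1 := @node_step R N k j N0 (ltn_ord j).
      have n0 : 0 <= node R N j.+1 ^+ k - node R N j ^+ k.
        by rewrite subr_ge0; exact: (@node_homo R N k _ _ (leqnSn j)).
      have hj : 0 <= H j.+2 - H j by rewrite subr_ge0 (le_trans (Hnd j)).
      have -> : H j.+2 + H j.+1 - (H j.+1 + H j) = H j.+2 - H j by ring.
      apply: (@le_trans _ _ ((node R N j.+1 ^+ k - node R N j ^+ k) * (H j.+2 - H j))).
        by rewrite ler_wpM2l// ab.
      by rewrite ler_wpM2r.
    rewrite -mulr_sumr ler_wpM2l ?divr_ge0//.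
    rewrite -(big_mkord xpredT (fun j => H j.+2 + H j.+1 - (H j.+1 + H j))).
    rewrite (telescope_sumr (fun j => H j.+1 + H j))// /=.
    have h1 := F_leL1 (node R N N); have h2 := F_ge0 (node R N 0).
    have h3 : H N <= L 1 by apply: (le_trans (Hnd N)).
    by rewrite addr0; lra.
  rewrite ler_norml; apply/andP; split.
    rewrite lerNl opprB.
    have := @tele (fun j => F (node R N j.+1)) (fun j => G (node R N j)) _.
    move=> /(_ (fun j _ => lerB (lexx _) (HG j))) h.
    by apply: le_trans h; lra.
  have := @tele (fun j => G (node R N j.+1)) (fun j => F (node R N j)) _.
  move=> /(_ (fun j _ => lerB (GH j.+1) (Hnd j))) h.
  by apply: le_trans h; lra.
apply/eqP; rewrite -subr_eq0 -normr_le0; apply/ler_addgt0Pl => e e0; rewrite addr0.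
pose N := (Num.bound (k%:R * (2 * L 1) / e)).+1.
apply: (le_trans (key N isT)).
have -> : k%:R / N%:R * (2 * L 1) = (k%:R * (2 * L 1)) / N%:R by rewrite mulrAC.
rewrite ler_pdivrMr ?ltr0n// -ler_pdivrMl// mulrC.
have : k%:R * (2 * L 1) / e < (Num.bound (k%:R * (2 * L 1) / e))%:R.
  by apply: archi_boundP; rewrite divr_ge0 ?mulr_ge0//; exact: ltW.
by move=> /ltW /le_trans; apply; rewrite ler_nat.
Qed.

End hausdorff.

(** * Supports and regularity of finite measures *)

Section bounded_integrals.
Context d (T : measurableType d) (R : realType).
Variable mu : {finite_measure set T -> \bar R}.

Lemma bounded_integrable (D : set T) (f : T -> R) (M : R) :
  measurable D -> measurable_fun D f -> (forall x, D x -> `|f x| <= M) ->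
  mu.-integrable D (EFin \o f).
Proof.
move=> mD mf fM; apply: measurable_bounded_integrable => //.
  by rewrite ltey_eq fin_num_measure.
exists M; split; first exact: num_real.
by move=> y My x Dx /=; exact: le_trans (fM x Dx) (ltW My).
Qed.

(* If the weights [u ^+ n], which peak where [psi] is small, do not make the
   mean of [psi] drop below [c], then [psi] is at least [c] almost everywhere. *)
Lemma peak_support (D : set T) (psi : T -> R) (M c : R) :
  measurable D -> measurable_fun D psi -> 0 < M -> c <= M ->
  (forall x, D x -> 0 <= psi x <= M) ->
  (forall n, c * \int[mu]_(x in D) (1 - psi x / M) ^+ (2 * n) <=
             \int[mu]_(x in D) (psi x * (1 - psi x / M) ^+ (2 * n))) ->
  mu (D `&` [set x | psi x < c]) = 0%E.
Proof.
move=> mD mpsi M0 cM psi0M H.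
pose u x := 1 - psi x / M.
have u01 x : D x -> 0 <= u x <= 1.
  move=> Dx; have /andP[p0 pM] := psi0M x Dx.
  by rewrite subr_ge0 ler_pdivrMr// mul1r pM/= gerBl divr_ge0// ltW.
have mu_ : measurable_fun D u.
  by apply: measurable_funB => //; exact: measurable_funM.
have mun n : measurable_fun D (fun x => u x ^+ n) by exact: measurable_funX.
have iu n : mu.-integrable D (EFin \o (fun x => u x ^+ n)).
  apply: (@bounded_integrable _ _ 1) => // x Dx.
  have /andP[u0 u1] := u01 x Dx.
  by rewrite normrX ger0_norm// exprn_ile1.
have ipu n : mu.-integrable D (EFin \o (fun x => psi x * u x ^+ n)).
  apply: (@bounded_integrable _ _ M) => //; first exact: measurable_funM.
  move=> x Dx; have /andP[u0 u1] := u01 x Dx; have /andP[p0 pM] := psi0M x Dx.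
  rewrite normrM normrX (ger0_norm p0) (ger0_norm u0).
  by rewrite (le_trans _ pM)// ler_piMr// exprn_ile1.
have mlt e : measurable (D `&` [set x | psi x < e]).
  rewrite (_ : _ `&` _ = D `&` psi @^-1` `]-oo, e[%classic).
    by apply: mpsi => //; exact: measurable_itv.
  by apply/seteqP; split=> x /= [Dx]; rewrite in_itv.
have key e : e < c -> mu (D `&` [set x | psi x < e]) = 0%E.
  move=> ec; set A := _ `&` _.
  have mA : measurable A by exact: mlt.
  have fA : fine (mu A) = 0.
    apply/eqP; rewrite eq_le fine_ge0// andbT leNgt; apply/negP => A0.
    have [e0|e0] := leP e 0.
      suff : mu A = 0%E by move=> A0'; move: A0; rewrite A0' ltxx.
      rewrite (_ : A = set0) ?measure0//.
      apply/seteqP; split=> // x [Dx /= pe]; have /andP[p0 _] := psi0M x Dx.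
      by have := lt_le_trans pe (le_trans e0 p0); rewrite ltxx.
    have c0 : 0 < c by exact: lt_trans ec.
    (* [u >= b] where [psi < e], and [u <= a] where [psi > c]. If [A] had mass, its weight of order
       [b ^+ (2 * n)] would eventually exceed everything the other points contribute, which is of
       order [a ^+ (2 * n)]. *)
    pose a := 1 - c / M; pose b := 1 - e / M.
    have a0 : 0 <= a by rewrite subr_ge0 ler_pdivrMr// mul1r.
    have ab : a < b by rewrite ltrD2l ltrN2 ltr_pM2r// invr_gt0.
    have b0 : 0 < b by exact: le_lt_trans ab.
    have bound n : (c - e) * b ^+ (2 * n) * fine (mu A) <= M * a ^+ (2 * n) * fine (mu D).
      have h : \int[mu]_(x in D) ((c - psi x) * u x ^+ (2 * n)) <= 0.
        have -> : \int[mu]_(x in D) ((c - psi x) * u x ^+ (2 * n)) =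
            \int[mu]_(x in D) (c * u x ^+ (2 * n) - psi x * u x ^+ (2 * n)).
          by apply: eq_Rintegral => x _; rewrite mulrBl.
        rewrite RintegralB//; last by apply: (integrableZl mD c) (iu _).
        by rewrite RintegralZl// subr_le0 H.
      rewrite -(Rintegral_cst mu mD).
      have -> : (c - e) * b ^+ (2 * n) * fine (mu A) =
          \int[mu]_(x in D) ((c - e) * b ^+ (2 * n) * \1_A x).
        have iA : mu.-integrable D (EFin \o (\1_A : T -> R)).
          apply: (@bounded_integrable _ _ 1) => //.
          by move=> x _; rewrite indicE; case: (_ \in _); rewrite /= ?normr1 ?normr0.
        rewrite RintegralZl//; congr (_ * _).
        by rewrite /Rintegral integral_indic// setIidl// => x [].
      apply: (@le_trans _ _ (\int[mu]_(x in D) (M * a ^+ (2 * n)) +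
          \int[mu]_(x in D) ((c - psi x) * u x ^+ (2 * n)))); last by rewrite gerDl.
      have i1 : mu.-integrable D (EFin \o (fun x => M * a ^+ (2 * n))).
        by apply: (@bounded_integrable _ _ `|M * a ^+ (2 * n)|) => //; exact: measurable_cst.
      have i2 : mu.-integrable D (EFin \o (fun x => (c - psi x) * u x ^+ (2 * n))).
        under [X in _.-integrable _ X]funext do rewrite /= mulrBl EFinB.
        apply: (integrableB mD _ (ipu _)); exact: (integrableZl mD c (iu _)).
      rewrite -RintegralD//.
      apply: le_Rintegral => //.
      - apply: (@bounded_integrable _ _ `|(c - e) * b ^+ (2 * n)|) => //.
          by apply: measurable_funM => //; exact: measurable_cst.
        by move=> x _; rewrite normrM ler_piMr// indicE; case: (_ \in _); rewrite /= ?normr1 ?normr0.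
      - under [X in _.-integrable _ X]funext do rewrite /= EFinD.
        exact: integrableD.
      move=> x Dx; have /andP[p0 pM] := psi0M x Dx; have /andP[u0 u1] := u01 x Dx.
      have un0 m : 0 <= u x ^+ m by exact: exprn_ge0.
      have an0 m : 0 <= a ^+ m by exact: exprn_ge0.
      rewrite indicE; have [xA|xA] := boolP (x \in A).
        move: xA; rewrite inE => -[_ /= pe]; rewrite mulr1.
        have bu : b <= u x by rewrite lerD2l lerN2 ler_pM2r ?invr_gt0// ltW.
        have : b ^+ (2 * n) <= u x ^+ (2 * n) by apply: lerXn2r; rewrite ?nnegrE// ltW.
        have := un0 (2 * n)%N; have := an0 (2 * n)%N; have : 0 <= b ^+ (2 * n) by rewrite exprn_ge0// ltW.
        by move: (b ^+ _) (u x ^+ _) (a ^+ _) => x1 x2 x3; nra.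
      rewrite mulr0; have [pc|cp] := leP (psi x) c.
        by rewrite addr_ge0// mulr_ge0// ?subr_ge0// ltW.
      have ua : u x <= a by rewrite lerD2l lerN2 ler_pM2r ?invr_gt0// ltW.
      have : u x ^+ (2 * n) <= a ^+ (2 * n) by apply: lerXn2r; rewrite ?nnegrE.
      have := un0 (2 * n)%N; have := an0 (2 * n)%N.
      by move: (u x ^+ _) (a ^+ _) => x2 x3; nra.
    pose r := (a / b) ^+ 2.
    have ab01 : 0 <= a / b < 1 by rewrite divr_ge0 ?(ltW b0)//= ltr_pdivrMr// mul1r.
    have r01 : `|r| < 1.
      rewrite normrX ger0_norm; last by case/andP: ab01.
      by rewrite exprn_ilt1//; case/andP: ab01.
    have L0 : 0 < (c - e) * fine (mu A) by rewrite mulr_gt0// subr_gt0.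
    have : (fun n => M * fine (mu D) * r ^+ n) @ \oo --> M * fine (mu D) * 0.
      by apply: cvgM; [exact: cvg_cst|exact: cvg_expr].
    rewrite mulr0 => /cvgr0Pnorm_lt /(_ _ L0)[N _ /(_ N (leqnn N))].
    move=> /(le_lt_trans (ler_norm _)); apply/negP; rewrite -leNgt.
    have bN : 0 < b ^+ (2 * N) by rewrite exprn_gt0.
    rewrite -(ler_pM2r bN) /r -exprM expr_div_n.
    have -> : M * fine (mu D) * (a ^+ (2 * N) / b ^+ (2 * N)) * b ^+ (2 * N) =
      M * a ^+ (2 * N) * fine (mu D) by field; rewrite gt_eqF.
    by rewrite mulrAC bound.
  by rewrite -[LHS]fineK ?fA// fin_num_measure.
(* The gap between [a] and [b] required [e < c]; the level [c] itself is reached by a countable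
   union. *)
rewrite (_ : _ `&` _ = \bigcup_n (D `&` [set x | psi x < c - n.+1%:R^-1])); last first.
  apply/seteqP; split=> x /=.
    move=> [Dx pc]; have cp0 : 0 < c - psi x by rewrite subr_gt0.
    exists (Num.bound (c - psi x)^-1) => //; split=> //=.
    rewrite ltrBrDr -ltrBrDl.
    rewrite invf_plt ?posrE ?ltr0n//.
    have : (c - psi x)^-1 < (Num.bound (c - psi x)^-1)%:R.
      by apply: archi_boundP; rewrite invr_ge0 ltW.
    by move=> /lt_trans; apply; rewrite ltr_nat.
  move=> [n _ [Dx /= h]]; split=> //; apply: (lt_le_trans h).
  by rewrite gerBl invr_ge0.
apply: measure_negligible; first by apply: bigcupT_measurable => n; exact: mlt.
apply: negligible_bigcup => n; apply/negligibleP; first exact: mlt.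
by apply: key; rewrite gtrBl invr_gt0 ltr0n.
Qed.

End bounded_integrals.

Lemma measure_decreasing_small d (T : measurableType d) (R : realType)
    (mu : {finite_measure set T -> \bar R}) (D : nat -> set T) (e : \bar R) :
  (forall n, measurable (D n)) -> (forall m n, (m <= n)%N -> D n `<=` D m) ->
  (mu (\bigcap_n D n) < e)%E -> exists n, (mu (D n) < e)%E.
Proof.
move=> mD dD; apply: contraPP => /forallNP h; apply/negP; rewrite -leNgt.
have cvg : mu (D n) @[n --> \oo] --> mu (\bigcap_n D n).
  apply: nonincreasing_cvg_mu => //.
  - by rewrite ltey_eq fin_num_measure.
  - exact: bigcapT_measurable.
  - by move=> m n mn; apply/subsetPset; exact: dD.
apply: (cvge_ge _ cvg).
by apply: nearW => n; rewrite leNgt; apply/negP; exact: h.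
Qed.

(** * Regularity of finite measures on the line *)

Section regularity.
Context (R : realType).
Variable mu : {finite_measure set (measurableTypeR R) -> \bar R}.

(** Inner and outer approximation are measured by the single gap between [C] and [U], and [C] is
    closed rather than compact, so that the condition is symmetric under complements. *)
Let approx (A : set (measurableTypeR R)) := measurable A /\
  forall e : R, 0 < e -> exists (C : set R) (U : set R),
    [/\ closed C, open U, C `<=` A, A `<=` U & (mu (U `\` C) < e%:E)%E].

Let open_m (U : set R) : open U -> measurable (U : set (measurableTypeR R)).
Proof. exact: open_measurable. Qed.

Let closed_m (U : set R) : closed U -> measurable (U : set (measurableTypeR R)).
Proof. exact: closed_measurable. Qed.

Let approxC A : approx A -> approx (~` A).
Proof.
move=> [mA h]; split; first exact: measurableC.
move=> e e0; have [C [U [cC oU CA AU h']]] := h e e0.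
exists (~` U), (~` C); split.
- exact: open_closedC.
- exact: closed_openC.
- exact: subsetC.
- exact: subsetC.
- by rewrite setDE setCK setIC -setDE.
Qed.

(** The union of the closed sets need not be closed, so it is cut to a finite union. The gaps e / 2
    / 2^(n + 1) add up to e / 2, which leaves room for the cut by continuity from above. *)
Let approx_bigcup (F : nat -> set (measurableTypeR R)) :
  (forall n, approx (F n)) -> approx (\bigcup_n F n).
Proof.
move=> hF; split; first by apply: bigcupT_measurable => n; case: (hF n).
move=> e e0.
have e2n n : 0 < e / 2 / (2 ^ n.+1)%:R :> R.
  by rewrite !divr_gt0// ltr0n expn_gt0.
have /choice[CU hCU] n : exists CU : set R * set R,
    [/\ closed CU.1, open CU.2, CU.1 `<=` F n, F n `<=` CU.2 &
     (mu (CU.2 `\` CU.1) < (e / 2 / (2 ^ n.+1)%:R)%:E)%E].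
  by have [_ /(_ _ (e2n n))[C [U h]]] := hF n; exists (C, U).
pose U := \bigcup_n (CU n).2; pose C n := \big[setU/set0]_(i < n) (CU i).1.
have CE n : C n = \bigcup_(i < n) (CU i).1.
  by rewrite /C (bigcup_mkord n (fun i => (CU i).1)).
have oU : open U by apply: bigcup_open => n _; case: (hCU n).
have cC n : closed (C n).
  by apply: closed_bigsetU => i _; case: (hCU i).
have mC1 n : measurable ((CU n).1 : set (measurableTypeR R)) by apply: closed_m; case: (hCU n).
have mU2 n : measurable ((CU n).2 : set (measurableTypeR R)) by apply: open_m; case: (hCU n).
have mUC1 n : measurable ((CU n).2 `\` (CU n).1 : set (measurableTypeR R)) by exact: measurableD.
have mUC n : measurable (U `\` C n : set (measurableTypeR R)).
  by apply: measurableD; [exact: open_m|exact: closed_m].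
have mUC2 : measurable (U `\` \bigcup_n (CU n).1 : set (measurableTypeR R)).
  by apply: measurableD; [exact: open_m|exact: bigcupT_measurable].
have tail : (mu (U `\` \bigcup_n (CU n).1) <= (e / 2)%:E)%E.
  apply: (@le_trans _ _ (\sum_(n <oo) mu ((CU n).2 `\` (CU n).1))%E).
    apply: measure_sigma_subadditive => //.
    by move=> x [[n _ Unx] nC]; exists n => //; split=> // Cx; apply: nC; exists n.
  apply: (@le_trans _ _ (\sum_(n <oo) (0 + (e / 2 / (2 ^ n.+1)%:R)%:E))%E).
    by apply: lee_nneseries => // n _; rewrite add0e ltW//; case: (hCU n).
  apply: (le_trans (epsilon_trick _ _ _)) => //; first by rewrite ltW// divr_gt0.
  by rewrite eseries0// add0e.
have [N hN] : exists N, (mu (U `\` C N) < e%:E)%E.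
  apply: measure_decreasing_small => //.
    move=> m n mn x [Ux nC]; split=> // Cx; apply: nC.
    by move: Cx; rewrite !CE => -[i im Cx]; exists i => //=; exact: leq_trans im mn.
  rewrite (_ : \bigcap_n _ = U `\` \bigcup_n (CU n).1).
    by apply: (le_lt_trans tail); rewrite lte_fin; lra.
  apply/seteqP; split=> x.
    move=> h; split; first by case: (h 0%N I).
    move=> [n _ Cx]; case: (h n.+1 I) => _; apply; rewrite CE; exists n => //=.
  move=> [Ux nC] n _; split=> //; rewrite CE => -[i _ Cx].
  by apply: nC; exists i.
exists (C N), U; split=> //.
- by rewrite CE => x [i _ Cx]; exists i => //; case: (hCU i) => _ _ + _ _; apply.
- by move=> x [n _ Fx]; exists n => //; case: (hCU n) => _ _ _ + _; apply.
Qed.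

(** The closed intervals [a + 1/(n + 1), b] and the open intervals ]a, b + 1/(n + 1)[ have gaps that
    decrease to the empty set. *)
Let approx_itv (a b : R) : approx `]a, b]%classic.
Proof.
split; first exact: measurable_itv.
move=> e e0.
pose D n : set R := `]a, (b + n.+1%:R^-1)[%classic `\` `[(a + n.+1%:R^-1), b]%classic.
have small (y : R) : 0 < y -> exists n, n.+1%:R^-1 < y.
  move=> y0; exists (Num.bound y^-1); rewrite invf_plt ?posrE ?ltr0n//.
  have : y^-1 < (Num.bound y^-1)%:R by apply: archi_boundP; rewrite invr_ge0 ltW.
  by move=> /lt_trans; apply; rewrite ltr_nat.
have Dmono m n : (m <= n)%N -> D n `<=` D m.
  move=> mn x; rewrite /D /= !in_itv/= => -[/andP[ax xb] /negP h].
  have inv : n.+1%:R^-1 <= m.+1%:R^-1 :> R by rewrite lef_pV2 ?posrE ?ltr0n// ler_nat.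
  split; first by rewrite ax (lt_le_trans xb)// lerD2l.
  apply/negP; apply: contra h => /andP[h1 ->]; rewrite andbT.
  by apply: le_trans h1; rewrite lerD2l.
have D0 : \bigcap_n D n = set0 :> set R.
  apply/seteqP; split=> // x h.
  have ax : a < x by case: (h 0%N I) => /=; rewrite in_itv/= => /andP[].
  have [bx|xb] := ltP b x.
    have [n hn] := small (x - b) ltac:(by rewrite subr_gt0).
    case: (h n I) => /=; rewrite in_itv/= => /andP[_ + _].
    by rewrite ltNge => /negP; apply; rewrite -lerBrDl; exact: ltW.
  have [n hn] := small (x - a) ltac:(by rewrite subr_gt0).
  by case: (h n I) => /= _; apply; rewrite in_itv/= xb andbT -lerBrDl; exact: ltW.
have [N hN] : exists N, (mu (D N) < e%:E)%E.
  apply: measure_decreasing_small => //.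
    by move=> n; apply: measurableD; exact: measurable_itv.
  by rewrite (_ : \bigcap_n _ = set0) ?measure0 ?lte_fin.
exists `[(a + N.+1%:R^-1), b]%classic, `]a, (b + N.+1%:R^-1)[%classic; split=> //.
- exact: itv_closed.
- move=> x /=; rewrite !in_itv/= => /andP[h ->]; rewrite andbT (lt_le_trans _ h)//.
  by rewrite ltrDl invr_gt0.
- move=> x /=; rewrite !in_itv/= => /andP[-> h]; rewrite /= (le_lt_trans h)//.
  by rewrite ltrDl invr_gt0.
Qed.

Let approx_measurable A : measurable A -> approx A.
Proof.
move=> mA.
suff : [set A | approx A] A by [].
apply: mA; split.
  split.
  - have e0 : `]1, 0]%classic = set0 :> set R by apply: set_itv_ge; rewrite bnd_simp ltr10.
    by have := approx_itv 1 0; rewrite e0.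
  - by move=> B aB; rewrite setTD; exact: approxC.
  - by move=> F; exact: approx_bigcup.
by move=> _ [[a b] _ <-] /=; exact: approx_itv.
Qed.

Lemma finite_measure_regular : regular_measure mu.
Proof.
move=> A mA; have [_ h] := approx_measurable mA.
have finm B : measurable B -> mu B \is a fin_num by exact: fin_num_measure.
split.
  apply/eqP; rewrite eq_le; apply/andP; split.
    apply: le_ereal_inf_tmp => _ [U [oU AU] <-]; apply: le_measure; rewrite ?inE//.
    exact: open_m.
  apply/lee_addgt0Pr => e e0; have [C [U [cC oU CA AU hUC]]] := h e e0.
  apply: (@le_trans _ _ (mu U)); first by apply: ereal_inf_lbound; exists U.
  have -> : U = A `|` (U `\` A) by rewrite setDUK.
  apply: (le_trans (measureU2 _ _ _)) => //.
    by apply: measurableD => //; exact: open_m.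
  rewrite leeD2l//; apply/ltW; apply: le_lt_trans hUC; apply: le_measure; rewrite ?inE.
  - by apply: measurableD => //; exact: open_m.
  - by apply: measurableD; [exact: open_m|exact: closed_m].
  - by move=> x [Ux nA]; split=> // /CA.
apply/eqP; rewrite eq_le; apply/andP; split; last first.
  apply: ge_ereal_sup => _ [K [cK KA] <-]; apply: le_measure; rewrite ?inE//.
  by apply: closed_m; apply: compact_closed => //; exact: Rhausdorff.
apply/lee_addgt0Pr => e e0.
have [C [U [cC oU CA AU hUC]]] := h (e / 2) ltac:(by rewrite divr_gt0).
have mC := closed_m cC.
(* Cutting [C] with a large segment makes it compact; the mass lost tends to 0, and [e] is shared
   evenly between this loss and the gap of [C] in [U]. *)
pose D n : set R := C `\` `[- n%:R, n%:R]%classic.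
have mK n : measurable (`[- n%:R, n%:R]%classic : set (measurableTypeR R)) by exact: measurable_itv.
have D0 : \bigcap_n D n = set0 :> set R.
  apply/seteqP; split=> // x h'; case: (h' (Num.bound `|x|) I) => _; apply.
  by rewrite /= in_itv/= -ler_norml ltW// archi_boundP.
have [N hN] : exists N, (mu (D N) < (e / 2)%:E)%E.
  apply: measure_decreasing_small.
  - by move=> n; apply: measurableD.
  - move=> m n mn x [Cx h']; split=> // h2; apply: h'; move: h2 => /=; rewrite !in_itv/=.
    have : m%:R <= n%:R :> R by rewrite ler_nat.
    by move=> mn' /andP[h1 h2]; rewrite (le_trans h2)// (le_trans _ h1)// lerN2.
  by rewrite (_ : \bigcap_n _ = set0) ?measure0 ?lte_fin ?divr_gt0.
pose K := C `&` `[- N%:R, N%:R]%classic.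
have cK : compact K.
  apply: (subclosed_compact _ (@segment_compact R (- N%:R) N%:R)).
    by apply: closedI => //; exact: itv_closed.
  by move=> x [].
have mKK : measurable (K : set (measurableTypeR R)) by exact: measurableI.
apply: (@le_trans _ _ (mu K + e%:E)%E); last first.
  by rewrite leeD2r//; apply: ereal_sup_ubound; exists K => //; split=> // x [/CA].
have sub : A `<=` K `|` (D N `|` (U `\` C)).
  move=> x Ax; have [Cx|nC] := pselect (C x); last by right; right; split=> //; exact: AU.
  by have [Kx|nK] := pselect (`[- N%:R, N%:R]%classic x); [left|right; left].
have mDN : measurable (D N : set (measurableTypeR R)) by exact: measurableD.
have mUC : measurable (U `\` C : set (measurableTypeR R)) by apply: measurableD => //; exact: open_m.
apply: (@le_trans _ _ (mu (K `|` (D N `|` (U `\` C))))).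
  by apply: le_measure; rewrite ?inE//; apply: measurableU => //; exact: measurableU.
apply: (le_trans (measureU2 _ _ _)) => //; first exact: measurableU.
rewrite leeD2l//; apply: (le_trans (measureU2 _ _ _)) => //.
apply: (@le_trans _ _ ((e / 2)%:E + (e / 2)%:E)%E); first by apply: leeD; exact: ltW.
by rewrite -EFinD lee_fin; lra.
Qed.

End regularity.

(** * Symmetric contractions *)

Section polynomial_integrals.
Context (R : realType) (nu : {finite_measure set (measurableTypeR R) -> \bar R}) (a b : R).

Lemma poly_integrable (p : {poly R}) : nu.-integrable `[a, b] (EFin \o horner p).
Proof. by apply: continuous_itv_integrable; exact: continuous_horner. Qed.

Lemma Rintegral_poly (p : {poly R}) :
  \int[nu]_(x in `[a, b]) p.[x] = \sum_(i < size p) p`_i * \int[nu]_(x in `[a, b]) x ^+ i.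
Proof.
have mI : measurable (`[a, b]%classic : set (measurableTypeR R)) by exact: measurable_itv.
have [n] := ubnP (size p); elim: n p => // n IH p sp.
have iX i : nu.-integrable `[a, b] (EFin \o (fun x : R => x ^+ i)).
  by apply: continuous_itv_integrable; exact: exprn_continuous.
suff h m : \int[nu]_(x in `[a, b]) (\sum_(i < m) p`_i * x ^+ i) =
    \sum_(i < m) p`_i * \int[nu]_(x in `[a, b]) x ^+ i /\
    nu.-integrable `[a, b] (EFin \o (fun x : R => \sum_(i < m) p`_i * x ^+ i)).
  rewrite -(proj1 (h (size p))); apply: eq_Rintegral => x _.
  by rewrite horner_coef.
elim: m => [|m [e1 i1]].
  under eq_Rintegral do rewrite big_ord0.
  under [X in _.-integrable _ X]funext do rewrite /= big_ord0.
  by rewrite big_ord0 Rintegral_cst// mul0r; split=> //; exact: integrable0.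
have i2 : nu.-integrable `[a, b] (EFin \o (fun x : R => p`_m * x ^+ m)).
  by apply: (integrableZl mI _) (iX m).
under eq_Rintegral do rewrite big_ord_recr/=.
under [X in _.-integrable _ X]funext do rewrite /= big_ord_recr/= EFinD.
split; last exact: integrableD.
by rewrite RintegralD// e1 RintegralZl// big_ord_recr.
Qed.

End polynomial_integrals.

(** * Measures representing positive functionals on polynomials *)

Section moment_measures.
Context (R : realType) (L : {scalar {poly R}}).

Lemma scalar_polyE (p : {poly R}) : L p = \sum_(i < size p) p`_i * L 'X^i.
Proof.
rewrite -{1}[p]coefK poly_def linear_sum; apply: eq_bigr => i _.
by rewrite linearZ.
Qed.

Lemma moment_measure01 :
  (forall p, 0 <= L (p ^+ 2)) -> (forall p, 0 <= L ('X * p ^+ 2)) ->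
  (forall p, 0 <= L ((1 - 'X) * p ^+ 2)) ->
  exists nu : {finite_measure set (measurableTypeR R) -> \bar R},
    nu (~` `[0, 1]) = 0%E /\ forall p, \int[nu]_(x in `[0, 1]) p.[x] = L p.
Proof.
move=> h1 h2 h3; have [nu [n0 nm]] := hausdorff_moment h1 h2 h3.
exists nu; split=> // p; rewrite Rintegral_poly scalar_polyE.
by apply: eq_bigr => i _; rewrite nm.
Qed.

End moment_measures.

(** The substitution (X + 1) / 2 carries [-1, 1] to [0, 1], and the measure comes back along y |-> 2
    y - 1. Positivity on squares follows from the two hypotheses, as 2 p^2 = (1 + X) p^2 + (1 - X)
    p^2. *)
Lemma moment_measure11 (R : realType) (L : {scalar {poly R}}) :
  (forall p, 0 <= L ((1 + 'X) * p ^+ 2)) -> (forall p, 0 <= L ((1 - 'X) * p ^+ 2)) ->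
  exists F : {finite_measure set (measurableTypeR R) -> \bar R},
    F (~` `[-1, 1]) = 0%E /\ forall p, \int[F]_(x in `[-1, 1]) p.[x] = L p.
Proof.
move=> hp hm.
pose q : {poly R} := 2^-1 *: ('X + 1).
pose L' : {scalar {poly R}} := L \o comp_poly q.
have L'E p : L' p = L (p \Po q) by [].
have half0 : 0 <= 2^-1 :> R by rewrite invr_ge0.
have q1 : 1 - q = 2^-1 *: (1 - 'X).
  apply/polyP => i; rewrite !(coefB, coefZ, coefD, coef1, coefX).
  by case: i => [|[|i]] /=; lra.
have [|p|p|nu [n0 nm]] := @moment_measure01 R L'.
- move=> p; rewrite L'E rmorphXn /=.
  have -> : (p \Po q) ^+ 2 = 2^-1 *: ((1 + 'X) * (p \Po q) ^+ 2) + 2^-1 *: ((1 - 'X) * (p \Po q) ^+ 2).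
    rewrite -scalerDr -mulrDl (_ : 1 + 'X + (1 - 'X) = 2%:R); last by ring.
    by rewrite mulr_natl -(scaler_nat 2 ((p \Po q) ^+ 2)) scalerA mulVf ?pnatr_eq0// scale1r.
  by rewrite linearD !linearZ /= addr_ge0// mulr_ge0.
- rewrite L'E rmorphM rmorphXn /= comp_polyX /q addrC -scalerAl linearZ /=.
  by rewrite mulr_ge0.
- rewrite L'E rmorphM rmorphXn rmorphB rmorph1 /= comp_polyX q1 -scalerAl linearZ /=.
  by rewrite mulr_ge0.
pose phi (y : measurableTypeR R) : measurableTypeR R := 2 * y - 1.
have mphi : measurable_fun setT phi.
  apply: measurable_funB; last exact: measurable_cst.
  by apply: measurable_funM; [exact: measurable_cst|exact: measurable_id].
have itvE (x : R) : (-1 <= 2 * x - 1 <= 1) = (0 <= x <= 1).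
  by apply/andP/andP => -[? ?]; split; lra.
have pre : phi @^-1` `[-1, 1]%classic = `[0, 1]%classic.
  by apply/seteqP; split=> x; rewrite /phi /= !in_itv/= itvE.
pose pm : {measure set (measurableTypeR R) -> \bar R} :=
  measure_function_pushforward__canonical__measure_function_Measure nu mphi.
have [F FE] : exists F : {finite_measure set (measurableTypeR R) -> \bar R}, forall A, F A = pm A.
  by apply: finite_measureW; rewrite /= /pushforward preimage_setT ltey_eq fin_num_measure.
exists F; split.
  rewrite (FE (~` `[-1, 1]%classic)).
  change (nu (~` (phi @^-1` `[-1, 1]%classic)) = 0%E).
  by rewrite pre.
move=> p.
transitivity (fine (\int[pm]_(x in `[-1, 1]) (p.[x])%:E)).
  by congr fine; apply: eq_measure_integral => A mA _; exact: FE.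
have pE x : (p \Po (2 *: 'X - 1)).[x] = p.[phi x].
  by rewrite horner_comp /phi !hornerE.
transitivity (\int[nu]_(x in `[0, 1]) (p \Po (2 *: 'X - 1)).[x]).
  congr fine; under [RHS]eq_integral do rewrite pE.
  rewrite -pre.
  apply: (@integral_pushforward _ _ _ _ _ _ mphi nu `[-1, 1]%classic (fun y => (p.[y])%:E)).
  - by apply/measurable_EFinP; apply: continuous_measurable_fun; exact: continuous_horner.
  - rewrite pre; have := poly_integrable nu 0 1 (p \Po (2 *: 'X - 1)).
    by under [X in _.-integrable _ X -> _]funext do rewrite /= pE.
  - exact: measurable_itv.
rewrite nm L'E -comp_polyA; congr (L _).
rewrite (_ : (2 *: 'X - 1) \Po q = 'X) ?comp_polyXr//.
rewrite comp_polyB comp_polyZ comp_polyX -polyC1 comp_polyC /q scalerA mulfV ?scale1r ?pnatr_eq0//.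
by rewrite polyC1 addrK.
Qed.

Lemma poly_bounded_itv (R : realType) (p : {poly R}) (a b : R) :
  exists2 M, 0 < M & forall x, a <= x <= b -> `|p.[x]| <= M.
Proof.
have : compact (horner p @` `[a, b]).
  apply: continuous_compact; last exact: segment_compact.
  apply: continuous_subspaceT; exact: continuous_horner.
move=> /compact_bounded [M [Mr h]]; exists (`|M| + 1) => [|x xab].
  by rewrite ltr_wpDl.
by apply: (h (`|M| + 1)); [rewrite (le_lt_trans (ler_norm _))// ltrDl|exists x].
Qed.

(** * Null sets detected by polynomials *)

Section null_sets.
Context (R : realType) (F : {finite_measure set (measurableTypeR R) -> \bar R}).

(** For a polynomial [psi] the peaking weights are themselves squares of polynomials, namely of
    [(1 - psi / M) ^+ n], so it is enough to test the hypothesis on squares. *)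
Lemma poly_peak (a b c : R) (psi : {poly R}) :
  (forall x, a <= x <= b -> 0 <= psi.[x]) ->
  (forall p : {poly R}, c * \int[F]_(x in `[a, b]) (p ^+ 2).[x] <=
     \int[F]_(x in `[a, b]) (psi * p ^+ 2).[x]) ->
  F (`[a, b] `&` [set x | psi.[x] < c]) = 0%E.
Proof.
move=> psi0 H; have [M0 M00 hM] := poly_bounded_itv psi a b.
pose M := Num.max M0 c.
have Mgt0 : 0 < M by rewrite lt_max M00.
have uE x : 1 - psi.[x] / M = (1 - M^-1 *: psi).[x] by rewrite !hornerE mulrC.
apply: (@peak_support _ _ _ F _ (fun x : measurableTypeR R => psi.[x]) M c) => //.
- by apply/measurable_funTS; apply: continuous_measurable_fun; exact: continuous_horner.
- by rewrite le_max lexx orbT.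
- move=> x; rewrite /= in_itv/= => xab; rewrite psi0//= le_max.
  by rewrite (le_trans (ler_norm _) (hM x xab)).
- move=> n; have := H ((1 - M^-1 *: psi) ^+ n).
  congr (c * _ <= _); apply: eq_Rintegral => x _.
    by rewrite uE !horner_exp -exprM mulnC.
  by rewrite uE hornerM !horner_exp -exprM mulnC.
Qed.

(* Lindelof's argument, through rational intervals. *)
Lemma locally_null (I O : set (measurableTypeR R)) : measurable I -> measurable O ->
  (forall l : R, O l -> exists2 e : R, 0 < e & F (I `&` `](l - e), (l + e)[%classic) = 0%E) ->
  F (I `&` O) = 0%E.
Proof.
move=> mI mO H.
pose J (q : rat * rat) : set R := `](ratr q.1), (ratr q.2)[%classic.
pose N n : set (measurableTypeR R) := if unpickle n is Some q then
  if `[< F (I `&` J q) = 0%E >] then I `&` J q else set0 else set0.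
have mN n : measurable (N n) /\ F (N n) = 0%E.
  rewrite /N; case: (unpickle n) => [q|]; last by rewrite measure0.
  case: asboolP => [h|_]; last by rewrite measure0.
  by split=> //; apply: measurableI => //; exact: measurable_itv.
suff sub : I `&` O `<=` \bigcup_n N n.
  apply: measure_negligible; first exact: measurableI.
  apply: (negligibleS sub); apply: negligible_bigcup => n.
  by have [mNn Nn] := mN n; apply/negligibleP.
move=> l [Il Ol]; have [e e0 he] := H l Ol.
have [p /= hp] := @rat_in_itvoo R (l - e) l ltac:(by rewrite gtrBl).
have [q /= hq] := @rat_in_itvoo R l (l + e) ltac:(by rewrite ltrDl).
move: hp hq; rewrite !in_itv/= => /andP[p1 p2] /andP[q1 q2].
have [k hk] : exists k, unpickle k = Some (p, q) by exists (pickle (p, q)); exact: pickleK.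
exists k => //; rewrite /N hk.
case: asboolP => [_|]; first by split=> //; rewrite /J /= in_itv/= p2 q1.
case; apply: (subset_measure0 _ _ _ he).
- by apply: measurableI => //; exact: measurable_itv.
- by apply: measurableI => //; exact: measurable_itv.
- move=> x [Ix]; rewrite /J /= !in_itv/= => /andP[h1 h2]; split=> //.
  by rewrite (lt_trans p1 h1) (lt_trans h2 q2).
Qed.

Lemma Rintegral_null_setD (I O : set (measurableTypeR R)) (f : R -> R) :
  measurable I -> measurable O -> O `<=` I -> F (I `\` O) = 0%E ->
  F.-integrable I (EFin \o f) ->
  (\int[F]_(x in O) (f x)%:E)%E = (\int[F]_(x in I) f x)%:E.
Proof.
move=> mI mO OI F0 fi.
rewrite /Rintegral fineK; last exact: integrable_fin_num.
rewrite [RHS](@negligible_integral _ _ _ F I (I `\` O))//; last exact: measurableD.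
by rewrite setDD setIidr.
Qed.

End null_sets.

(* An abstract model of [L^2]: [B] is only a semi-inner product, vectors being
   functions rather than classes, and [T] is self-adjoint, hence linear, only
   up to vectors of norm zero. *)
Section contraction.
Context (R : realType) (V : lmodType R) (B : V -> V -> R) (T : V -> V).
Hypothesis B_sym : forall u v, B u v = B v u.
Hypothesis B_lin : forall a u v w, B (a *: u + v) w = a * B u w + B v w.
Hypothesis B_ge0 : forall u, 0 <= B u u.
Hypothesis T_sym : forall u v, B (T u) v = B u (T v).
Hypothesis T_contr : forall u, B (T u) (T u) <= B u u.

Lemma formDl u v w : B (u + v) w = B u w + B v w.
Proof. by rewrite -[u]scale1r B_lin mul1r scale1r. Qed.
Lemma form0l w : B 0 w = 0.
Proof. by have := formDl 0 0 w; rewrite addr0; lra. Qed.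
Lemma formZl a u w : B (a *: u) w = a * B u w.
Proof. by rewrite -[_ *: u]addr0 B_lin form0l addr0. Qed.
Lemma formNl u w : B (- u) w = - B u w.
Proof. by rewrite -scaleN1r formZl mulN1r. Qed.
Lemma formDr u v w : B w (u + v) = B w u + B w v.
Proof. by rewrite ![B w _]B_sym formDl. Qed.
Lemma formZr a u w : B w (a *: u) = a * B w u.
Proof. by rewrite ![B w _]B_sym formZl. Qed.
Lemma formNr u w : B w (- u) = - B w u.
Proof. by rewrite ![B w _]B_sym formNl. Qed.
Lemma form_suml (I : Type) (r : seq I) (F : I -> V) w :
  B (\sum_(i <- r) F i) w = \sum_(i <- r) B (F i) w.
Proof. by elim/big_rec2: _ => [|i a b _ <-]; rewrite ?form0l ?formDl. Qed.

Definition form_eq u v := forall w, B u w = B v w.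

Lemma cauchy_schwarz u v : B u v ^+ 2 <= B u u * B v v.
Proof.
have h (a b : R) : 0 <= a ^+ 2 * B u u + 2 * a * b * B u v + b ^+ 2 * B v v.
  have := B_ge0 (a *: u + b *: v).
  rewrite formDl !formDr !formZl !formZr (B_sym v u).
  by rewrite [X in 0 <= X -> _](_ : _ = a ^+ 2 * B u u + 2 * a * b * B u v + b ^+ 2 * B v v)//; ring.
have u0 := B_ge0 u; have v0 := B_ge0 v.
have := h (B v v) (- B u v).
have [v00|vn0] := eqVneq (B v v) 0.
  move=> _; rewrite v00 mulr0 leNgt; apply/negP => xp.
  (* When [B v v = 0] the form is affine in the coefficient of [v]; this coefficient makes it
     [- B u u - 2], which is negative. *)
  have := h 1 (- B u v * ((B u u + 1) / B u v ^+ 2)).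
  have -> : 1 ^+ 2 * B u u + 2 * 1 * (- B u v * ((B u u + 1) / B u v ^+ 2)) * B u v +
    (- B u v * ((B u u + 1) / B u v ^+ 2)) ^+ 2 * B v v = - B u u - 2.
    rewrite v00 mulr0 addr0; field.
    by apply: contraTN xp => /eqP ->; rewrite expr0n ltxx.
  by lra.
have vp : 0 < B v v by rewrite lt_def vn0.
move=> h1; rewrite -subr_ge0 -(pmulr_rge0 _ vp).
by apply: le_trans h1 _; rewrite le_eqVlt; apply/orP; left; apply/eqP; ring.
Qed.

Lemma form_eq0P u : B u u = 0 <-> form_eq u 0.
Proof.
split=> [u0 w|h]; last by rewrite h form0l.
have := cauchy_schwarz u w; rewrite u0 mul0r form0l => h.
by apply/eqP; rewrite -sqrf_eq0 eq_le h sqr_ge0.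
Qed.

Lemma form_eqP u v : B (u - v) (u - v) = 0 <-> form_eq u v.
Proof.
split=> [/form_eq0P h w|h].
  by apply/eqP; rewrite -subr_eq0 -formNl -formDl h form0l.
by apply/form_eq0P => w; rewrite formDl formNl h subrr form0l.
Qed.

Lemma parallelogram_le u v : B (u + v) (u + v) <= 2 * (B u u + B v v).
Proof.
have := B_ge0 (u - v); rewrite !formDl !formDr !formNl !formNr (B_sym v u) => h; lra.
Qed.

(** Exactly linear in [p], but linear in [u] only up to [form_eq], as [T] is not assumed linear.
    Hence composition and products are compared through [B]. *)
Definition poly_op (p : {poly R}) u := \sum_(i < size p) p`_i *: iter i T u.

Lemma poly_opE n (p : {poly R}) u : (size p <= n)%N -> poly_op p u = \sum_(i < n) p`_i *: iter i T u.
Proof.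
move=> sp; rewrite /poly_op (big_ord_widen _ (fun i => p`_i *: iter i T u) sp).
rewrite big_mkcond/=; apply: eq_bigr => i _.
by case: ltnP => // h; rewrite nth_default// scale0r.
Qed.

Lemma poly_op_lin a (p q : {poly R}) u : poly_op (a *: p + q) u = a *: poly_op p u + poly_op q u.
Proof.
pose n := maxn (size (a *: p + q)) (maxn (size p) (size q)).
rewrite !(@poly_opE n) ?leq_max ?leqnn ?orbT//.
rewrite scaler_sumr -big_split; apply: eq_bigr => i _ /=.
by rewrite coefD coefZ scalerDl scalerA.
Qed.

Lemma poly_opD (p q : {poly R}) u : poly_op (p + q) u = poly_op p u + poly_op q u.
Proof. by rewrite -[p]scale1r poly_op_lin !scale1r. Qed.
Lemma poly_op0 u : poly_op 0 u = 0.
Proof. by rewrite /poly_op size_poly0 big_ord0. Qed.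
Lemma poly_opZ a (p : {poly R}) u : poly_op (a *: p) u = a *: poly_op p u.
Proof. by rewrite -[_ *: p]addr0 poly_op_lin poly_op0 addr0. Qed.
Lemma poly_opB (p q : {poly R}) u : poly_op (p - q) u = poly_op p u - poly_op q u.
Proof. by rewrite -(scaleN1r q) poly_opD poly_opZ scaleN1r. Qed.

Lemma poly_opXn n u : poly_op 'X^n u = iter n T u.
Proof.
rewrite /poly_op size_polyXn big_ord_recr /= coefXn eqxx scale1r big1 ?add0r// => i _.
by rewrite coefXn ltn_eqF// scale0r.
Qed.

Lemma poly_opC c u : poly_op c%:P u = c *: u.
Proof. by rewrite (@poly_opE 1) ?size_polyC ?leq_b1// big_ord1 coefC. Qed.

Lemma iter_sym n u v : B (iter n T u) v = B u (iter n T v).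
Proof. by elim: n u v => // n IH u v; rewrite iterS T_sym IH -iterSr. Qed.

Lemma poly_op_sym p u v : B (poly_op p u) v = B u (poly_op p v).
Proof.
rewrite [RHS]B_sym !form_suml; apply: eq_bigr => i _.
by rewrite !formZl iter_sym B_sym.
Qed.

Lemma poly_linear_ext (F G : {poly R} -> R) :
  (forall a p q, F (a *: p + q) = a * F p + F q) ->
  (forall a p q, G (a *: p + q) = a * G p + G q) ->
  (forall n, F 'X^n = G 'X^n) -> forall p, F p = G p.
Proof.
move=> Flin Glin FG p.
have F0 : F 0 = 0 by have := Flin 1 0 0; rewrite scaler0 addr0 mul1r; lra.
have G0 : G 0 = 0 by have := Glin 1 0 0; rewrite scaler0 addr0 mul1r; lra.
rewrite -[p]coefK poly_def.
elim/big_rec: _ => [|i r _ IH]; first by rewrite F0 G0.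
by rewrite Flin Glin FG IH.
Qed.

Lemma poly_opM (p q : {poly R}) u v :
  B (poly_op (p * q) u) v = B (poly_op q u) (poly_op p v).
Proof.
move: p; apply: poly_linear_ext => [a p r|a p r|i].
- by rewrite mulrDl -scalerAl poly_op_lin B_lin.
- by rewrite poly_op_lin formDr formZr.
move: q; apply: poly_linear_ext => [a p r|a p r|j].
- by rewrite mulrDr -scalerAr poly_op_lin B_lin.
- by rewrite poly_op_lin B_lin.
by rewrite -exprD !poly_opXn -[in RHS]iter_sym iterD.
Qed.

Lemma poly_op_comp (p q : {poly R}) u : form_eq (poly_op p (poly_op q u)) (poly_op (p * q) u).
Proof. by move=> w; rewrite poly_opM poly_op_sym. Qed.

Lemma form_eqr u v w : form_eq u v -> B w u = B w v.
Proof. by move=> h; rewrite !(B_sym w) h. Qed.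
Lemma form_eq2 u v : form_eq u v -> B u u = B v v.
Proof. by move=> h; rewrite h (form_eqr _ h). Qed.

(** Expand the squared norms of [u + T u] and [u - T u] and bound [B (T u) (T u)] by [B u u]. This
    is the positivity of 1 + T and 1 - T. *)
Lemma contraction_pos u : 0 <= B u u + B u (T u) /\ 0 <= B u u - B u (T u).
Proof.
have := B_ge0 (u + T u); have := B_ge0 (u - T u); have := T_contr u.
rewrite !formDl !formDr !formNl !formNr (B_sym (T u) u); lra.
Qed.

Lemma spectral_functional u : exists L : {scalar {poly R}}, forall p, L p = B u (poly_op p u).
Proof.
have lin : scalar (fun p : {poly R} => B u (poly_op p u)).
  by move=> a p q; rewrite poly_op_lin formDr formZr.
pose L : {scalar {poly R}} := HB.pack_for {scalar {poly R}} (fun p : {poly R} => B u (poly_op p u))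
  (GRing.isLinear.Build R {poly R} R *%R (fun p : {poly R} => B u (poly_op p u)) lin).
by exists L.
Qed.

Definition spectral_measure_of u (F : {finite_measure set (measurableTypeR R) -> \bar R}) :=
  F (~` `[-1, 1]) = 0%E /\
  forall p : {poly R}, \int[F]_(x in `[-1, 1]) p.[x] = B u (poly_op p u).

Lemma spectral_measure_exists u : exists F, spectral_measure_of u F.
Proof.
have [L LE] := spectral_functional u.
have [p|p|F [F0 FL]] := @moment_measure11 R L.
- rewrite LE B_sym expr2 mulrA poly_opM mulrDl mul1r poly_opD formDr.
  rewrite (B_sym _ (poly_op ('X * p) u)) poly_opM -['X]expr1 poly_opXn /=.
  by have [] := contraction_pos (poly_op p u).
- rewrite LE B_sym expr2 mulrA poly_opM mulrBl mul1r poly_opB formDr formNr.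
  rewrite (B_sym _ (poly_op ('X * p) u)) poly_opM -['X]expr1 poly_opXn /=.
  by have [] := contraction_pos (poly_op p u).
by exists F; split=> // p; rewrite FL LE.
Qed.

Lemma poly_op_norm p u : B (poly_op p u) (poly_op p u) = B u (poly_op (p ^+ 2) u).
Proof. by rewrite expr2 [RHS]B_sym poly_opM. Qed.

Definition nrm u := Num.sqrt (B u u).

Lemma nrm_ge0 u : 0 <= nrm u. Proof. exact: sqrtr_ge0. Qed.
Lemma nrm_sqr u : nrm u ^+ 2 = B u u. Proof. by rewrite sqr_sqrtr. Qed.

Lemma form_le_nrm u v : `|B u v| <= nrm u * nrm v.
Proof.
rewrite -(@ler_pXn2r _ 2)// ?nnegrE ?mulr_ge0 ?nrm_ge0//.
by rewrite exprMn !nrm_sqr real_normK ?num_real// cauchy_schwarz.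
Qed.

Lemma nrmD u v : nrm (u + v) <= nrm u + nrm v.
Proof.
rewrite -(@ler_pXn2r _ 2)// ?nnegrE ?addr_ge0 ?nrm_ge0//.
rewrite nrm_sqr formDl !formDr sqrrD !nrm_sqr (B_sym v u).
by have := le_trans (ler_norm _) (form_le_nrm u v); lra.
Qed.

Lemma nrm_eq u v : form_eq u v -> nrm u = nrm v.
Proof. by move=> /form_eq2 h; rewrite /nrm h. Qed.

Lemma nrm_le u b : 0 <= b -> (nrm u <= b) = (B u u <= b ^+ 2).
Proof. by move=> b0; rewrite -(@ler_pXn2r _ 2) ?nnegrE ?nrm_ge0// nrm_sqr. Qed.

Lemma nrmZ a u : nrm (a *: u) = `|a| * nrm u.
Proof. by rewrite /nrm formZl formZr mulrA -expr2 sqrtrM ?sqr_ge0// sqrtr_sqr. Qed.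

Lemma nrmN u : nrm (- u) = nrm u.
Proof. by rewrite -scaleN1r nrmZ normrN1 mul1r. Qed.

(** Expresses, before any spectrum is available, that the polynomial calculus of [T] sees only
    [E]. *)
Definition bounded_on (E : set R) := forall (p : {poly R}) b u, 0 <= b ->
  (forall x, E x -> `|p.[x]| <= b) -> nrm (poly_op p u) <= b * nrm u.

(** The squared norm of p(T) u is the integral of p^2 against [F], and the total mass of [F] is the
    squared norm of [u]. *)
Lemma bounded_at (E : set R) u F (p : {poly R}) b : spectral_measure_of u F ->
  measurable (E : set (measurableTypeR R)) ->
  F (`[-1, 1] `\` E) = 0%E -> 0 <= b ->
  (forall x, E x -> `|p.[x]| <= b) -> nrm (poly_op p u) <= b * nrm u.
Proof.
move=> [F0 FL] mE FE b0 pb.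
have mI : measurable (`[-1, 1]%classic : set (measurableTypeR R)) by exact: measurable_itv.
rewrite nrm_le ?mulr_ge0 ?nrm_ge0// poly_op_norm -FL exprMn nrm_sqr.
have -> : B u u = \int[F]_(x in `[-1, 1]) 1.
  transitivity (\int[F]_(x in `[-1, 1]) (1 : {poly R}).[x]).
    by rewrite FL -polyC1 poly_opC scale1r.
  by apply: eq_Rintegral => x _; rewrite hornerE.
rewrite !Rintegral_cst// mul1r.
rewrite -[leRHS]/(fine ((b ^+ 2 * fine (F `[-1, 1]%classic))%:E)).
apply: fine_le => //.
  exact/integrable_fin_num/poly_integrable.
rewrite EFinM fineK ?fin_num_measure// -integral_cst//.
apply: ae_ge0_le_integral => //.
- by move=> x _; rewrite lee_fin horner_exp sqr_ge0.
- apply/measurable_EFinP/measurable_funTS; apply: continuous_measurable_fun; exact: continuous_horner.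
- by move=> x _; rewrite lee_fin sqr_ge0.
exists (`[-1, 1] `\` E); split=> //; first exact: measurableD.
move=> x /= /not_implyP [xI xp]; split=> // /pb px; apply: xp.
by rewrite lee_fin horner_exp -[leLHS]real_normK ?num_real// lerXn2r// nnegrE.
Qed.

Lemma bounded_on_itv : bounded_on `[-1, 1].
Proof.
move=> p b u b0 pb; have [F hF] := spectral_measure_exists u.
apply: (bounded_at hF) pb => //.
by rewrite setDv measure0.
Qed.

Lemma dominated_cvg0 (x y : nat -> R) : (forall n, `|x n| <= y n) ->
  y n @[n --> \oo] --> 0 -> x n @[n --> \oo] --> 0.
Proof.
move=> xy /cvgr0Pnorm_lt h; apply/cvgr0Pnorm_lt => e e0.
by have := h e e0; apply: filterS => n; apply: le_lt_trans; apply: le_trans (xy n) (ler_norm _).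
Qed.

Definition norm_cvg (x : nat -> V) (l : V) := nrm (x n - l) @[n --> \oo] --> (0 : R).

Lemma norm_cvg_B x l w : norm_cvg x l -> B (x n) w @[n --> \oo] --> B l w.
Proof.
move=> h; apply/subr_cvg0.
apply: (@dominated_cvg0 _ (fun n => nrm (x n - l) * nrm w)) => [n|].
  by rewrite -formNl -formDl form_le_nrm.
by rewrite -(mul0r (nrm w)); apply: cvgM => //; exact: cvg_cst.
Qed.

Lemma norm_cvg_nrm_le x l b : norm_cvg x l -> (forall n, nrm (x n) <= b) -> nrm l <= b.
Proof.
move=> h xb.
have : (fun n => b + nrm (x n - l)) @ \oo --> b + 0 by apply: cvgD => //; exact: cvg_cst.
rewrite addr0 => cv; apply: (ler_cvg_to (cvg_cst (nrm l)) cv); apply: nearW => n.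
rewrite -[l in leLHS](subKr (x n)).
by apply: (le_trans (nrmD _ _)); rewrite nrmN lerD// xb.
Qed.

Hypothesis B_complete : forall x : nat -> V,
  (forall e : R, 0 < e -> exists N, forall m n, (N <= m)%N -> (N <= n)%N -> nrm (x m - x n) <= e) ->
  exists l, norm_cvg x l.

(** * Inversion of a polynomial in the operator *)

Section neumann.
Variables (E : set R) (p : {poly R}) (c C : R).
Hypothesis bE : bounded_on E.
Hypotheses (c0 : 0 < c) (cC : c <= C).
Hypothesis pE : forall x, E x -> c <= p.[x] <= C.

Let C0 : 0 < C. Proof. exact: lt_le_trans cC. Qed.
(** On [E] the values of [k] lie between 0 and [q < 1], so [1 / p = C^-1 / (1 - k)] is a geometric
    series there; since [C^-1 / (1 - q) = c^-1], the tail bounds carry the factor [c^-1]. *)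
Let k : {poly R} := 1 - C^-1 *: p.
Let q : R := 1 - c / C.
Let q0 : 0 <= q. Proof. by rewrite subr_ge0 ler_pdivrMr// mul1r. Qed.
Let q1 : q < 1. Proof. by rewrite gtrBl divr_gt0. Qed.
Let kE x : E x -> `|k.[x]| <= q.
Proof.
move=> /pE/andP[cp pC]; rewrite /k !hornerE ger0_norm.
  by rewrite lerD2l lerN2 (mulrC c) ler_pM2l// invr_gt0.
by rewrite subr_ge0 mulrC ler_pdivrMr// mul1r.
Qed.
Let s n : {poly R} := C^-1 *: \sum_(i < n) k ^+ i.

Let geo_le m n : (m <= n)%N -> \sum_(m <= i < n) q ^+ i <= q ^+ m / (1 - q).
Proof.
move=> mn; rewrite ler_pdivlMr ?subr_gt0//.
rewrite mulr_suml (eq_bigr (fun i => - (q ^+ i.+1 - q ^+ i))); last first.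
  by move=> i _; rewrite exprS; ring.
by rewrite sumrN telescope_sumr// opprB gerBl exprn_ge0.
Qed.

Let s_tail m n u : (m <= n)%N ->
  nrm (poly_op (s n) u - poly_op (s m) u) <= q ^+ m / c * nrm u.
Proof.
move=> mn; rewrite -poly_opB; apply: (bE) => [|x Ex].
  by rewrite divr_ge0 ?exprn_ge0// ltW.
have -> : s n - s m = C^-1 *: \sum_(m <= i < n) k ^+ i.
  rewrite /s -scalerBr -!(big_mkord xpredT (fun i => k ^+ i)).
  by rewrite (@big_cat_nat _ _ _ m 0 n)//= addrAC subrr add0r.
rewrite hornerZ horner_sum normrM ger0_norm ?invr_ge0 ?(ltW C0)//.
apply: (@le_trans _ _ (C^-1 * (q ^+ m / (1 - q)))).
  rewrite ler_wpM2l ?invr_ge0 ?(ltW C0)//; apply: le_trans (geo_le mn).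
  apply: (le_trans (ler_norm_sum _ _ _)); apply: ler_sum => i _.
  by rewrite horner_exp normrX; apply: lerXn2r; rewrite ?nnegrE// kE.
have -> : 1 - q = c / C by rewrite /q; ring.
by rewrite le_eqVlt; apply/orP; left; apply/eqP; field; rewrite !gt_eqF.
Qed.

Let qn_cvg0 (a : R) : q ^+ n * a @[n --> \oo] --> (0 : R).
Proof.
rewrite -(mul0r a); apply: cvgM; last exact: cvg_cst.
by apply: cvg_expr; rewrite ger0_norm.
Qed.

(** [M] is chosen vector by vector, by completeness. The polynomials [s] are kept in the conclusion
    because symmetry of [M] and its commutation with polynomials are derived as limits of theirs. *)
Lemma neumann_inverse : exists M : V -> V, exists s : nat -> {poly R},
  [/\ forall u, norm_cvg (fun n => poly_op (s n) u) (M u),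
      forall u, nrm (M u) <= c^-1 * nrm u &
      forall u, form_eq (poly_op p (M u)) u].
Proof.
have lim_ex u : exists l, norm_cvg (fun n => poly_op (s n) u) l.
  apply: B_complete => e e0.
  have := qn_cvg0 (c^-1 * nrm u).
  move=> /cvgr0Pnorm_lt /(_ _ e0)[N _ hN]; exists N.
  suff h m n : (N <= m)%N -> (m <= n)%N -> nrm (poly_op (s n) u - poly_op (s m) u) <= e.
    move=> m n Nm Nn; have [mn|nm] := leqP n m; first exact: h.
    by rewrite -nrmN opprB; apply: h => //; exact: ltnW.
  move=> Nm mn; apply: (le_trans (s_tail _ mn)).
  by rewrite -mulrA; apply: le_trans (ltW (hN m Nm)); exact: ler_norm.
have [M hM] := choice lim_ex.
exists M, s; split=> // u.
  apply: (norm_cvg_nrm_le (hM u)) => n.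
  have := s_tail u (leq0n n).
  by rewrite {2}/s big_ord0 scaler0 poly_op0 subr0 expr0 mul1r.
move=> w; rewrite poly_op_sym.
have cv1 := norm_cvg_B (w := poly_op p w) (hM u).
have ps n : p * s n = 1 - k ^+ n.
  rewrite -[1 - _]opprB -[k ^+ n - 1]/(k ^+ n - 1) subrX1 -mulNr opprB /k opprB addrCA subrr addr0.
  by rewrite /s -scalerAr -scalerAl.
have cv2 : B (poly_op (s n) u) (poly_op p w) @[n --> \oo] --> B u w.
  under eq_fun do rewrite -poly_opM ps poly_opB formDl formNl.
  rewrite -[B u w]subr0; apply: cvgB.
    by rewrite -polyC1; under eq_fun do rewrite poly_opC scale1r; exact: cvg_cst.
  apply: (@dominated_cvg0 _ (fun n => q ^+ n * (nrm u * nrm w))) => [n|]; last exact: qn_cvg0.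
  rewrite (le_trans (form_le_nrm _ _))// mulrA ler_wpM2r ?nrm_ge0//.
  apply: bE => [|x Ex]; first exact: exprn_ge0.
  by rewrite horner_exp normrX; apply: lerXn2r; rewrite ?nnegrE// kE.
exact: (cvg_unique _ cv1 cv2).
Qed.

End neumann.

(** * The resolvent at a complex point *)

Section resolvent.
Variables (E : set R) (phi : {poly R}) (A : V -> V) (a b c C : R).
Hypothesis bE : bounded_on E.
Hypothesis A_phi : forall u, form_eq (A u) (poly_op phi u).
Hypotheses (c0 : 0 < c) (cC : c <= C).
Hypothesis phiE : forall x, E x -> c <= (phi.[x] - a) ^+ 2 + b ^+ 2 <= C.

(* [G + i H] is the inverse of [A - (a + i b)] on the complexification. *)
Lemma resolvent_exists : exists G H : V -> V -> V, exists2 K : R, 0 <= K & forall f g,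
  [/\ B (G f g) (G f g) + B (H f g) (H f g) <= K * (B f f + B g g),
      form_eq (A (G f g) - a *: G f g + b *: H f g) f,
      form_eq (A (H f g) - a *: H f g - b *: G f g) g,
      form_eq (G (A f - a *: f + b *: g) (A g - a *: g - b *: f)) f &
      form_eq (H (A f - a *: f + b *: g) (A g - a *: g - b *: f)) g].
Proof.
pose phia : {poly R} := phi - a%:P.
(* The squared modulus of phi - (a + i b): it is real, so only a real polynomial has to be
   inverted. *)
pose p : {poly R} := phia ^+ 2 + (b ^+ 2)%:P.
have [|M [s [Ms Mb Mp]]] := @neumann_inverse E p c C bE c0 cC.
  by move=> x /phiE; rewrite /p /phia !hornerE.
have M_sym u v : B (M u) v = B u (M v).
  have c1 := norm_cvg_B (w := v) (Ms u); have c2 := norm_cvg_B (w := u) (Ms v).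
  have c3 : B (poly_op (s n) u) v @[n --> \oo] --> B u (M v).
    by under eq_fun do rewrite poly_op_sym B_sym; rewrite (B_sym u).
  exact: (cvg_unique _ c1 c3).
have M_comm r u v : B (M (poly_op r u)) v = B (M u) (poly_op r v).
  have c1 := norm_cvg_B (w := v) (Ms (poly_op r u)); have c2 := norm_cvg_B (w := poly_op r v) (Ms u).
  have c3 : B (poly_op (s n) (poly_op r u)) v @[n --> \oo] --> B (M u) (poly_op r v).
    under eq_fun do rewrite (poly_op_comp _ _ _ v) mulrC poly_opM.
    exact: c2.
  exact: (cvg_unique _ c1 c3).
have Aa u v : B (A u - a *: u) v = B u (poly_op phia v).
  rewrite formDl formNl formZl A_phi poly_op_sym /phia poly_opB formDr formNr poly_opC formZr.
  by [].
have Mpw u w : B (M u) (poly_op p w) = B u w by rewrite -poly_op_sym Mp.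
have pE w z : B w (poly_op p z) = B w (poly_op phia (poly_op phia z)) + b ^+ 2 * B w z.
  rewrite poly_opD formDr poly_opC formZr; congr (_ + _).
  by rewrite (B_sym w) [RHS]B_sym expr2 poly_op_comp.
have XB f g z : B (A f - a *: f + b *: g) z = B f (poly_op phia z) + b * B g z.
  by rewrite formDl formZl Aa.
have YB f g z : B (A g - a *: g - b *: f) z = B g (poly_op phia z) - b * B f z.
  by rewrite formDl formNl formZl Aa.
have Mc r w : form_eq (M (poly_op r w)) (poly_op r (M w)).
  by move=> z; rewrite M_comm -poly_op_sym.
(* Real and imaginary parts of (phi - a + i b) applied to M f + i M g: the conjugate factor times
   the inverse of the squared modulus. *)
pose G f g := poly_op phia (M f) - b *: M g.
pose H f g := poly_op phia (M g) + b *: M f.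
have bI : exists2 K, 0 <= K & forall u, nrm (poly_op phia (M u)) <= K * nrm u.
  (* On [E] the square of [phia] is at most [C <= (C + 1) ^+ 2], and [M] has norm at most [c^-1]. *)
  exists ((C + 1) / c) => [|u].
    by rewrite divr_ge0 ?(ltW c0)// addr_ge0// ltW// (lt_le_trans c0).
  rewrite -mulrA; apply: (@le_trans _ _ ((C + 1) * nrm (M u))).
    have C0 : 0 < C by exact: lt_le_trans cC.
    apply: bE => [|x /phiE/andP[_ h]]; first by rewrite addr_ge0// ltW.
    have h2 : phia.[x] ^+ 2 <= C.
      by apply: le_trans h; rewrite /phia !hornerE lerDl sqr_ge0.
    rewrite -(@ler_pXn2r _ 2)// ?nnegrE ?addr_ge0 ?(ltW C0)// real_normK ?num_real//.
    by apply: (le_trans h2); nra.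
  by rewrite ler_wpM2l ?Mb// addr_ge0// ltW// (lt_le_trans c0).
have [K K0 hK] := bI.
exists G, H, (4 * (K ^+ 2 + (b / c) ^+ 2)); first by rewrite mulr_ge0// addr_ge0// sqr_ge0.
have GB f g w : B (G f g) w = B (M f) (poly_op phia w) - b * B (M g) w.
  by rewrite /G formDl formNl formZl poly_op_sym.
have HB f g w : B (H f g) w = B (M g) (poly_op phia w) + b * B (M f) w.
  by rewrite /H formDl formZl poly_op_sym.
move=> f g; split.
- have h1 u : B (poly_op phia (M u)) (poly_op phia (M u)) <= K ^+ 2 * B u u.
    by have := hK u; rewrite nrm_le ?mulr_ge0 ?nrm_ge0// exprMn nrm_sqr.
  have h2 u : B (b *: M u) (b *: M u) <= (b / c) ^+ 2 * B u u.
    have := Mb u; rewrite nrm_le ?mulr_ge0 ?invr_ge0 ?nrm_ge0 ?(ltW c0)//.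
    rewrite exprMn nrm_sqr formZl formZr => h.
    have := ler_wpM2l (sqr_ge0 b) h; rewrite expr_div_n; lra.
  have hG := parallelogram_le (poly_op phia (M f)) (- (b *: M g)).
  have hH := parallelogram_le (poly_op phia (M g)) (b *: M f).
  rewrite formNl formNr opprK in hG.
  have := h1 f; have := h1 g; have := h2 f; have := h2 g.
  move: (K ^+ 2) ((b / c) ^+ 2) (sqr_ge0 K) (sqr_ge0 (b / c)) => x y x0 y0 *.
  have := B_ge0 f; have := B_ge0 g; rewrite /G /H; nra.
- move=> w; rewrite formDl formZl Aa GB HB -[RHS]Mpw pE; ring.
- move=> w; rewrite formDl formNl formZl Aa GB HB -[RHS]Mpw pE; ring.
- move=> w; rewrite GB !M_sym XB YB -[RHS](form_eqr f (Mp w)) pE (form_eqr g (Mc phia w)).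
  by rewrite -(poly_op_sym phia f) (form_eqr _ (Mc phia w)) poly_op_sym; ring.
- move=> w; rewrite HB !M_sym XB YB -[RHS](form_eqr g (Mp w)) pE (form_eqr f (Mc phia w)).
  by rewrite -(poly_op_sym phia g) (form_eqr _ (Mc phia w)) poly_op_sym; ring.
Qed.

End resolvent.

(** * Approximate spectrum and carriers of spectral measures *)

Definition bounded_below (phi : {poly R}) (l : R) :=
  exists2 c, 0 < c & forall f, c * nrm f <= nrm (poly_op phi f - l *: f).

(** Applied to f = p(T) u and squared, the lower bound becomes the hypothesis of [poly_peak] for
    [(phi - l) ^+ 2]. *)
Lemma spectral_measure_null phi l c u F : 0 < c ->
  (forall f, c * nrm f <= nrm (poly_op phi f - l *: f)) ->
  spectral_measure_of u F ->
  F (`[-1, 1] `&` [set x | (phi.[x] - l) ^+ 2 < c ^+ 2]) = 0%E.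
Proof.
move=> c0 hc [F0 FL].
have := @poly_peak R F (-1) 1 (c ^+ 2) ((phi - l%:P) ^+ 2).
have -> : [set x | ((phi - l%:P) ^+ 2).[x] < c ^+ 2] = [set x | (phi.[x] - l) ^+ 2 < c ^+ 2].
  by apply/seteqP; split=> x /=; rewrite horner_exp !hornerE.
apply=> [x _|p]; first by rewrite horner_exp sqr_ge0.
rewrite !FL -exprMn -!poly_op_norm.
have := hc (poly_op p u).
have e : form_eq (poly_op ((phi - l%:P) * p) u) (poly_op phi (poly_op p u) - l *: poly_op p u).
  by move=> w; rewrite -poly_op_comp poly_opB poly_opC.
rewrite (form_eq2 e) -!nrm_sqr -exprMn => h.
by apply: lerXn2r => //; rewrite nnegrE ?mulr_ge0 ?nrm_ge0 ?(ltW c0).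
Qed.

(** The real approximate point spectrum of phi(T). It is defined on real vectors, and it is closed,
    hence measurable. *)
Definition spectral_set (phi : {poly R}) : set R := [set l | ~ bounded_below phi l].

Lemma bounded_below_near phi l c : 0 < c ->
  (forall f, c * nrm f <= nrm (poly_op phi f - l *: f)) ->
  forall m, `|l - m| <= c / 2 -> bounded_below phi m.
Proof.
move=> c0 hc m lm; exists (c / 2) => [|f]; first by rewrite divr_gt0.
have h := nrmD (poly_op phi f - m *: f) ((m - l) *: f).
rewrite scalerBl addrA subrK in h.
have h1 := le_trans (hc f) h.
rewrite -scalerBl nrmZ distrC in h1.
have := ler_wpM2r (nrm_ge0 f) lm; lra.
Qed.

Lemma spectral_set_closed phi : closed (spectral_set phi).
Proof.
rewrite -(setCK (spectral_set phi)); apply: open_closedC.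
rewrite openE => l /= /contrapT [c c0 hc]; rewrite /interior -nbhs_ballE.
exists (c / 2) => [|m /= lm]; first by rewrite /= divr_gt0.
by apply; exact: (bounded_below_near c0 hc (ltW lm)).
Qed.

Lemma spectral_set_measurable phi : measurable (spectral_set phi : set (measurableTypeR R)).
Proof. by apply: closed_measurable; exact: spectral_set_closed. Qed.

(** Supplies the set [E] for the Neumann series at [l]: on it [(phi - l) ^+ 2] is bounded away from
    0. *)
Lemma bounded_below_bounded_on phi l c : 0 < c ->
  (forall f, c * nrm f <= nrm (poly_op phi f - l *: f)) ->
  bounded_on (`[-1, 1] `&` [set x | c ^+ 2 <= (phi.[x] - l) ^+ 2]).
Proof.
move=> c0 hc p b u b0 pb; have [F hF] := spectral_measure_exists u.
have mlt : measurable ([set x | (phi.[x] - l) ^+ 2 < c ^+ 2] : set (measurableTypeR R)).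
  rewrite (_ : [set _ | _] = setT `&` (fun x => (phi.[x] - l) ^+ 2) @^-1` `]-oo, (c ^+ 2)[%classic).
    have : measurable_fun setT (fun x : measurableTypeR R => (phi.[x] - l) ^+ 2).
      apply: measurable_funX; apply: measurable_funB; last exact: measurable_cst.
      by apply: continuous_measurable_fun; exact: continuous_horner.
    by apply => //; exact: measurable_itv.
  by apply/seteqP; split=> x /=; rewrite in_itv/= ; [|case].
have eC : [set x | c ^+ 2 <= (phi.[x] - l) ^+ 2] = ~` [set x | (phi.[x] - l) ^+ 2 < c ^+ 2].
  by apply/seteqP; split=> x /=; rewrite leNgt => /negP.
apply: (bounded_at hF) pb => //.
- apply: measurableI; first exact: measurable_itv.
  by rewrite eC; exact: measurableC.
- rewrite eC setDIr setDv set0U setDE setCK.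
  exact: (spectral_measure_null c0 hc hF).
Qed.

Lemma measurable_poly_preimage (q : {poly R}) (O : set (measurableTypeR R)) :
  measurable O -> measurable ([set x | O q.[x]] : set (measurableTypeR R)).
Proof.
move=> mO; rewrite -[X in measurable X]setTI.
have : measurable_fun setT (horner q : measurableTypeR R -> measurableTypeR R).
  by apply: continuous_measurable_fun; exact: continuous_horner.
exact.
Qed.

(** A point whose image under [phi] is not in the spectral set has, by continuity of [phi], a
    neighbourhood mapped within distance [c] of that image, which is null. *)
Lemma spectral_measure_compl phi u F : spectral_measure_of u F ->
  F (`[-1, 1] `&` [set x | ~ spectral_set phi phi.[x]]) = 0%E.
Proof.
move=> hF; apply: locally_null; first exact: measurable_itv.
  apply: (@measurable_poly_preimage phi (~` spectral_set phi)).
  by apply: measurableC; exact: spectral_set_measurable.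
move=> l /= /contrapT [c c0 hc].
have := @continuous_horner R phi l => /cvgrPdist_lt /(_ c c0).
rewrite -nbhs_ballE => -[e /= e0 he]; exists e => //.
apply: (subset_measure0 _ _ _ (spectral_measure_null c0 hc hF)).
- by apply: measurableI; exact: measurable_itv.
- apply: measurableI; first exact: measurable_itv.
  rewrite (_ : [set _ | _] = [set x | `]-oo, (c ^+ 2)[%classic ((phi - (phi.[l])%:P) ^+ 2).[x]]).
    by apply: measurable_poly_preimage; exact: measurable_itv.
  by apply/seteqP; split=> x; rewrite /= in_itv/= horner_exp !hornerE.
- move=> x [Ix]; rewrite /= in_itv/= => /andP[x1 x2]; split=> //=.
  have := he x; rewrite /ball /= => /(_ _).
  have xl : `|l - x| < e by rewrite ltr_norml; apply/andP; split; lra.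
  move=> /(_ xl) h; rewrite -[ltLHS]real_normK ?num_real// distrC.
  by rewrite ltrXn2r// ?nnegrE// ltW.
Qed.

Lemma nrmT u : nrm (T u) <= nrm u.
Proof. by rewrite ler_sqrt. Qed.

Lemma nrmB_ge u v : nrm u - nrm v <= nrm (u - v).
Proof. by rewrite lerBlDr; have := nrmD (u - v) v; rewrite subrK. Qed.

Lemma bounded_belowX l : 1 < `|l| -> bounded_below 'X l.
Proof.
move=> l1; exists (`|l| - 1) => [|f]; first by rewrite subr_gt0.
rewrite -['X]expr1 poly_opXn /= -[leRHS]nrmN opprB.
apply: le_trans (nrmB_ge _ _); rewrite nrmZ mulrBl mul1r.
by rewrite lerD2l lerN2 nrmT.
Qed.

(** For [l < 0], pair with [f]: <T^2 f - l f, f> = |T f|^2 - l |f|^2 >= - l |f|^2. For [l > 1] the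
    contraction property is enough. *)
Lemma bounded_belowX2 l : l < 0 \/ 1 < l -> bounded_below 'X^2 l.
Proof.
move=> [l0|l1].
  exists (- l) => [|f]; first by rewrite oppr_gt0.
  rewrite poly_opXn /=.
  have [->|fn0] := eqVneq (nrm f) 0; first by rewrite mulr0 nrm_ge0.
  have f0 : 0 < nrm f by rewrite lt_def fn0 nrm_ge0.
  rewrite -(ler_pM2r f0); apply: le_trans (form_le_nrm _ _); apply: le_trans (ler_norm _).
  rewrite formDl formNl formZl T_sym -mulrA -expr2 nrm_sqr.
  by have := B_ge0 (T f); lra.
exists (l - 1) => [|f]; first by rewrite subr_gt0.
rewrite poly_opXn /= -[leRHS]nrmN opprB.
apply: le_trans (nrmB_ge _ _); rewrite nrmZ mulrBl mul1r ger0_norm; last by lra.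
by rewrite lerD2l lerN2 (le_trans (nrmT _))// nrmT.
Qed.

Lemma spectral_setX_sub : spectral_set 'X `<=` `[-1, 1].
Proof.
move=> l /= h; rewrite in_itv/= -ler_norml leNgt; apply/negP => l1.
exact/h/bounded_belowX.
Qed.

Lemma spectral_setX2_sub : spectral_set 'X^2 `<=` `[0, 1].
Proof.
move=> l /= h; rewrite in_itv/=; apply/andP; split; rewrite leNgt; apply/negP => l1; apply: h; apply: bounded_belowX2.
  by left.
by right.
Qed.

Lemma spectral_moments u : exists F : {finite_measure set (measurableTypeR R) -> \bar R},
  forall k, ((B u (iter k T u))%:E = \int[F]_(x in spectral_set 'X) (x ^+ k)%:E)%E.
Proof.
have [F hF] := spectral_measure_exists u; exists F => k.
have [F0 FL] := hF.
rewrite (@Rintegral_null_setD _ F `[-1, 1]%classic (spectral_set 'X) (fun x => x ^+ k)).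
- congr EFin; rewrite -poly_opXn -FL; apply: eq_Rintegral => x _.
  by rewrite hornerXn.
- exact: measurable_itv.
- exact: spectral_set_measurable.
- exact: spectral_setX_sub.
- have := spectral_measure_compl 'X hF; rewrite setDE.
  by under [X in `[-1, 1] `&` X]eq_set do rewrite hornerX.
- by apply: continuous_itv_integrable; exact: exprn_continuous.
Qed.

(** The functional p |-> <u, p(T^2) (1 + T) u> is the integral of p(x^2) (1 + x) against [F], so it
    is nonnegative whenever p is on [0, 1]. Its measure [G] lives on [0, 1], and where [G] vanishes
    is deduced from where [F] does. *)
Lemma spectral_even_moments u : exists G : {finite_measure set (measurableTypeR R) -> \bar R},
  forall k, ((B u (iter (2 * k) T u) + B u (iter (2 * k + 1) T u))%:E =
    \int[G]_(x in spectral_set 'X^2) (x ^+ k)%:E)%E.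
Proof.
have [F hF] := spectral_measure_exists u; have [F0 FL] := hF.
pose ev (p : {poly R}) := (p \Po 'X^2) * (1 + 'X).
have evE (p : {poly R}) x : (ev p).[x] = p.[x ^+ 2] * (1 + x).
  by rewrite /ev hornerM horner_comp hornerXn !hornerE.
have lin : scalar (fun p : {poly R} => B u (poly_op (ev p) u)).
  by move=> a p q; rewrite /ev comp_polyD comp_polyZ mulrDl -scalerAl poly_op_lin formDr formZr.
pose L : {scalar {poly R}} := HB.pack_for {scalar {poly R}} (fun p : {poly R} => B u (poly_op (ev p) u))
  (GRing.isLinear.Build R {poly R} R *%R (fun p : {poly R} => B u (poly_op (ev p) u)) lin).
have LE p : L p = \int[F]_(x in `[-1, 1]) ((p.[x ^+ 2]) * (1 + x)).
  rewrite -[L p]/(B u (poly_op (ev p) u)) -FL; apply: eq_Rintegral => x _.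
  by rewrite evE.
have Lpos (q : {poly R}) : (forall y, 0 <= y <= 1 -> 0 <= q.[y]) -> 0 <= L q.
  move=> q0; rewrite LE; apply: Rintegral_ge0 => x; rewrite /= in_itv/= => /andP[x1 x2].
  rewrite mulr_ge0//; last by lra.
  apply: q0; rewrite sqr_ge0/=; nra.
have [p|p|p|G [G0 GL]] := @moment_measure01 R L.
- by apply: Lpos => y _; rewrite horner_exp sqr_ge0.
- by apply: Lpos => y /andP[y0 _]; rewrite hornerM horner_exp hornerX mulr_ge0// sqr_ge0.
- apply: Lpos => y /andP[_ y1]; rewrite hornerM horner_exp mulr_ge0 ?sqr_ge0//.
  by rewrite !hornerE subr_ge0.
exists G => k.
have Gnull : G (`[0, 1] `&` ~` spectral_set 'X^2) = 0%E.
  apply: locally_null; first exact: measurable_itv.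
    by apply: measurableC; exact: spectral_set_measurable.
  move=> l /contrapT [c c0 hc]; exists c => //.
  suff pk : G (`[0, 1] `&` [set x | (('X - l%:P) ^+ 2).[x] < c ^+ 2]) = 0%E.
  apply: (subset_measure0 _ _ _ pk).
  - by apply: measurableI; exact: measurable_itv.
  - apply: measurableI; first exact: measurable_itv.
    rewrite (_ : [set _ | _] = [set x | `]-oo, (c ^+ 2)[%classic (('X - l%:P) ^+ 2).[x]]).
      by apply: measurable_poly_preimage; exact: measurable_itv.
    by apply/seteqP; split=> x; rewrite /= in_itv/=.
  - move=> x [Ix]; rewrite /= in_itv/= => /andP[x1 x2]; split=> //=.
    rewrite horner_exp !hornerE -[ltLHS]real_normK ?num_real//.
    rewrite ltrXn2r// ?nnegrE ?(ltW c0)//.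
    by rewrite ltr_norml; apply/andP; split; lra.
  apply: poly_peak => [x _|p]; first by rewrite horner_exp sqr_ge0.
  rewrite !GL -subr_ge0.
  (* The inequality wanted is [0 <= L q]. The integrand [q.[x ^+ 2] * (1 + x)] is negative only
     where (x^2 - l)^2 < c^2, and that set is null for [F]; [O] is its complement in [-1, 1]. *)
  pose q : {poly R} := (('X - l%:P) ^+ 2 - (c ^+ 2)%:P) * p ^+ 2.
  have -> : L (('X - l%:P) ^+ 2 * p ^+ 2) - c ^+ 2 * L (p ^+ 2) = L q.
    have -> : q = (- c ^+ 2) *: p ^+ 2 + ('X - l%:P) ^+ 2 * p ^+ 2.
      by rewrite /q mulrBl mul_polyC addrC scaleNr.
    by apply: esym; apply: (etrans (lin _ _ _)); rewrite mulNr addrC.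
  rewrite LE.
  pose O : set (measurableTypeR R) := `[-1, 1] `&` [set x | c ^+ 2 <= (('X^2).[x] - l) ^+ 2].
  have eC : `[-1, 1] `\` O = `[-1, 1] `&` [set x | (('X^2).[x] - l) ^+ 2 < c ^+ 2].
    rewrite /O setDIr setDv set0U setDE; congr (_ `&` _).
    by apply/seteqP; split=> x /=; rewrite ltNge => /negP.
  have mO : measurable O.
    apply: measurableI; first exact: measurable_itv.
    rewrite (_ : [set _ | _] = [set x | `[(c ^+ 2), +oo[%classic (('X^2 - l%:P) ^+ 2).[x]]).
      by apply: measurable_poly_preimage; exact: measurable_itv.
    by apply/seteqP; split=> x; rewrite /= in_itv/= horner_exp !hornerE ?andbT.
  rewrite -lee_fin -(@Rintegral_null_setD _ F `[-1, 1]%classic O (fun x => q.[x ^+ 2] * (1 + x))).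
  - apply: integral_ge0 => x [/=]; rewrite in_itv/= hornerXn => /andP[x1 x2] hx.
    rewrite lee_fin mulr_ge0//; last by lra.
    rewrite /q hornerM horner_exp mulr_ge0 ?sqr_ge0//.
    by rewrite !hornerE subr_ge0.
  - exact: measurable_itv.
  - exact: mO.
  - by move=> x [].
  - by rewrite eC; exact: (spectral_measure_null c0 hc hF).
  - rewrite (_ : EFin \o _ = EFin \o horner (ev q)); first exact: poly_integrable.
    by apply/funext => x /=; rewrite evE.
rewrite (@Rintegral_null_setD _ G `[0, 1]%classic (spectral_set 'X^2) (fun x => x ^+ k)).
- congr EFin; rewrite -!poly_opXn.
  have -> : \int[G]_(x in `[0, 1]) x ^+ k = L 'X^k.
    by rewrite -GL; apply: eq_Rintegral => x _; rewrite hornerXn.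
  rewrite -[L _]/(B u (poly_op (ev 'X^k) u)) -formDr -poly_opD; congr (B u (poly_op _ u)).
  by rewrite /ev rmorphXn /= comp_polyX -exprM mulrDr mulr1 -exprSr addn1.
- exact: measurable_itv.
- exact: spectral_set_measurable.
- exact: spectral_setX2_sub.
- by rewrite setDE.
- by apply: continuous_itv_integrable; exact: exprn_continuous.
Qed.

(* Chebyshev: for [s > r] the spectral measure of [v] gives {s < |x|} at most
   the mass [nrm (iter n T v) ^+ 2 / s ^+ (2 * n)], which tends to 0. *)
Lemma decay_bounded_on r : 0 <= r ->
  (forall u e, 0 < e -> exists2 v, nrm (u - v) <= e & exists C, forall n, (0 < n)%N ->
     nrm (iter n T v) ^+ 2 <= C * r ^+ (2 * n)) ->
  bounded_on `[- r, r].
Proof.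
move=> r0 dense p b u b0 pb.
have mI : measurable (`[-1, 1]%classic : set (measurableTypeR R)) by exact: measurable_itv.
have bv v C : (forall n, (0 < n)%N -> nrm (iter n T v) ^+ 2 <= C * r ^+ (2 * n)) ->
    nrm (poly_op p v) <= b * nrm v.
  move=> hC; have [F hF] := spectral_measure_exists v; have [F0 FL] := hF.
  apply: (bounded_at hF _ _ b0 pb); first exact: measurable_itv.
  have nE s : ~` `[- s, s]%classic = [set x | s < `|x|] :> set R.
    by apply/seteqP; split=> x /=; rewrite in_itv/= -ler_norml ltNge => /negP.
  have mabs s : measurable ([set x | s < `|x|] : set (measurableTypeR R)).
    by rewrite -nE; apply: measurableC; exact: measurable_itv.
  rewrite setDE nE; apply: locally_null => // l /= rl.
  (* The midpoint of [r] and [|l|]: the interval of radius [e] about [l] stays where [s < |x|], and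
     [r / s < 1]. *)
  pose s := (r + `|l|) / 2; pose e := (`|l| - r) / 2.
  have e0 : 0 < e by rewrite divr_gt0// subr_gt0.
  have rs : r < s by rewrite /s; lra.
  have s0 : 0 < s by exact: le_lt_trans rs.
  exists e => //.
  have mA : measurable (`[-1, 1] `&` [set x | s < `|x|] : set (measurableTypeR R)) by exact: measurableI.
  apply: (@subset_measure0 _ _ _ F _ (`[-1, 1] `&` [set x | s < `|x|])) => //.
  - by apply: measurableI => //; exact: measurable_itv.
  - move=> x [Ix]; rewrite /= in_itv/= => /andP[x1 x2]; split=> //=.
    have xl : `|l - x| < e by rewrite ltr_norml; apply/andP; split; lra.
    have := ler_normD (l - x) x; rewrite subrK; rewrite /s /e in xl *; lra.
  set A := _ `&` _.
  suff fA : fine (F A) = 0 by rewrite -[LHS]fineK ?fA// fin_num_measure.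
  apply/eqP; rewrite eq_le fine_ge0// andbT.
  have bound n : (0 < n)%N -> fine (F A) <= C * ((r / s) ^+ 2) ^+ n.
    move=> n0; have sn : 0 < s ^+ (2 * n) by exact: exprn_gt0.
    rewrite -exprM expr_div_n mulrA ler_pdivlMr// [leLHS]mulrC.
    apply: le_trans (hC n n0).
    rewrite nrm_sqr -poly_opXn poly_op_norm -FL.
    have -> : fine (F A) = \int[F]_(x in `[-1, 1]) \1_A x.
      by rewrite /Rintegral integral_indic// setIidl// => x [].
    have iA : F.-integrable `[-1, 1] (EFin \o (\1_A : R -> R)).
      apply: (@bounded_integrable _ _ _ F _ _ 1) => //.
      by move=> x _; rewrite indicE; case: (_ \in _); rewrite /= ?normr1 ?normr0.
    rewrite -RintegralZl//; apply: le_Rintegral => //.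
    - exact: (integrableZl mI _ iA).
    - exact: poly_integrable.
    move=> x Ix; rewrite -exprM (mulnC n) hornerXn indicE; case: (boolP (_ \in _)).
      rewrite inE /= => -[_ /= sx]; rewrite mulr1 exprM [leRHS]exprM.
      apply: lerXn2r; rewrite ?nnegrE ?sqr_ge0//.
      by rewrite -[leRHS]real_normK ?num_real// lerXn2r// ?nnegrE// ltW.
    by move=> _; rewrite mulr0 exprM exprn_ge0// sqr_ge0.
  have q1 : `|(r / s) ^+ 2| < 1.
    have rs01 : 0 <= r / s < 1 by rewrite divr_ge0 ?(ltW s0)//= ltr_pdivrMr// mul1r.
    rewrite normrX ger0_norm; last by case/andP: rs01.
    by rewrite exprn_ilt1//; case/andP: rs01.
  have cv : C * ((r / s) ^+ 2) ^+ n @[n --> \oo] --> C * 0.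
    by apply: cvgM; [exact: cvg_cst|exact: cvg_expr].
  rewrite mulr0 in cv; apply: (ler_cvg_to (cvg_cst (fine (F A))) cv).
  by exists 1%N => // n /= n0; exact: bound.
have [M M0 hM] := poly_bounded_itv p (-1) 1.
have pM v : nrm (poly_op p v) <= M * nrm v.
  by apply: bounded_on_itv => [|x]; [exact: ltW|rewrite /= in_itv/=; exact: hM].
apply/ler_addgt0Pr => e e0.
(* Replacing [u] by [v] costs [b] times the distance in the norm on the right and [M] times it in
   p(T) (u - v), with [M] the crude bound of [p] on [-1, 1]. *)
have e0' : 0 < e / (M + b) by rewrite divr_gt0// ltr_wpDr.
have [v uv [C hC]] := dense u _ e0'.
have -> : nrm (poly_op p u) = nrm (poly_op p v + poly_op p (u - v)).
  apply: nrm_eq => w; rewrite formDl !poly_op_sym -formDl addrC subrK //.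
apply: (le_trans (nrmD _ _)).
apply: (@le_trans _ _ (b * (nrm u + nrm (u - v)) + M * nrm (u - v))).
  apply: lerD => //; apply: (le_trans (bv v C hC)); rewrite ler_wpM2l//.
  by have := nrmD u (- (u - v)); rewrite nrmN opprB (addrC u (v - u)) subrK.
by rewrite mulrDr -addrA lerD2l -mulrDl (addrC b) mulrC -ler_pdivlMr// ltr_wpDr.
Qed.

(** * Points with a resolvent *)

Definition has_resolvent (A : V -> V) (a b : R) :=
  exists G H : V -> V -> V, exists2 K : R, 0 <= K & forall f g,
  [/\ B (G f g) (G f g) + B (H f g) (H f g) <= K * (B f f + B g g),
      form_eq (A (G f g) - a *: G f g + b *: H f g) f,
      form_eq (A (H f g) - a *: H f g - b *: G f g) g,
      form_eq (G (A f - a *: f + b *: g) (A g - a *: g - b *: f)) f &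
      form_eq (H (A f - a *: f + b *: g) (A g - a *: g - b *: f)) g].

Lemma has_resolvent_poly E (phi : {poly R}) A a b c :
  bounded_on E -> E `<=` `[-1, 1] -> (forall u, form_eq (A u) (poly_op phi u)) -> 0 < c ->
  (forall x, E x -> c <= (phi.[x] - a) ^+ 2 + b ^+ 2) -> has_resolvent A a b.
Proof.
move=> bE EI hA c0 hc.
have [M M0 hM] := poly_bounded_itv ((phi - a%:P) ^+ 2 + (b ^+ 2)%:P) (-1) 1.
apply: (@resolvent_exists E phi A a b c (Num.max c M)) => //.
  by rewrite le_max lexx.
move=> x Ex; rewrite hc//= le_max; apply/orP; right.
have := EI x Ex; rewrite /= in_itv/= => /hM; rewrite !hornerE => /(le_trans (ler_norm _)).
by [].
Qed.

Lemma has_resolvent_real phi A l : (forall u, form_eq (A u) (poly_op phi u)) ->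
  bounded_below phi l -> has_resolvent A l 0.
Proof.
move=> hA [c c0 hc].
apply: (@has_resolvent_poly _ phi A l 0 (c ^+ 2) (bounded_below_bounded_on c0 hc)) => //.
- by rewrite exprn_gt0.
- by move=> x [_ /=]; rewrite expr0n addr0.
Qed.

Lemma has_resolventX r a b : r <= 1 -> bounded_on `[- r, r] ->
  b != 0 \/ r < `|a| -> has_resolvent T a b.
Proof.
move=> r1 bE ab.
(* A lower bound for the squared distance from a + i b to the points of [- r, r]. *)
apply: (@has_resolvent_poly _ 'X T a b (if b != 0 then b ^+ 2 else (`|a| - r) ^+ 2) bE).
- by move=> x; rewrite /= !in_itv/= => /andP[h1 h2]; apply/andP; split; lra.
- by move=> u w; rewrite -['X]expr1 poly_opXn.
- by case: ifPn ab => [bn0 _|_ [//|ra]]; rewrite exprn_even_gt0//= subr_eq0 gt_eqF.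
move=> x; rewrite /= in_itv/= -ler_norml => xr; rewrite hornerX.
case: ifPn ab => [_ _|/negbNE/eqP -> [|ra]]; first by rewrite lerDr sqr_ge0.
  by [].
rewrite expr0n addr0 -[leRHS]real_normK ?num_real// lerXn2r// ?nnegrE ?subr_ge0 ?(ltW ra)//.
by have := ler_normB x (x - a); rewrite opprB addrCA subrr addr0; lra.
Qed.

Lemma has_resolventX2 r a b : 0 <= r <= 1 -> bounded_on `[- r, r] ->
  [\/ b != 0, a < 0 | r ^+ 2 < a] -> has_resolvent (T \o T) a b.
Proof.
move=> /andP[r0 r1] bE ab.
have h c : 0 < c -> (forall x, `|x| <= r -> c <= (x ^+ 2 - a) ^+ 2 + b ^+ 2) ->
    has_resolvent (T \o T) a b.
  move=> c0 hc; apply: (@has_resolvent_poly _ 'X^2 (T \o T) a b c bE) => //.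
  - by move=> x; rewrite /= !in_itv/= => /andP[h1 h2]; apply/andP; split; lra.
  - by move=> u w; rewrite poly_opXn.
  - by move=> x; rewrite /= in_itv/= -ler_norml hornerXn; exact: hc.
have sq x : `|x| <= r -> 0 <= x ^+ 2 <= r ^+ 2.
  by move=> xr; rewrite sqr_ge0/= -[leLHS]real_normK ?num_real// lerXn2r// nnegrE.
case: ab => [bn0|a0|ra].
- apply: (h (b ^+ 2)) => //; first by rewrite exprn_even_gt0.
  by move=> x _; rewrite lerDr sqr_ge0.
- apply: (h (a ^+ 2)) => //; first by rewrite exprn_even_gt0//= lt_eqF.
  move=> x /sq/andP[x0 _]; have := sqr_ge0 b; move: (x ^+ 2) x0 => y y0; nra.
- apply: (h ((a - r ^+ 2) ^+ 2)); first by rewrite exprn_even_gt0//= subr_eq0 gt_eqF.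
  move=> x /sq/andP[x0 xr]; have := sqr_ge0 b; move: (x ^+ 2) (r ^+ 2) x0 xr ra => y z *; nra.
Qed.

End contraction.

(** * The Hilbert space of square-integrable functions *)

Section mixture.
Context d d' (X : measurableType d) (Y : measurableType d') (R : realType)
  (l : {measure set X -> \bar R}) (k : X -> {measure set Y -> \bar R})
  (m : {measure set Y -> \bar R}).
Hypothesis mk : forall U, measurable U -> measurable_fun setT (k ^~ U).
Hypothesis mE : forall U, measurable U -> m U = (\int[l]_x k x U)%E.
Local Open Scope ereal_scope.

Import HBNNSimple.

Lemma nnsfun_integral_mixture (f : {nnsfun Y >-> R}) :
  \int[m]_y (f y)%:E = \int[l]_x \int[k x]_y (f y)%:E.
Proof.
have fE (n : {measure set Y -> \bar R}) :
    \int[n]_y (f y)%:E = \sum_(r \in range f) r%:E * n (f @^-1` [set r]).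
  under eq_integral do rewrite fimfunE -fsumEFin//.
  rewrite ge0_integral_fsum//; last 2 first.
  - by move=> r; exact/measurable_EFinP/measurableT_comp.
  - by move=> r z _; rewrite EFinM nnfun_muleindic_ge0.
  apply: eq_fsbigr => r _.
  rewrite (integralZl_indic _ (fun r => f @^-1` [set r]))//; last first.
    by move=> r0; rewrite preimage_nnfun0.
  by rewrite integral_indic// setIT.
rewrite fE; under [in RHS]eq_integral do rewrite fE.
rewrite ge0_integral_fsum//; last 2 first.
- by move=> r; apply: measurable_funeM; exact: mk.
- move=> r x _; have := mulemu_ge0 (fun n => f @^-1` [set n]).
  by apply; exact: preimage_nnfun0.
apply: eq_fsbigr => r _; rewrite mE//.
have [r0|r0] := leP 0%R r; first by rewrite ge0_integralZl//; exact: mk.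
(* A nonnegative simple function does not take the negative value [r], so both sides are 0. *)
rewrite preimage_nnfun0// [X in _ * X]integral0_eq ?mule0.
  by rewrite integral0_eq// => y _; rewrite measure0 mule0.
by move=> y _; rewrite measure0.
Qed.

(** With [l = m = pi] and [k = Q], this extends invariance of [pi] from sets to functions. *)
Lemma ge0_integral_mixture (f : Y -> \bar R) : (forall y, 0 <= f y) ->
  measurable_fun setT f -> \int[m]_y f y = \int[l]_x \int[k x]_y f y.
Proof.
move=> f0 mf; pose f_ := nnsfun_approx measurableT mf.
have fE (n : {measure set Y -> \bar R}) :
    \int[n]_y f y = lim (\int[n]_y (f_ j y)%:E @[j --> \oo]).
  rewrite -monotone_convergence//; last 3 first.
  - by move=> j; exact/measurable_EFinP.
  - by move=> j z _; rewrite lee_fin.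
  - by move=> z _ a b ab; rewrite lee_fin; exact/lefP/nd_nnsfun_approx.
  by apply/eq_integral => z _; apply/esym/cvg_lim => //=; exact: cvg_nnsfun_approx.
rewrite fE; under [in RHS]eq_integral do rewrite fE.
under eq_fun do rewrite nnsfun_integral_mixture.
rewrite -monotone_convergence//.
- move=> n; apply: measurable_fun_integral_kernel => //.
  + by move=> z; rewrite lee_fin.
  + exact/measurable_EFinP.
- by move=> n y _; apply: integral_ge0 => // z _; rewrite lee_fin.
- move=> y _ a b ab; apply: ge0_le_integral => //.
  + by move=> z _; rewrite lee_fin.
  + exact/measurable_EFinP.
  + exact/measurable_EFinP.
  + by move=> z _; rewrite lee_fin; exact/lefP/nd_nnsfun_approx.
Qed.

End mixture.

Section square_integrable.
Context d (T : measurableType d) (R : realType) (pi : probability T R).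
Implicit Types f h : T -> R.
Local Notation L2 := (Lfun pi 2%:E).

Lemma L2P f : f \in L2 <->
  measurable_fun setT f /\ (\int[pi]_x ((f x) ^+ 2)%:E < +oo)%E.
Proof.
split=> [fL|[mf fi]].
  split; first by have := sub_Lfun_mfun fL; rewrite inE.
  have /integrableP[_] := Lfun2_integrable_sqr fL.
  by apply: le_lt_trans; under [leRHS]eq_integral do rewrite /= ger0_norm ?sqr_ge0//.
apply/andP; split; first by rewrite inE/=.
rewrite inE/= /finite_norm unlock /=; apply: poweR_lty.
rewrite (eq_integral (fun x => ((f x) ^+ 2)%:E))// => x _.
by rewrite /= powR_mulrn// real_normK// num_real.
Qed.

Lemma L2_measurable f : f \in L2 -> measurable_fun setT f.
Proof. by move=> /L2P[]. Qed.

Lemma L2_mul f h : f \in L2 -> h \in L2 -> pi.-integrable setT (EFin \o (fun x => f x * h x)).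
Proof. by move=> fL hL; apply/Lfun1_integrable; exact: Lfun2_mul_Lfun1. Qed.

Lemma L2_sqr f : f \in L2 -> pi.-integrable setT (EFin \o (fun x => f x ^+ 2)).
Proof. exact: Lfun2_integrable_sqr. Qed.

Lemma L2_cst c : cst c \in L2.
Proof. exact: Lfun_cst. Qed.

Lemma L2_integrable f : f \in L2 -> pi.-integrable setT (EFin \o f).
Proof.
move=> fL; have := L2_mul fL (L2_cst 1); congr (integrable _ _ _).
by apply/funext => x /=; rewrite mulr1.
Qed.

Lemma L2_dominated f (h : T -> R) C : h \in L2 -> measurable_fun setT f ->
  (forall x, (f x) ^+ 2 <= C * (h x) ^+ 2) -> f \in L2.
Proof.
move=> hL mf fh; apply/L2P; split => //.
have := integrableZl measurableT C (L2_sqr hL) => /integrableP[_]; apply: le_lt_trans.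
apply: ge0_le_integral => //.
- by move=> x _; rewrite lee_fin sqr_ge0.
- by apply/measurable_EFinP; exact: measurable_funX.
- apply: measurableT_comp => //; apply: measurable_funeM; apply/measurable_EFinP.
  by apply: measurable_funX; exact: L2_measurable.
- by move=> x _ /=; rewrite lee_fin (le_trans (fh x))// ler_norm.
Qed.

Lemma L2_lin a f h : f \in L2 -> h \in L2 -> (fun x => a * f x + h x) \in L2.
Proof.
move=> fL hL; apply/L2P; split.
  by apply: measurable_funD; [apply: measurable_funM => //|]; exact: L2_measurable.
have ha := integrableZl measurableT (2 * a ^+ 2) (L2_sqr fL).
have hb := integrableZl measurableT 2 (L2_sqr hL).
have /integrableP[_] := integrableD measurableT ha hb; apply: le_lt_trans.
apply: ge0_le_integral => //.
- by move=> x _; rewrite lee_fin sqr_ge0.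
- apply/measurable_EFinP; apply: measurable_funX.
  by apply: measurable_funD; [apply: measurable_funM => //|]; exact: L2_measurable.
- by have /integrableP[/(measurableT_comp (@abse_measurable _ setT))] := integrableD measurableT ha hb.
- move=> x _; rewrite [leRHS](_ : _ = `|2 * a ^+ 2 * f x ^+ 2 + 2 * h x ^+ 2|%:E)// lee_fin.
  apply: le_trans (ler_norm _).
  by have := sqr_ge0 (a * f x - h x); nra.
Qed.

Lemma L2_sub f h : f \in L2 -> h \in L2 -> (fun x => f x - h x) \in L2.
Proof.
move=> fL hL; have := L2_lin (-1) hL fL.
by rewrite (_ : (fun _ => _) = (fun x => f x - h x))//; apply/funext => x /=; ring.
Qed.

Lemma L2_indic A : measurable A -> (\1_A : T -> R) \in L2.
Proof.
move=> mA; apply: (@L2_dominated _ (cst 1) 1 (L2_cst 1)) => //.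
by move=> x; rewrite /= indicE; case: (_ \in _); rewrite /= ?expr1n ?expr0n /= mul1r// ler01.
Qed.

Lemma innerC f h : inner pi f h = inner pi h f.
Proof. by apply: eq_Rintegral => x _; rewrite mulrC. Qed.

Lemma inner_lin a f h u : f \in L2 -> h \in L2 -> u \in L2 ->
  inner pi (fun x => a * f x + h x) u = a * inner pi f u + inner pi h u.
Proof.
move=> fL hL uL; rewrite /inner.
rewrite -RintegralZl//; last exact: L2_mul.
rewrite -RintegralD//; [|exact: (integrableZl measurableT a (L2_mul fL uL))|exact: L2_mul].
by apply: eq_Rintegral => x _ /=; ring.
Qed.

Lemma inner_sqrE f : f \in L2 -> (inner pi f f)%:E = (\int[pi]_x ((f x) ^+ 2)%:E)%E.
Proof.
move=> fL; rewrite /inner /Rintegral fineK; last by apply: integrable_fin_num => //; exact: L2_mul.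
by apply: eq_integral => x _; rewrite expr2.
Qed.

Lemma inner_eq0 f : f \in L2 -> inner pi f f = 0 <-> {ae pi, forall x, f x = 0}.
Proof.
move=> fL; have mf := L2_measurable fL; split=> [f0|f0].
  have h : ae_eq pi setT (fun x => ((f x) ^+ 2)%:E) (cst 0%E).
    apply/ae_eq_integral_abs => //; first by apply/measurable_EFinP; exact: measurable_funX.
    rewrite -[RHS](congr1 EFin f0) inner_sqrE//.
    by apply: eq_integral => x _; rewrite /= ger0_norm ?sqr_ge0.
  apply: filterS h => x /(_ I)/= [] /eqP; rewrite sqrf_eq0 => /eqP //.
apply: EFin_inj; rewrite inner_sqrE//.
rewrite (ae_eq_integral (cst 0%E)) ?integral0//.
  by apply/measurable_EFinP; exact: measurable_funX.
by apply: filterS f0 => x /= -> _; rewrite expr0n.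
Qed.

Lemma inner_subcst f h c : f \in L2 -> h \in L2 ->
  inner pi f (fun x => h x - c) = inner pi f h - c * \int[pi]_x f x.
Proof.
move=> fL hL; have := inner_lin (- c) (L2_cst 1) hL fL.
rewrite (_ : (fun x => _) = (fun x => h x - c)); last first.
  by apply/funext => x; rewrite /= mulr1 addrC.
rewrite innerC => ->; rewrite addrC mulNr (innerC h); congr (_ - _ * _).
by apply: eq_Rintegral => x _; rewrite mul1r.
Qed.

Lemma L2_subcst f c : f \in L2 -> (fun x => f x - c) \in L2.
Proof. by move=> fL; apply: (L2_sub fL (L2_cst c)). Qed.

Lemma integral_prob_cst (c : \bar R) : (\int[pi]_x c = c)%E.
Proof.
rewrite (integral_cst pi measurableT c) -[RHS]mule1; congr (_ * _)%E.
exact: probability_setT.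
Qed.

Lemma Rintegral_subcst f c : f \in L2 -> \int[pi]_x (f x - c) = \int[pi]_x f x - c.
Proof.
move=> fL; rewrite RintegralB//; [|exact: L2_integrable|exact: L2_integrable (L2_cst c)].
by congr (_ - _); rewrite /Rintegral integral_prob_cst.
Qed.

Lemma inner_center f c : f \in L2 ->
  inner pi (fun x => f x - c) (fun x => f x - c) =
  inner pi f f - 2 * c * \int[pi]_x f x + c ^+ 2.
Proof.
move=> fL; rewrite inner_subcst//; last exact: L2_subcst.
by rewrite innerC inner_subcst// Rintegral_subcst//; ring.
Qed.

Lemma sqr_mean_le f : f \in L2 -> (\int[pi]_x f x) ^+ 2 <= inner pi f f.
Proof.
move=> fL; rewrite -subr_ge0; set c := \int[pi]_x f x.
rewrite (_ : _ - _ = inner pi (fun x => f x - c) (fun x => f x - c)).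
  by apply: Rintegral_ge0 => x _; rewrite -expr2 sqr_ge0.
by rewrite inner_center// -/c; ring.
Qed.

End square_integrable.
Fact le1_2 (R : realType) : (1 <= 2%:E :> \bar R)%E.
Proof. by rewrite lee1n. Qed.

Definition L2space d (T : measurableType d) (R : realType) (pi : probability T R) :=
  LfunType pi (le1_2 R).

(** * Completeness and density in the space of square-integrable functions *)

Section L2_space.
Context d (T : measurableType d) (R : realType) (pi : probability T R).
Local Notation L2 := (Lfun pi 2%:E).
Local Notation V := (LfunType pi (le1_2 R)).
Implicit Types u v w : V.

Definition L2ip u v : R := inner pi u v.

Lemma L2_funE a u v x : (a *: u + v : V) x = a * u x + v x.
Proof. by []. Qed.

Lemma L2_funBE u v x : (u - v : V) x = u x - v x.
Proof. by []. Qed.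

Definition toL2 f (fL : f \in L2) : V := Lfun_Sub _ fL.
Lemma toL2E f (fL : f \in L2) : toL2 fL = f :> (T -> R).
Proof. by []. Qed.

Lemma ip_sym u v : L2ip u v = L2ip v u.
Proof. exact: innerC. Qed.
Lemma ip_lin a u v w : L2ip (a *: u + v) w = a * L2ip u w + L2ip v w.
Proof. by rewrite /L2ip -inner_lin//; exact: LfunP. Qed.
Lemma ip_ge0 u : 0 <= L2ip u u.
Proof. by apply: Rintegral_ge0 => x _; rewrite -expr2 sqr_ge0. Qed.

Local Notation norm2 := (nrm L2ip).

Lemma nrm_sqrE u : (norm2 u ^+ 2)%:E = (\int[pi]_x ((u x) ^+ 2)%:E)%E.
Proof. by rewrite /nrm sqr_sqrtr ?ip_ge0// /L2ip inner_sqrE// LfunP. Qed.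

Lemma limn_einf_le (s : nat -> \bar R) c K : (forall k, (K <= k)%N -> s k <= c)%E ->
  (limn_einf s <= c)%E.
Proof.
move=> sc; rewrite limn_einf_lim; apply: lime_le; first exact: is_cvg_einfs.
exists K => // k /= Kk; apply: le_trans (sc k Kk).
by apply: ereal_inf_lbound; exists k => //=.
Qed.

Lemma cvgn_sqr (s : nat -> R) (l : R) : s @ \oo --> l -> (fun n => s n ^+ 2) @ \oo --> l ^+ 2.
Proof. by move=> sl; rewrite expr2; under eq_fun do rewrite expr2; exact: cvgM. Qed.

(** With d_k the k-th increment, the sum of 2^k d_k^2 has integral at most 2, so it is finite almost
    everywhere. The bound |d_k| <= 2^(-k) + 2^k d_k^2 then gives absolute convergence. *)
Lemma L2_cvg_ae (y : nat -> V) :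
  (forall k, norm2 (y k.+1 - y k) <= (1 / 2) ^+ k) ->
  {ae pi, forall t, cvgn (fun k => y k t)}.
Proof.
move=> dy; pose dl k t : R := y k.+1 t - y k t.
pose W t : \bar R := (\sum_(0 <= k <oo) (2 ^+ k * dl k t ^+ 2)%:E)%E.
have md k : measurable_fun setT (fun t => (2 ^+ k * dl k t ^+ 2)%:E).
  apply/measurable_EFinP/measurable_funM => //; apply: measurable_funX.
  by apply: measurable_funB; exact: measurable_funPT.
have d0 k t : 0 <= 2 ^+ k * dl k t ^+ 2 by rewrite mulr_ge0 ?sqr_ge0// exprn_ge0.
have mW : measurable_fun setT W.
  by apply: ge0_emeasurable_sum => // k t _ _; rewrite lee_fin.
have geo n : series (geometric 1 (1 / 2 : R)) n <= 2.
  apply: le_trans (geometric_le_lim n _ _ _) _ => //.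
  - by rewrite ger0_norm//; lra.
  - by rewrite ler_pdivrMr; lra.
have iW : (\int[pi]_t W t <= 2%:E)%E.
  rewrite integral_nneseries//; last by move=> k t _; rewrite lee_fin.
  apply: lime_le; first by apply: is_cvg_nneseries => k _ _; apply: integral_ge0 => t _; rewrite lee_fin.
  apply: nearW => n; apply: (@le_trans _ _ (\sum_(0 <= k < n) (geometric 1 (1 / 2 : R) k)%:E)%E); last first.
    by rewrite sumEFin lee_fin; exact: geo.
  apply: lee_sum => k _; under eq_integral do rewrite EFinM.
  rewrite ge0_integralZl//; first last.
  - by move=> t _; rewrite lee_fin sqr_ge0.
  - apply/measurable_EFinP; apply: measurable_funX.
    by apply: measurable_funB; exact: measurable_funPT.
  have := nrm_sqrE (y k.+1 - y k); rewrite /dl => <-.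
  rewrite -EFinM lee_fin /geometric /= mul1r.
  apply: (@le_trans _ _ (2 ^+ k * ((1 / 2) ^+ k) ^+ 2)).
    by rewrite ler_wpM2l ?exprn_ge0// lerXn2r ?nnegrE ?exprn_ge0// ?sqrtr_ge0//.
  rewrite expr2 mulrA -exprMn (_ : 2 * (1 / 2) = 1 :> R) ?expr1n ?mul1r//; lra.
have Wi : pi.-integrable setT W.
  apply/integrableP; split => //; apply: le_lt_trans (ltry 2).
  apply: le_trans iW; rewrite le_eqVlt; apply/orP; left; apply/eqP.
  by apply: eq_integral => t _; rewrite gee0_abs// nneseries_ge0// => k _ _; rewrite lee_fin.
have := integrable_ae measurableT Wi; apply: filterS => t /(_ I) Wfin.
have yE n : y n t = y 0%N t + series (dl^~ t) n.
  elim: n => [|n IH]; first by rewrite /series /= big_geq// addr0.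
  rewrite /series /= big_nat_recr//= addrA.
  by rewrite -[y 0%N t + _]/(y 0%N t + series (dl^~ t) n) -IH addrC subrK.
rewrite (_ : (fun k => _) = (fun k => y 0%N t + series (dl^~ t) k)); last exact/funext.
apply: is_cvgD; first exact: is_cvg_cst.
apply: normed_cvg; apply: nondecreasing_is_cvgn.
  by apply: nondecreasing_series => k _ _; exact: normr_ge0.
exists (2 + fine (W t)) => _ [n _ <-].
apply: (@le_trans _ _ (series (geometric 1 (1 / 2)) n + \sum_(0 <= k < n) 2 ^+ k * dl k t ^+ 2)).
  rewrite /series /= -big_split/=; apply: ler_sum => k _.
  rewrite mul1r; set a := (1 / 2) ^+ k; have a0 : 0 < a by rewrite exprn_gt0.
  have ai : 2 ^+ k * a = 1 by rewrite -exprMn (_ : 2 * (1 / 2) = 1 :> R) ?expr1n//; lra.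
  rewrite -(ler_pM2l a0) mulrDr mulrA (mulrC a (2 ^+ k)) ai mul1r -[dl k t ^+ 2]real_normK ?num_real//.
  by have := sqr_ge0 (a - `|dl k t|); nra.
apply: lerD; first exact: geo.
rewrite -lee_fin fineK// -sumEFin.
by apply: nneseries_lim_ge => k _ _; rewrite lee_fin.
Qed.

Lemma L2_complete (x : nat -> V) :
  (forall e, 0 < e -> exists N, forall m n, (N <= m)%N -> (N <= n)%N -> norm2 (x m - x n) <= e) ->
  exists l, norm_cvg L2ip x l.
Proof.
move=> cx.
have /choice[N hN] : forall k, exists N, forall m n, (N <= m)%N -> (N <= n)%N ->
    norm2 (x m - x n) <= (1 / 2) ^+ k by move=> k; apply: cx; rewrite exprn_gt0.
(* This makes [phi] nondecreasing, beyond [N k] and beyond [k], without a recursive choice. *)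
pose phi k := (\sum_(i < k.+1) (N i).+1)%N.
have phi_ge k : (k < phi k)%N.
  by rewrite /phi -[X in (X <= _)%N]card_ord -sum1_card; exact: leq_sum.
have phiN k : (N k <= phi k)%N by rewrite /phi big_ord_recr/=; lia.
have phiS k : (phi k <= phi k.+1)%N by rewrite /phi [leqRHS]big_ord_recr/=; lia.
pose y k := x (phi k).
have ycv : {ae pi, forall t, cvgn (fun k => y k t)}.
  by apply: L2_cvg_ae => k; apply: hN => //; exact: leq_trans (phiS k).
(* The upper limit is measurable on the whole space, including the points where [y] diverges. *)
pose l0 t := fine (limn_esup (fun k => (y k t)%:E)).
have ml0 : measurable_fun setT l0.
  apply: measurableT_comp => //; apply: measurable_fun_limn_esup => k.
  by apply/measurable_EFinP; exact: measurable_funPT.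
have yl0 : {ae pi, forall t, (fun k => y k t) @ \oo --> l0 t}.
  apply: filterS ycv => t yt; rewrite /l0 is_cvg_limn_esupE.
    by rewrite EFin_lim.
  by apply/cvg_ex; exists (limn (fun k => y k t))%:E; apply: cvg_EFin => //; exact: nearW.
(* Fatou along the subsequence [y]; applied to the whole sequence [x], it yields both [l0 \in L2]
   and convergence. *)
have key e n0 : 0 < e -> (forall m n, (n0 <= m)%N -> (n0 <= n)%N -> norm2 (x m - x n) <= e) ->
    forall m, (n0 <= m)%N -> (\int[pi]_t ((x m t - l0 t) ^+ 2)%:E <= (e ^+ 2)%:E)%E.
  move=> e0 he m n0m.
  have mF k : measurable_fun setT (fun t => ((x m t - y k t) ^+ 2)%:E).
    by apply/measurable_EFinP/measurable_funX/measurable_funB; exact: measurable_funPT.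
  apply: (@le_trans _ _ (\int[pi]_t limn_einf (fun k => ((x m t - y k t) ^+ 2)%:E))%E).
    apply: ae_ge0_le_integral => //.
    - by move=> t _; rewrite lee_fin sqr_ge0.
    - by apply/measurable_EFinP/measurable_funX/measurable_funB => //; exact: measurable_funPT.
    - move=> t _; rewrite limn_einf_lim; apply: lime_ge; first exact: is_cvg_einfs.
      by apply: nearW => k; apply: le_ereal_inf_tmp => _ [j _ <-]; rewrite lee_fin sqr_ge0.
    - rewrite (_ : (fun t => _) =
          (fun t => - limn_esup (fun k => - ((x m t - y k t) ^+ 2)%:E))%E); last first.
        by [].
      apply: measurableT_comp => //; apply: measurable_fun_limn_esup => k.
      exact: measurableT_comp.
    apply: filterS yl0 => t yt _.
    have yc : (fun k => ((x m t - y k t) ^+ 2)%:E) @ \oo --> ((x m t - l0 t) ^+ 2)%:E.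
      apply: cvg_EFin; first exact: nearW.
      by apply: cvgn_sqr; apply: cvgB => //; exact: cvg_cst.
    rewrite is_cvg_limn_einfE; last by apply/cvg_ex; eexists; exact: yc.
    by rewrite (cvg_lim _ yc).
  apply: (le_trans (fatou pi measurableT mF _)).
    by move=> k t _; rewrite lee_fin sqr_ge0.
  apply: (@limn_einf_le _ _ n0) => k n0k.
  have := nrm_sqrE (x m - y k) => /= <-; rewrite lee_fin.
  rewrite lerXn2r ?nnegrE ?sqrtr_ge0 ?(ltW e0)//; apply: he => //.
  by apply: leq_trans n0k _; exact: ltnW.
have l0L : l0 \in L2.
  have [n0 hn0] := cx 1 ltr01.
  have dL : (fun t => x n0 t - l0 t) \in L2.
    apply/L2P; split; first by apply: measurable_funB => //; exact: measurable_funPT.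
    by apply: le_lt_trans (key 1 n0 ltr01 hn0 n0 (leqnn _)) (ltry _).
  have := L2_sub (LfunP (x n0)) dL.
  by rewrite (_ : (fun _ => _) = l0)//; apply/funext => t; rewrite opprB addrC subrK.
exists (toL2 l0L); apply/cvgr0Pnorm_le => e e0.
have [n0 hn0] := cx e e0; exists n0 => // m /= n0m.
rewrite ger0_norm ?sqrtr_ge0// -(@ler_pXn2r _ 2)// ?nnegrE ?sqrtr_ge0 ?(ltW e0)//.
by rewrite -lee_fin nrm_sqrE; exact: key hn0 _ n0m.
Qed.

Let B_lin := ip_lin.
Let B_sym := ip_sym.
Let B_ge0 := ip_ge0.

Definition L2_adherent (S : V -> Prop) u :=
  forall e, 0 < e -> exists2 v, norm2 (u - v) <= e & S v.

Section density.
Variable S : V -> Prop.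
Hypotheses (S0 : S 0) (S_lin : forall a u v, S u -> S v -> S (a *: u + v)).
Local Notation cl := (L2_adherent S).

Lemma adherent_lin a u v : cl u -> cl v -> cl (a *: u + v).
Proof.
move=> cu cv e e0.
(* The added 1 avoids division by 0 when [a = 0]. *)
have a0 : 0 < `|a| + 1 by rewrite ltr_wpDl.
have [u' hu Su] := cu (e / (`|a| + 1) / 2) ltac:(by rewrite !divr_gt0).
have [v' hv Sv] := cv (e / 2) ltac:(by rewrite divr_gt0).
exists (a *: u' + v'); last exact: S_lin.
have -> : a *: u + v - (a *: u' + v') = a *: (u - u') + (v - v').
  by rewrite scalerBr opprD !addrA; congr (_ + _); rewrite addrAC.
apply: (le_trans (nrmD B_sym B_lin B_ge0 _ _)); rewrite (nrmZ B_sym B_lin) [leRHS]splitr; apply: lerD => //.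
apply: (@le_trans _ _ ((`|a| + 1) * norm2 (u - u'))).
  by rewrite ler_wpM2r ?sqrtr_ge0// lerDl.
by rewrite -ler_pdivlMl// mulrC -mulrA [X in _ <= _ * X]mulrC mulrA.
Qed.

Lemma adherent_closed u : L2_adherent cl u -> cl u.
Proof.
move=> cu e e0; have [v uv cv] := cu (e / 2) ltac:(by rewrite divr_gt0).
have [w vw Sw] := cv (e / 2) ltac:(by rewrite divr_gt0).
exists w => //; rewrite -[u](subrK v) -addrA.
by apply: (le_trans (nrmD B_sym B_lin B_ge0 _ _)); rewrite [leRHS]splitr lerD.
Qed.

Hypothesis S_indic : forall A (mA : measurable A), cl (toL2 (L2_indic pi mA)).

Lemma adherent0 : cl 0.
Proof.
by move=> e e0; exists 0; rewrite // subrr /norm2 /nrm (form0l B_lin) sqrtr0 ltW.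
Qed.

Import HBNNSimple.

Lemma adherent_nnsfun (f : {nnsfun T >-> R}) : exists2 v : V, (v : T -> R) = f & cl v.
Proof.
pose s : seq R := finmap.enum_fset (fset_set (f @` setT)).
have h n : exists2 v : V, (forall x, v x = \sum_(i < n) (s`_i * \1_(f @^-1` [set s`_i]) x)) & cl v.
  elim: n => [|n [v vE cv]].
    by exists 0; [move=> x; rewrite big_ord0|exact: adherent0].
  have mA : measurable (f @^-1` [set s`_n]) by exact: measurable_sfunP.
  have cw := adherent_lin s`_n (S_indic mA) cv.
  exists (s`_n *: toL2 (L2_indic pi mA) + v) => //.
  by move=> x; rewrite L2_funE big_ord_recr/= addrC vE.
have [v vE cv] := h (size s); exists v => //.
by apply/funext => x; rewrite vE fimfunEord.
Qed.

(** Simple functions [s n] increase to [u], and [(u - s n) ^+ 2] is dominated by [u ^+ 2]. *)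
Lemma adherent_nonneg u : (forall x, 0 <= u x) -> cl u.
Proof.
move=> u0; apply: adherent_closed => e e0.
have mu : measurable_fun setT (EFin \o u) by apply/measurable_EFinP; exact: measurable_funPT.
pose s := nnsfun_approx measurableT mu.
have su x : (fun n => (s n x)%:E) @ \oo --> (u x)%:E.
  by apply: cvg_nnsfun_approx => // y _; rewrite lee_fin.
have sle n x : s n x <= u x.
  rewrite -lee_fin; apply: (cvge_ge _ (su x)); exists n => // m /= nm.
  by rewrite lee_fin; exact/lefP/nd_nnsfun_approx.
have mE n : measurable_fun setT (fun x => ((u x - s n x) ^+ 2)%:E).
  by apply/measurable_EFinP/measurable_funX/measurable_funB => //; exact: measurable_funPT.
have [] := @dominated_convergence _ _ _ pi setT measurableT
  (fun n x => ((u x - s n x) ^+ 2)%:E) (cst 0%E) (EFin \o (fun x => u x ^+ 2)).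
- exact: mE.
- exact: measurable_cst.
- apply: nearW => x _; apply: cvg_EFin; first exact: nearW.
  rewrite [X in _ --> X](_ : _ = (u x - u x) ^+ 2); last by rewrite subrr expr0n.
  apply: cvgn_sqr; apply: cvgB; first exact: cvg_cst.
  by have /fine_cvgP[] := su x.
- exact: L2_sqr (LfunP u).
- apply: nearW => x n _ /=; rewrite lee_fin ger0_norm ?sqr_ge0//.
  by rewrite lerXn2r ?nnegrE ?subr_ge0 ?sle// gerDl oppr_le0.
move=> _ _; rewrite integral0 => cv.
have e20 : 0 < e ^+ 2 by rewrite exprn_gt0.
have [n] : exists n, (\int[pi]_x ((u x - s n x) ^+ 2)%:E < (e ^+ 2)%:E)%E.
  have [|n _ /(_ n (leqnn _)) h] := cv [set z | (z < (e ^+ 2)%:E)%E]; first exact: open_ereal_lt'.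
  by exists n.
have [v vE cv'] := adherent_nnsfun (s n).
move=> h; exists v => //.
rewrite -(@ler_pXn2r _ 2)// ?nnegrE ?sqrtr_ge0 ?(ltW e0)// -lee_fin nrm_sqrE ltW//.
by apply: le_lt_trans h; rewrite le_eqVlt; apply/orP; left; apply/eqP/eq_integral => x _; rewrite L2_funBE vE.
Qed.

Lemma L2_dense u : cl u.
Proof.
have mu := measurable_funPT u.
have pL (f : T -> R) : measurable_fun setT f -> (forall x, `|f x| <= `|u x|) -> f \in L2.
  move=> mf fu; apply: (@L2_dominated _ _ _ _ _ u 1 (LfunP u)) => // x.
  by rewrite mul1r -[leLHS]real_normK ?num_real// -[leRHS]real_normK ?num_real// lerXn2r ?nnegrE.
have p1L : (fun x => Num.max (u x) 0) \in L2.
  apply: pL; first exact: measurable_maxr.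
  by move=> x; have [h|h] := leP (u x) 0; rewrite ?normr0.
have p2L : (fun x => Num.max (- u x) 0) \in L2.
  apply: pL; first by apply: measurable_maxr => //; exact: measurableT_comp.
  by move=> x; have [h|h] := leP (- u x) 0; rewrite ?normr0// normrN.
rewrite (_ : u = (-1) *: toL2 p2L + toL2 p1L).
  by apply: adherent_lin; apply: adherent_nonneg => x; rewrite toL2E le_max lexx orbT.
apply/LfuneqP => x; rewrite L2_funE !toL2E.
by have [h|h] := leP (u x) 0; have [h'|h'] := leP (- u x) 0; lra.
Qed.

End density.
End L2_space.

(** * Reversible kernels *)

Section reversible_kernel.
Context d (T : measurableType d) (R : realType) (pi : probability T R).
Variable Q : R.-pker T ~> T.
Implicit Types f h : T -> R.
Local Notation L2 := (Lfun pi 2%:E).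

Let mQ U : measurable U -> measurable_fun setT (Q ^~ U).
Proof. exact: measurable_kernel. Qed.

(** Repackages [Q x] as a probability; [pi] only fills the default that [mnormalize] uses for mass 0
    or infinity. *)
Lemma kernel_prob x : exists P : probability T R, forall A, P A = Q x A.
Proof.
exists (mnormalize (Q x) pi) => A.
by rewrite /= /mnormalize/= (prob_kernel x) orbF onee_eq0/= invr1 mule1.
Qed.

Lemma kernel_op_measurable f : measurable_fun setT f -> measurable_fun setT (kernel_op Q f).
Proof.
move=> mf; apply: measurableT_comp => //.
have mg : measurable_fun setT (EFin \o f) by exact/measurable_EFinP.
under eq_fun do rewrite integralE.
apply: emeasurable_funB; apply: measurable_fun_integral_kernel => //.
- exact: measurable_funepos.
- exact: measurable_funeneg.
Qed.

(** Jensen's inequality for the square, as nonnegativity of the variance under [Q x]; it is trivial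
    if the second moment is infinite. *)
Lemma kernel_op_sqr_le f x : measurable_fun setT f ->
  ((kernel_op Q f x ^+ 2)%:E <= \int[Q x]_y ((f y) ^+ 2)%:E)%E.
Proof.
move=> mf; have [fi|] := ltP (\int[Q x]_y ((f y) ^+ 2)%:E)%E +oo%E; last first.
  by apply: le_trans; exact: leey.
have [P PE] := kernel_prob x.
have QE (h : T -> \bar R) : (\int[Q x]_y h y = \int[P]_y h y)%E.
  apply: eq_measure_integral => A mA _; first [exact: PE|exact/esym/PE].
have fL : f \in Lfun P 2%:E by apply/L2P; split; rewrite // -QE.
by have := sqr_mean_le fL; rewrite -lee_fin inner_sqrE// /kernel_op /Rintegral !QE.
Qed.

Lemma kernel_op1 : kernel_op Q (cst 1) = cst 1.
Proof.
apply/funext => x; rewrite /kernel_op /Rintegral (integral_cst (Q x) measurableT 1).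
by rewrite mul1e (prob_kernel x).
Qed.

Lemma kernel_le1 x A : measurable A -> (Q x A <= 1)%E.
Proof. by move=> mA; rewrite -(prob_kernel (s := Q) x) le_measure// inE. Qed.

Lemma kernel_fin_num x A : measurable A -> Q x A \is a fin_num.
Proof. by move=> mA; rewrite ge0_fin_numE// (le_lt_trans (kernel_le1 x mA))// ltry. Qed.

Lemma kernel_op_indic A x : measurable A -> kernel_op Q \1_A x = fine (Q x A).
Proof. by move=> mA; rewrite /kernel_op /Rintegral integral_indic// setIT. Qed.

Hypothesis hrev : reversible pi Q.

(** Reversibility tested on [\1_A] and on the constant 1, which [Q] fixes. *)
Lemma reversible_invariant A : measurable A -> pi A = (\int[pi]_x Q x A)%E.
Proof.
move=> mA; have := hrev (L2_indic pi mA) (L2_cst pi 1).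
rewrite kernel_op1 /inner.
under eq_Rintegral do rewrite mulr1.
under [in RHS]eq_Rintegral do rewrite mulr1 kernel_op_indic//.
rewrite /Rintegral integral_indic// setIT => h.
under eq_integral do rewrite -(fineK (kernel_fin_num _ mA)).
rewrite -(fineK (fin_num_measure pi _ mA)) h fineK//.
rewrite ge0_fin_numE; last by apply: integral_ge0 => x _; rewrite lee_fin fine_ge0.
apply: (@le_lt_trans _ _ (\int[pi]_x 1)%E); last first.
  by rewrite integral_prob_cst ltry.
apply: ge0_le_integral => //.
- by apply/measurable_EFinP; apply: measurableT_comp => //; exact: mQ.
- by move=> x _; rewrite fineK ?kernel_fin_num//; exact: kernel_le1.
Qed.

Lemma ge0_integral_kernel (f : T -> \bar R) : (forall x, 0 <= f x)%E -> measurable_fun setT f ->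
  (\int[pi]_x f x = \int[pi]_x \int[Q x]_y f y)%E.
Proof. by move=> f0 mf; apply: ge0_integral_mixture => //; exact: reversible_invariant. Qed.

Lemma kernel_op_sqr_integral f : measurable_fun setT f ->
  (\int[pi]_x ((kernel_op Q f x) ^+ 2)%:E <= \int[pi]_x ((f x) ^+ 2)%:E)%E.
Proof.
move=> mf; have mf2 : measurable_fun setT (fun x => ((f x) ^+ 2)%:E).
  by apply/measurable_EFinP; exact: measurable_funX.
rewrite (ge0_integral_kernel _ mf2); last by move=> x; rewrite lee_fin sqr_ge0.
apply: ge0_le_integral => //.
- by move=> x _; rewrite lee_fin sqr_ge0.
- by apply/measurable_EFinP; apply: measurable_funX; exact: kernel_op_measurable.
- by apply: measurable_fun_integral_kernel => // x; rewrite lee_fin sqr_ge0.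
- by move=> x _; exact: kernel_op_sqr_le.
Qed.

Lemma kernel_op_L2 f : f \in L2 -> kernel_op Q f \in L2.
Proof.
move=> /L2P[mf fi]; apply/L2P; split; first exact: kernel_op_measurable.
exact: le_lt_trans (kernel_op_sqr_integral mf) fi.
Qed.

Lemma kernel_op_mean f : f \in L2 -> \int[pi]_x kernel_op Q f x = \int[pi]_x f x.
Proof.
move=> fL; have := hrev fL (L2_cst pi 1); rewrite kernel_op1 /inner.
under eq_Rintegral do rewrite mulr1.
by under [in RHS]eq_Rintegral do rewrite mulr1.
Qed.

Lemma centered_op_L2 f : f \in L2 -> centered_op pi Q f \in L2.
Proof. by move=> fL; apply: L2_subcst; exact: kernel_op_L2. Qed.

Lemma centered_op_sym f h : f \in L2 -> h \in L2 ->
  inner pi (centered_op pi Q f) h = inner pi f (centered_op pi Q h).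
Proof.
move=> fL hL; have [qf qh] := (kernel_op_L2 fL, kernel_op_L2 hL).
by rewrite innerC !inner_subcst// innerC -hrev// mulrC.
Qed.

(** Since Q f and f have the same mean m, subtracting m lowers the squared norm of Q f by m^2. *)
Lemma centered_op_contr f : f \in L2 ->
  inner pi (centered_op pi Q f) (centered_op pi Q f) <= inner pi f f.
Proof.
move=> fL; have qf := kernel_op_L2 fL.
rewrite inner_center// kernel_op_mean//.
apply: (@le_trans _ _ (inner pi (kernel_op Q f) (kernel_op Q f))).
  by have := sqr_ge0 (\int[pi]_x f x); nra.
by rewrite -lee_fin !inner_sqrE//; apply: kernel_op_sqr_integral; exact: L2_measurable fL.
Qed.

Definition centeredL2 (u : L2space pi) : L2space pi := toL2 (centered_op_L2 (LfunP u)).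

Lemma LopE u : centeredL2 u = centered_op pi Q u :> (T -> R).
Proof. by []. Qed.

Lemma Lop_sym u v : L2ip (centeredL2 u) v = L2ip u (centeredL2 v).
Proof. by apply: centered_op_sym; exact: LfunP. Qed.

Lemma Lop_contr u : L2ip (centeredL2 u) (centeredL2 u) <= L2ip u u.
Proof. by apply: centered_op_contr; exact: LfunP. Qed.

End reversible_kernel.

(** * Complex spectra *)

Section complex_spectrum.
Context d (T : measurableType d) (R : realType) (pi : probability T R).
Local Notation L2 := (Lfun pi 2%:E).
Local Notation V := (L2space pi).
Local Notation ip := (@L2ip d T R pi).
Local Notation norm2 := (nrm ip).
Implicit Types u v w : V.

(** The inverse in [has_bounded_inverse] must act on arbitrary functions; those that are not
    square-integrable are sent to 0. *)
Definition L2proj (f : T -> R) : V := insubd (0 : V) f.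

Lemma L2projK f : f \in L2 -> L2proj f = f :> (T -> R).
Proof. by move=> fL; exact: (insubdK (0 : V) fL). Qed.

Lemma L2proj_val u : L2proj u = u.
Proof. by apply/LfuneqP => x; rewrite L2projK// LfunP. Qed.

Lemma form_eq_ae u v : form_eq ip u v <-> {ae pi, forall x, u x = v x}.
Proof.
rewrite -(form_eqP (@ip_sym _ _ _ _) (@ip_lin _ _ _ _) (@ip_ge0 _ _ _ _)).
rewrite inner_eq0; last exact: LfunP.
split; apply: filterS => x; rewrite L2_funBE; last by move=> ->; rewrite subrr.
by move=> /eqP; rewrite subr_eq0 => /eqP.
Qed.

Lemma cL2normE (f : T -> R[i]) u v :
  (forall x, complex.Re (f x) = u x) -> (forall x, complex.Im (f x) = v x) ->
  cL2norm pi f = (Num.sqrt (ip u u + ip v v))%:E.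
Proof.
move=> fu fv; rewrite /cL2norm unlock /=.
rewrite (eq_integral (fun x => ((u x) ^+ 2)%:E + ((v x) ^+ 2)%:E)%E); last first.
  move=> x _; rewrite -fu -fv; case: (f x) => a b /=.
  by rewrite powR_mulrn// real_normK ?num_real// sqr_sqrtr// addr_ge0 ?sqr_ge0.
have mm w : measurable_fun setT (fun x => ((w x) ^+ 2)%:E).
  by apply/measurable_EFinP; apply: measurable_funX; exact: measurable_funPT.
rewrite ge0_integralD//; [|by move=> x _; rewrite lee_fin sqr_ge0..].
rewrite -!inner_sqrE; [|exact: LfunP..].
by rewrite -EFinD poweR_EFin powR12_sqrt// addr_ge0// ip_ge0.
Qed.

Lemma cL2P (f : T -> R[i]) : cL2 pi f -> exists uv : V * V,
  (forall x, complex.Re (f x) = uv.1 x) /\ (forall x, complex.Im (f x) = uv.2 x).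
Proof. by move=> [fr fi]; exists (toL2 fr, toL2 fi). Qed.

Variables (A : (T -> R) -> (T -> R)).
Hypothesis AL : forall f, f \in L2 -> A f \in L2.

Definition L2op u : V := toL2 (AL (LfunP u)).

Lemma L2opE u : L2op u = A u :> (T -> R). Proof. by []. Qed.

Lemma has_resolvent_bounded_inverse a b : has_resolvent ip L2op a b ->
  has_bounded_inverse pi (fun f x => complexify A f x - (a +i* b)%C * f x).
Proof.
move=> [G [H [K K0 GH]]].
pose re (f : T -> R[i]) x := complex.Re (f x).
pose im (f : T -> R[i]) x := complex.Im (f x).
pose B f x := (G (L2proj (re f)) (L2proj (im f)) x +i* H (L2proj (re f)) (L2proj (im f)) x)%C.
exists B; split.
- by move=> f _; split; rewrite /B/=; exact: LfunP.
- exists (Num.sqrt K) => f fL; rewrite (@cL2normE f (L2proj (re f)) (L2proj (im f))); last 2 first.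
  + by move=> x; rewrite L2projK//; case: fL.
  + by move=> x; rewrite L2projK//; case: fL.
  rewrite (@cL2normE (B f) (G (L2proj (re f)) (L2proj (im f))) (H (L2proj (re f)) (L2proj (im f))))//.
  rewrite -EFinM lee_fin -sqrtrM// ler_sqrt; last first.
    by rewrite mulr_ge0// addr_ge0// ip_ge0.
  by have [] := GH (L2proj (re f)) (L2proj (im f)).
- move=> f fL; have [[u v]/= [fu fv]] := cL2P fL.
  have reE : re f = u by apply/funext.
  have imE : im f = v by apply/funext.
  pose Af x := complexify A f x - (a +i* b)%C * f x.
  change (\forall x \ae pi, B Af x = f x).
  have reA : re Af = (L2op u - a *: u + b *: v : V).
    apply/funext => x; rewrite /re /Af /complexify -[fun y => complex.Re _]/(re f) reE
      -[fun y => complex.Im _]/(im f) imE; move: (fu x) (fv x).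
    by case: (f x) => p q /= -> ->; rewrite -L2opE opprD opprK addrA.
  have imA : im Af = (L2op v - a *: v - b *: u : V).
    apply/funext => x; rewrite /im /Af /complexify -[fun y => complex.Re _]/(re f) reE
      -[fun y => complex.Im _]/(im f) imE; move: (fu x) (fv x).
    by case: (f x) => p q /= -> ->; rewrite -L2opE opprD addrA.
  have [_ _ _ /form_eq_ae h1 /form_eq_ae h2] := GH u v.
  apply: filterS2 h1 h2 => x h1 h2; rewrite /B reA imA !L2proj_val h1 h2.
  by rewrite -fu -fv; case: (f x).
- move=> f fL; have [[u v]/= [fu fv]] := cL2P fL.
  have reE : re f = u by apply/funext.
  have imE : im f = v by apply/funext.
  have [_ /form_eq_ae h1 /form_eq_ae h2 _ _] := GH u v.
  apply: filterS2 h1 h2 => x h1 h2; rewrite /complexify /B /= reE imE !L2proj_val.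
  have {}h1 : A (G u v) x - a * G u v x + b * H u v x = u x by [].
  have {}h2 : A (H u v) x - a * H u v x - b * G u v x = v x by [].
  apply/eqP; rewrite eq_complex /= fu fv -h1 -h2.
  by apply/andP; split; apply/eqP; rewrite opprD ?opprK addrA.
Qed.

Hypothesis A0 : A (fun=> 0) = fun=> 0.

(** Apply the complex inverse to (A - l) u with [u] real: the argument has imaginary part 0 because
    [A] fixes 0, and the real part of the result is [u] almost everywhere. *)
Lemma bounded_inverse_bounded_below (l : R) :
  has_bounded_inverse pi (fun f x => complexify A f x - (l +i* 0)%C * f x) ->
  exists2 c, 0 < c & forall u, c * norm2 u <= norm2 (L2op u - l *: u).
Proof.
move=> [B [BL [M BM] BA _]].
have M0 : 0 < `|M| + 1 by rewrite ltr_wpDl.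
exists (`|M| + 1)^-1; first by rewrite invr_gt0.
move=> u; rewrite mulrC ler_pdivrMr//.
pose f x : R[i] := (u x +i* 0)%C.
pose Af x := complexify A f x - (l +i* 0)%C * f x.
have zL : (fun=> 0 : R) \in L2 by exact: (L2_cst pi 0).
have fL : cL2 pi f by split => //; exact: LfunP.
have reA x : complex.Re (Af x) = (L2op u - l *: u : V) x.
  by rewrite /Af /complexify /f/= mul0r subr0.
have imA x : complex.Im (Af x) = (0 : V) x.
  by rewrite /Af /complexify /f/= A0 mulr0 mul0r addr0 subr0.
have AfL : cL2 pi Af.
  split; first by rewrite (_ : (fun x => _) = (L2op u - l *: u : V)) ?LfunP//; exact/funext.
  by rewrite (_ : (fun x => _) = (0 : V)) ?LfunP//; exact/funext.
have [[p q]/= [Bp Bq]] := cL2P (BL _ AfL).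
have pu : form_eq ip p u.
  by apply/form_eq_ae; apply: filterS (BA f fL) => x; rewrite -Bp => ->.
have := BM _ AfL; rewrite (cL2normE Bp Bq) (cL2normE reA imA).
rewrite -EFinM lee_fin => h.
have -> : norm2 u = norm2 p.
  by apply/esym; apply: (nrm_eq (@ip_sym _ _ _ _)); exact: pu.
have z0 : ip 0 0 = 0 by exact: (form0l (@ip_lin _ _ _ _)).
apply: (@le_trans _ _ (Num.sqrt (ip p p + ip q q))).
  by rewrite ler_sqrt ?lerDl ?addr_ge0 ?ip_ge0.
apply: (le_trans h); rewrite z0 addr0 mulrC ler_wpM2l ?sqrtr_ge0//.
by rewrite (le_trans (ler_norm _))// lerDl.
Qed.

End complex_spectrum.

Section spectrum_of_contraction.
Context d (T : measurableType d) (R : realType) (pi : probability T R).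
Variable Q : R.-pker T ~> T.
Hypothesis hrev : reversible pi Q.
Local Notation ip := (@L2ip d T R pi).
Local Notation Lop := (centeredL2 hrev).
Local Notation Q0 := (centered_op pi Q).
Local Notation L2 := (Lfun pi 2%:E).

Let ips := @ip_sym d T R pi.
Let ipl := @ip_lin d T R pi.
Let ipp := @ip_ge0 d T R pi.
Let Ls := Lop_sym hrev.
Let Lc := Lop_contr hrev.
Let cpl := @L2_complete d T R pi.

Lemma centered_op0 : Q0 (fun=> 0) = fun=> 0.
Proof.
by apply/funext => x; rewrite /centered_op /kernel_op /Rintegral !integral0 subrr.
Qed.

Lemma centered_op2_L2 f : f \in L2 -> (Q0 \o Q0) f \in L2.
Proof. by move=> fL /=; do 2 apply: (centered_op_L2 hrev). Qed.

Lemma spectrum_resolvent a b : has_resolvent ip Lop a b -> ~ spectrum pi Q0 (a +i* b)%C.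
Proof. by move=> /(@has_resolvent_bounded_inverse _ _ _ _ _ (@centered_op_L2 _ _ _ _ _ hrev)) h; apply. Qed.

Lemma spectrum2_resolvent a b : has_resolvent ip (Lop \o Lop) a b ->
  ~ spectrum pi (Q0 \o Q0) (a +i* b)%C.
Proof.
move=> h; have h' : has_resolvent ip (L2op centered_op2_L2) a b.
  rewrite (_ : L2op _ = Lop \o Lop)//.
  by apply/funext => u; apply/LfuneqP.
by have := has_resolvent_bounded_inverse h'; move=> hb; apply.
Qed.

Lemma real_spectrumE : [set x : R | spectrum pi Q0 (real_complex R x)] = spectral_set ip Lop 'X.
Proof.
apply/seteqP; split => l /= hl.
  move=> bl; apply: (spectrum_resolvent _ hl).
  apply: (has_resolvent_real ips ipl ipp Ls Lc cpl _ bl) => u.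
  by rewrite -['X]expr1 poly_opXn.
move=> hb; apply: hl.
have [c c0 hc] := bounded_inverse_bounded_below (@centered_op_L2 _ _ _ _ _ hrev) centered_op0 hb.
exists c; [exact: c0|move=> u].
have -> : poly_op Lop 'X u = Lop u by rewrite -['X]expr1 poly_opXn.
exact: hc.
Qed.

Lemma real_spectrum2E :
  [set x : R | spectrum pi (Q0 \o Q0) (real_complex R x)] = spectral_set ip Lop 'X^2.
Proof.
apply/seteqP; split => l /= hl.
  move=> bl; apply: (spectrum2_resolvent _ hl).
  apply: (has_resolvent_real ips ipl ipp Ls Lc cpl _ bl) => u.
  by rewrite poly_opXn.
move=> hb; apply: hl.
have A0 : (Q0 \o Q0) (fun=> 0) = fun=> 0 by rewrite /= !centered_op0.
have [c c0 hc] := bounded_inverse_bounded_below centered_op2_L2 A0 hb.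
exists c; [exact: c0|move=> u].
have -> : poly_op Lop 'X^2 u = Lop (Lop u) by rewrite poly_opXn.
have LE : L2op centered_op2_L2 u = Lop (Lop u) by exact/LfuneqP.
rewrite -LE.
exact: hc.
Qed.

Lemma spectrum_sub r : r <= 1 -> bounded_on ip Lop `[- r, r] ->
  spectrum pi Q0 `<=` real_complex R @` `[- r, r].
Proof.
move=> r1 br [a b] sab.
have h := fun hab => spectrum_resolvent (has_resolventX ips ipl ipp Ls cpl r1 br hab) sab.
have b0 : b = 0 by apply/eqP/negPn/negP => b0; apply: h; left.
exists a; last by rewrite b0.
rewrite /= in_itv/= -ler_norml leNgt; apply/negP => ra; apply: h; by right.
Qed.

Lemma spectrum2_sub r : 0 <= r <= 1 -> bounded_on ip Lop `[- r, r] ->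
  spectrum pi (Q0 \o Q0) `<=` real_complex R @` `[0, r ^+ 2].
Proof.
move=> r01 br [a b] sab.
have h := fun hab => spectrum2_resolvent (has_resolventX2 ips ipl ipp Ls cpl r01 br hab) sab.
have b0 : b = 0 by apply/eqP/negPn/negP => b0; apply: h; apply: Or31.
exists a; last by rewrite b0.
rewrite /= in_itv/= !leNgt; apply/andP; split; apply/negP => ra; apply: h.
  exact: Or32.
exact: Or33.
Qed.

End spectrum_of_contraction.

(** * Autocovariances *)

Section bilinear.
Context d (T : measurableType d) (R : realType) (pi : probability T R).
Local Notation V := (L2space pi).
Local Notation norm2 := (nrm (@L2ip d T R pi)).

Lemma adherent_zero (S : V -> R) M : (forall a u v, S (a *: u + v) = a * S u + S v) ->
  (forall u, `|S u| <= M * norm2 u) ->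
  (forall A (mA : measurable A), S (toL2 (L2_indic pi mA)) = 0) -> forall u, S u = 0.
Proof.
move=> Sl SM SA u; apply/eqP; rewrite -normr_eq0 eq_le normr_ge0 andbT.
have M0 : 0 < `|M| + 1 by rewrite ltr_wpDl.
have S0 : S 0 = 0.
  by apply/eqP; rewrite -normr_eq0 eq_le normr_ge0 andbT (le_trans (SM 0))// /nrm (form0l (@ip_lin _ _ _ _)) sqrtr0 mulr0.
apply/ler_addgt0Pr => e e0; rewrite add0r.
have Sl0 a v w : S v = 0 -> S w = 0 -> S (a *: v + w) = 0.
  by move=> Sv Sw; rewrite Sl Sv Sw mulr0 addr0.
have SA0 A (mA : measurable A) : L2_adherent (fun u => S u = 0) (toL2 (L2_indic pi mA)).
  move=> r r0; exists (toL2 (L2_indic pi mA)); last exact: SA.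
  by rewrite subrr /nrm (form0l (@ip_lin _ _ _ _)) sqrtr0 ltW.
have e0' : 0 < e / (`|M| + 1) by rewrite divr_gt0.
have [v uv Sv] := L2_dense S0 Sl0 SA0 u e0'.
have -> : S u = S (u - v).
  by rewrite addrC -scaleN1r Sl Sv mulr0 add0r.
apply: (le_trans (SM _)); apply: (@le_trans _ _ ((`|M| + 1) * norm2 (u - v))).
  by rewrite ler_wpM2r ?sqrtr_ge0// (le_trans (ler_norm _))// lerDl.
by rewrite mulrC -ler_pdivlMr.
Qed.

Lemma bilinear_zero (S : V -> V -> R) M :
  (forall a u v w, S (a *: u + v) w = a * S u w + S v w) ->
  (forall a u v w, S w (a *: u + v) = a * S w u + S w v) ->
  (forall u v, `|S u v| <= M * norm2 u * norm2 v) ->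
  (forall A B (mA : measurable A) (mB : measurable B),
     S (toL2 (L2_indic pi mA)) (toL2 (L2_indic pi mB)) = 0) ->
  forall u v, S u v = 0.
Proof.
move=> Sl Sr SM SA u v.
apply: (@adherent_zero (S^~ v) (M * norm2 v)) => [a w z|w|A mA]; first exact: Sl.
  by rewrite mulrAC; exact: SM.
by apply: (@adherent_zero (S _) (M * norm2 (toL2 (L2_indic pi mA)))).
Qed.

End bilinear.

(** * Joint moments of the stationary chain *)

Section chain.
Context d (T : measurableType d) (R : realType) (pi : probability T R).
Variable Q : R.-pker T ~> T.
Hypothesis hrev : reversible pi Q.
Context d' (Omega : measurableType d') (P : probability Omega R).
Variable X : nat -> {mfun Omega >-> T}.
Hypothesis hX : markov_chain Q pi P X.
Local Notation V := (L2space pi).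
Local Notation ip := (@L2ip d T R pi).
Local Notation norm2 := (nrm ip).

Lemma history_preimage n A : measurable A -> history X n (X 0%N @^-1` A).
Proof. by move=> mA; apply: sub_sigma_algebra; exists 0%N, A; split. Qed.

Lemma ge0_integral_law n (f : T -> \bar R) :
  (forall A, measurable A -> P (X n @^-1` A) = pi A) ->
  (forall x, 0 <= f x)%E -> measurable_fun setT f ->
  (\int[P]_w f (X n w) = \int[pi]_x f x)%E.
Proof.
move=> law f0 mf; have mX : measurable_fun setT (X n) by [].
rewrite -[LHS](@ge0_integral_pushforward _ _ _ _ _ _ mX P setT f)//.
by apply: eq_measure_integral => A mA _; exact: law.
Qed.

Lemma chain_law n A : measurable A -> P (X n @^-1` A) = pi A.
Proof.
elim: n A => [|n IH] A mA; first by case: hX => h _; exact: h.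
have [_ /(_ n setT A)] := hX; rewrite setTI => -> //.
  rewrite (@ge0_integral_law n (Q^~ A) IH)//; last exact: measurable_kernel.
  by rewrite -(reversible_invariant hrev).
by rewrite -(@preimage_setT _ _ (X 0%N)); exact: history_preimage.
Qed.

Lemma chain_L2 n f : f \in Lfun pi 2%:E -> (fun w => f (X n w)) \in Lfun P 2%:E.
Proof.
move=> /L2P[mf fi]; apply/L2P; split; first exact: measurableT_comp.
rewrite (@ge0_integral_law n (fun x => ((f x) ^+ 2)%:E))//; first exact: chain_law.
- by move=> x; rewrite lee_fin sqr_ge0.
- by apply/measurable_EFinP; exact: measurable_funX.
Qed.

Lemma chain_inner_sqr n (u : V) : inner P (fun w => u (X n w)) (fun w => u (X n w)) = ip u u.
Proof.
have uL := LfunP u.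
apply: EFin_inj; rewrite !inner_sqrE//; last exact: chain_L2.
apply: (@ge0_integral_law n (fun x => ((u x) ^+ 2)%:E)); first exact: chain_law.
- by move=> x; rewrite lee_fin sqr_ge0.
- by apply/measurable_EFinP; apply: measurable_funX; exact: measurable_funPT.
Qed.

Definition cross n (u v : V) := inner P (fun w => u (X 0%N w)) (fun w => v (X n w)).

Lemma cross_linl n a (u v w : V) : cross n (a *: u + v) w = a * cross n u w + cross n v w.
Proof.
rewrite /cross -inner_lin//; apply: chain_L2; exact: LfunP.
Qed.

Lemma cross_linr n a (u v w : V) : cross n w (a *: u + v) = a * cross n w u + cross n w v.
Proof.
have cs z : cross n w z = inner P (fun x => z (X n x)) (fun x => w (X 0%N x)) by exact: innerC.
by rewrite !cs -inner_lin//; apply: chain_L2; exact: LfunP.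
Qed.

Lemma cross_le n u v : `|cross n u v| <= norm2 u * norm2 v.
Proof.
pose U : L2space P := toL2 (chain_L2 0 (LfunP u)).
pose W : L2space P := toL2 (chain_L2 n (LfunP v)).
rewrite /nrm -(chain_inner_sqr 0 u) -(chain_inner_sqr n v).
exact: (form_le_nrm (@ip_sym _ _ _ P) (@ip_lin _ _ _ P) (@ip_ge0 _ _ _ P) U W).
Qed.

Definition kernelL2 (u : V) : V := toL2 (kernel_op_L2 hrev (LfunP u)).

Lemma Kop_sym u v : ip (kernelL2 u) v = ip u (kernelL2 v).
Proof. by rewrite /ip -hrev//; exact: LfunP. Qed.

Lemma Kop_contr u : ip (kernelL2 u) (kernelL2 u) <= ip u u.
Proof.
rewrite -lee_fin /ip !inner_sqrE; [|exact: LfunP..].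
by apply: kernel_op_sqr_integral => //; exact: measurable_funPT.
Qed.

Lemma iter_Kop_le n u : norm2 (iter n kernelL2 u) <= norm2 u.
Proof.
elim: n => // n IH; apply: le_trans IH; rewrite iterS /nrm ler_sqrt ?ip_ge0//.
exact: Kop_contr.
Qed.

(** The Markov property for the event that X_0 lies in [A]. It turns the second indicator into a
    general vector, so the induction in [crossE] must cover all vectors. *)
Lemma cross_indic n A B (mA : measurable A) (mB : measurable B) :
  cross n.+1 (toL2 (L2_indic pi mA)) (toL2 (L2_indic pi mB)) =
  cross n (toL2 (L2_indic pi mA)) (kernelL2 (toL2 (L2_indic pi mB))).
Proof.
have mXA k C : measurable C -> measurable (X k @^-1` C).
  by move=> mC; rewrite -[_ @^-1` _]setTI; exact: measurable_funPT.
have := proj2 hX n _ B (@history_preimage n A mA) mB.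
rewrite /cross /inner /Rintegral => h; congr fine.
transitivity (P (X 0%N @^-1` A `&` X n.+1 @^-1` B)).
  rewrite -[in RHS](setIT (_ `&` _)) -integral_indic//; last by apply: measurableI; exact: mXA.
  by apply: eq_integral => w _; rewrite indicI.
rewrite h [LHS]integral_mkcond; apply: eq_integral => w _.
rewrite /patch /= kernel_op_indic//; have -> : (w \in X 0%N @^-1` A) = (X 0%N w \in A) by apply/idP/idP; rewrite !inE.
rewrite indicE.
case: ifPn => _; last by rewrite mul0r.
by rewrite mul1r fineK// kernel_fin_num.
Qed.

(* Both sides are bounded bilinear forms, so indicators suffice. *)
Lemma crossE n u v : cross n u v = ip u (iter n kernelL2 v).
Proof.
elim: n u v => [|n IH] u v.
  have cs a b : cross 0 a b = cross 0 b a by exact: innerC.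
  have c2 a : cross 0 a a = ip a a by exact: chain_inner_sqr.
  (* Two symmetric bilinear forms that agree on squares agree, by polarization. *)
  have := c2 (1 *: u + v); rewrite cross_linl !cross_linr ip_lin !(ip_sym _ (_ + _)) !ip_lin.
  rewrite !c2 (cs v u) (ip_sym v u) /=; lra.
apply/eqP; rewrite -subr_eq0; apply/eqP; move: u v.
apply: (@bilinear_zero _ _ _ _ (fun u v => cross n.+1 u v - ip u (iter n.+1 kernelL2 v)) 2).
- by move=> a u v w; rewrite cross_linl ip_lin; ring.
- by move=> a u v w; rewrite cross_linr -!(iter_sym Kop_sym) !(ip_sym (iter _ _ _)) ip_lin; ring.
- move=> u v; apply: (le_trans (ler_normB _ _)).
  rewrite -mulrA mulr_natl mulr2n; apply: lerD; first exact: cross_le.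
  apply: (le_trans (form_le_nrm (@ip_sym _ _ _ pi) (@ip_lin _ _ _ pi) (@ip_ge0 _ _ _ pi) _ _)).
  by rewrite ler_wpM2l ?sqrtr_ge0//; exact: iter_Kop_le.
- by move=> A B mA mB; rewrite cross_indic IH -iterSr subrr.
Qed.

End chain.

Section autocovariance.
Context d (T : measurableType d) (R : realType) (pi : probability T R).
Variable Q : R.-pker T ~> T.
Hypothesis hrev : reversible pi Q.
Context d' (Omega : measurableType d') (P : probability Omega R).
Variable X : nat -> {mfun Omega >-> T}.
Hypothesis hX : markov_chain Q pi P X.
Variable g : T -> R.
Hypothesis gL : g \in Lfun pi 2%:E.
Local Notation V := (L2space pi).
Local Notation ip := (@L2ip d T R pi).

Definition centered : V := toL2 (L2_subcst (\int[pi]_x g x) gL).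

(** Q and Q0 agree on functions of mean zero, and Q preserves means; the two claims need each other
    in the induction. *)
Lemma iter_centered k : iter k (kernelL2 hrev) centered = iter k (centeredL2 hrev) centered /\
  \int[pi]_x iter k (centeredL2 hrev) centered x = 0.
Proof.
elim: k => [|k [IH m0]]; first by split => //=; rewrite Rintegral_subcst// subrr.
have LK (u : V) : \int[pi]_x u x = 0 -> kernelL2 hrev u = centeredL2 hrev u.
  by move=> u0; apply/LfuneqP => x; rewrite LopE /centered_op u0 subr0.
split; first by rewrite !iterS IH LK.
rewrite iterS -LK// -m0; apply: (kernel_op_mean hrev); exact: LfunP.
Qed.

(** The joint moment of the constant 1 and [g], with the iterates of the kernel moved onto the
    constant, which they fix. *)
Lemma chain_mean n : (\int[P]_w (g (X n w))%:E)%E = (\int[pi]_x g x)%:E.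
Proof.
have gnL := chain_L2 hrev hX n gL.
have zL := L2_cst P (1 : R).
have h : inner P (fun w => 1) (fun w => g (X n w)) = \int[pi]_x g x.
  have := crossE hrev hX n (toL2 (L2_cst pi 1)) (toL2 gL); rewrite /cross /= => ->.
  rewrite -(iter_sym (Kop_sym hrev)) (_ : iter n _ _ = toL2 (L2_cst pi 1)).
    by apply: eq_Rintegral => x _; rewrite mul1r.
  elim: n {gnL} => // n IH; rewrite iterS IH; apply/LfuneqP => x.
  by rewrite /kernelL2 !toL2E kernel_op1.
rewrite -h /inner /Rintegral fineK.
  by apply: eq_integral => w _; rewrite mul1r.
by apply: integrable_fin_num => //; exact: L2_mul.
Qed.

Lemma autocovE (k : int) :
  autocov P X g k = (ip centered (iter `|k|%N (centeredL2 hrev) centered))%:E.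
Proof.
rewrite /autocov; set n := `|k|%N.
rewrite unlock expectation.unlock /=.
have -> : iter n (centeredL2 hrev) centered = iter n (kernelL2 hrev) centered.
  by have [] := iter_centered n.
rewrite -(crossE hrev hX) /cross /inner /Rintegral fineK.
  apply: eq_integral => w _; congr EFin.
  by rewrite /= !chain_mean.
by apply: integrable_fin_num => //; apply: L2_mul; apply: (chain_L2 hrev hX); exact: LfunP.
Qed.

End autocovariance.

(** * Geometric ergodicity *)

Section measurable_hull.
Context d (T : measurableType d) (R : realType) (pi : probability T R).

(* Needed because the function [V] of geometric ergodicity is not assumed to
   be measurable. *)
Lemma measurable_hull (E : set T) : exists B, [/\ measurable B, E `<=` B &
  forall N, measurable N -> N `<=` B -> N `&` E = set0 -> pi N = 0%E].
Proof.
pose S := [set fine (pi C) | C in [set C | measurable C /\ E `<=` C]].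
have finP C : measurable C -> pi C \is a fin_num by move=> mC; exact: fin_num_measure.
have S_lb : has_lbound S by exists 0 => _ [C _ <-]; rewrite fine_ge0.
have S_inf : has_inf S by split => //; exists (fine (pi setT)), setT.
have /choice[C hC] : forall k : nat, exists C, [/\ measurable C, E `<=` C &
    fine (pi C) < inf S + k.+1%:R^-1].
  move=> k; have k0 : 0 < k.+1%:R^-1 :> R by rewrite invr_gt0.
  have [_ [C [mC EC] <-] hC] := inf_adherent k0 S_inf.
  by exists C.
have mC k : measurable (C k) by case: (hC k).
have mB : measurable (\bigcap_k C k) by exact: bigcapT_measurable.
exists (\bigcap_k C k); split => //.
  by move=> x Ex k _; case: (hC k) => _ + _; apply.
move=> N mN NB NE.
have le_inf : fine (pi (\bigcap_k C k)) <= inf S.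
  apply/ler_addgt0Pr => e e0.
  have [k] : exists k : nat, k.+1%:R^-1 < e.
    exists (Num.bound e^-1); rewrite invf_plt ?posrE//.
    have : e^-1 < (Num.bound e^-1)%:R by apply: archi_boundP; rewrite invr_ge0 ltW.
    by move=> /lt_trans; apply; rewrite ltr_nat.
  move=> ke; apply: (@le_trans _ _ (fine (pi (C k)))).
    by rewrite fine_le ?finP// le_measure ?inE// => x; apply.
  by case: (hC k) => _ _ /ltW h; apply: (le_trans h); rewrite lerD2l ltW.
have inf_le : inf S <= fine (pi (\bigcap_k C k `\` N)).
  apply: ge_inf => //; exists (\bigcap_k C k `\` N) => //; split; first exact: measurableD.
  move=> x Ex; split; first by move=> k _; case: (hC k) => _ + _; apply.
  by move=> Nx; have : set0 x by rewrite -NE.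
have split_pi : pi (\bigcap_k C k) = (pi (\bigcap_k C k `\` N) + pi N)%E.
  rewrite -measureU//; [|exact: measurableD|by rewrite setDE -setIA setICl setI0].
  by rewrite setUC setDUK.
move: le_inf; rewrite split_pi fineD ?finP//; last exact: measurableD.
move=> h; apply/eqP; rewrite eq_le measure_ge0 andbT -(fineK (finP _ mN)) lee_fin.
by move: h inf_le; lra.
Qed.

End measurable_hull.

(** * Decay along a geometrically ergodic chain *)

Section geometric_ergodicity.
Context d (T : measurableType d) (R : realType) (pi : probability T R).
Variable Q : R.-pker T ~> T.
Hypothesis hrev : reversible pi Q.
Local Notation V := (L2space pi).
Local Notation ip := (@L2ip d T R pi).
Local Notation norm2 := (nrm ip).
Local Notation indic mA := (toL2 (L2_indic pi mA)).
Local Notation Kop := (kernelL2 hrev).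
Local Notation Lop := (centeredL2 hrev).

Lemma kernel_iter_fin n x A : measurable A -> kernel_iter Q n x A \is a fin_num.
Proof.
move=> mA; rewrite ge0_fin_numE//.
apply: (@le_lt_trans _ _ (kernel_iter Q n x setT)); first by rewrite le_measure ?inE.
by apply: (le_lt_trans (sprob_kernel_le1 _ _)); rewrite ltry.
Qed.

Lemma iter_Kop_indic n A (mA : measurable A) x :
  iter n Kop (indic mA) x = fine (kernel_iter Q n x A).
Proof.
elim: n x => [|n IH] x; first by rewrite -[RHS]/(fine (\d_x A)) diracE /= indicE.
rewrite iterS toL2E /kernel_op /Rintegral; congr fine.
by apply: eq_integral => y _; rewrite IH fineK// kernel_iter_fin.
Qed.

(** The infimum in [tv_norm] is at most 0, by the empty set, so the supremum alone gives the
    bound. *)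
Lemma tv_norm_ge n x A : measurable A ->
  (kernel_iter Q n x A - pi A <= tv_norm (kernel_iter Q n x) pi)%E.
Proof.
move=> mA; rewrite /tv_norm -[leLHS]adde0; apply: leeD.
  by apply: ereal_sup_ubound; exists A.
rewrite leeNr oppe0; apply: ereal_inf_lbound; exists set0 => //.
by rewrite !measure0 sube0.
Qed.

Lemma tv_norm_ge0 n x : (0 <= tv_norm (kernel_iter Q n x) pi)%E.
Proof. by have := @tv_norm_ge n x set0 measurable0; rewrite !measure0 sube0. Qed.

Lemma geometrically_ergodic_rate : geometrically_ergodic Q pi ->
  exists r (W : T -> R), 0 <= r < 1 /\ forall n x A, (0 < n)%N -> measurable A ->
    fine (kernel_iter Q n x A) - fine (pi A) <= W x * r ^+ n.
Proof.
move=> [rho [W [rho1 W0 hW]]].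
have key n x A : measurable A ->
    fine (kernel_iter Q n x A) - fine (pi A) <= W x * rho ^+ n.
  move=> mA; rewrite -lee_fin; apply: le_trans (hW n x).
  rewrite EFinB fineK ?kernel_iter_fin// fineK; last exact: fin_num_measure.
  exact: tv_norm_ge.
have [rho0|rho0] := leP 0 rho.
  by exists rho, W; split; [rewrite rho0|move=> *; exact: key].
(* [rho] may be negative, but then [0 <= tv_norm _ _ <= W x * rho] forces [W = 0]. *)
have Wz x : W x = 0.
  have := le_trans (tv_norm_ge0 1 x) (hW 1 x); rewrite lee_fin expr1 => h.
  by apply/eqP; rewrite eq_le W0 andbT -(pmulr_lle0 _ (_ : 0 < - rho)) ?oppr_gt0//; nra.
exists 0, W; split; first by rewrite lexx ltr01.
by move=> n x A n0 mA; rewrite Wz mul0r; have := key n x A mA; rewrite Wz mul0r.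
Qed.

Definition geometric_decay r (v : V) :=
  exists C, forall n, (0 < n)%N -> norm2 (iter n Lop v) ^+ 2 <= C * r ^+ (2 * n).

Let ips := @ip_sym d T R pi.
Let ipl := @ip_lin d T R pi.
Let ipp := @ip_ge0 d T R pi.
Let Ls := Lop_sym hrev.

Lemma geometric_decay_lin r a u v : 0 <= r ->
  geometric_decay r u -> geometric_decay r v -> geometric_decay r (a *: u + v).
Proof.
move=> r0 [C hC] [D hD]; exists (2 * a ^+ 2 * C + 2 * D) => n n0.
have E : form_eq ip (iter n Lop (a *: u + v)) (a *: iter n Lop u + iter n Lop v).
  by move=> w; rewrite (iter_sym Ls) !ipl !(iter_sym Ls).
rewrite (nrm_eq ips E); set p := iter n Lop u; set q := iter n Lop v.
have t : norm2 (a *: p + q) <= `|a| * norm2 p + norm2 q.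
  by rewrite -(nrmZ ips ipl); exact: (nrmD ips ipl ipp).
apply: (@le_trans _ _ (2 * a ^+ 2 * norm2 p ^+ 2 + 2 * norm2 q ^+ 2)).
  apply: (@le_trans _ _ ((`|a| * norm2 p + norm2 q) ^+ 2)).
    by rewrite lerXn2r ?nnegrE ?addr_ge0 ?mulr_ge0 ?sqrtr_ge0.
  rewrite -(real_normK (num_real a)).
  by have := sqr_ge0 (`|a| * norm2 p - norm2 q); move: (`|a|) (norm2 p) (norm2 q) => x y z; nra.
rewrite [leRHS](_ : _ = 2 * a ^+ 2 * (C * r ^+ (2 * n)) + 2 * (D * r ^+ (2 * n))); last by ring.
apply: lerD; apply: ler_wpM2l; [by rewrite mulr_ge0 ?sqr_ge0|exact: hC|by []|exact: hD].
Qed.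

Lemma iter_Lop_cst1 n : (0 < n)%N -> iter n Lop (toL2 (L2_cst pi 1)) = 0.
Proof.
have L1 : Lop (toL2 (L2_cst pi 1)) = 0.
  apply/LfuneqP => x; rewrite LopE /centered_op toL2E kernel_op1.
  apply/eqP; rewrite subr_eq0 eq_sym /Rintegral; apply/eqP.
  by rewrite -[RHS]/(fine 1%E); congr fine; exact: (integral_prob_cst pi 1%E).
have L0 : Lop 0 = 0.
  by apply/LfuneqP => x; rewrite LopE (centered_op0 pi Q).
case: n => // n _; rewrite iterSr L1; elim: n => // n IH.
by rewrite iterS IH L0.
Qed.

Lemma geometric_decay_cst1 r : geometric_decay r (toL2 (L2_cst pi 1)).
Proof.
exists 0 => n n0; rewrite iter_Lop_cst1// (nrm_sqr ips ipp).
by rewrite (form0l ipl) mul0r.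
Qed.

(** Write 1_A = pi(A) + c. The operator Q0 kills the constant, and the squared norm of Q0^n c is <c,
    Q^(2n) c> = <1_A, Q^(2n) 1_A> - pi(A)^2, the integral over A of Q^(2n)(x, A) - pi(A). So the
    hypothesis is used at time 2 n. *)
Lemma geometric_decay_indic r (M : R) A (mA : measurable A) :
  0 <= M ->
  0 <= r -> (forall n, (0 < n)%N -> {ae pi, forall x, A x ->
     fine (kernel_iter Q n x A) - fine (pi A) <= M * r ^+ n}) ->
  geometric_decay r (indic mA).
Proof.
move=> M0 r0 hA; set p := \int[pi]_x indic mA x.
have pE : p = fine (pi A).
  by rewrite /p /Rintegral integral_indic// setIT.
have -> : indic mA = p *: toL2 (L2_cst pi 1) + centered (LfunP (indic mA)).
  apply/LfuneqP => x; rewrite L2_funE.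
  by rewrite -[X in _ = _ + X]/(indic mA x - p) toL2E mulr1 addrC subrK.
apply: geometric_decay_lin => //; first exact: geometric_decay_cst1.
set c := centered _.
exists M => n n0.
have [IK m0] := iter_centered hrev (LfunP (indic mA)) (n + n).
rewrite (nrm_sqr ips ipp) (iter_sym Ls) -iterD -IK -/c.
have uK k : iter k Kop (toL2 (L2_cst pi 1)) = toL2 (L2_cst pi 1).
  elim: k => // k IH; rewrite iterS IH; apply/LfuneqP => x.
  by rewrite /kernelL2 !toL2E kernel_op1.
have Ks := iter_sym (Kop_sym hrev).
have cE : c = (- p) *: toL2 (L2_cst pi 1) + indic mA.
  by apply/LfuneqP => x; rewrite L2_funE -[LHS]/(indic mA x - p) toL2E mulr1 addrC.
have one1 : ip (toL2 (L2_cst pi 1)) (toL2 (L2_cst pi 1)) = 1.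
  by rewrite /L2ip /inner /Rintegral /= mulr1 integral_prob_cst.
have oneh : ip (toL2 (L2_cst pi 1)) (indic mA) = p.
  by apply: eq_Rintegral => x _; rewrite toL2E mul1r.
have -> : ip c (iter (n + n) Kop c) = ip (indic mA) (iter (n + n) Kop (indic mA)) - p ^+ 2.
  have e1 z m : ip (toL2 (L2_cst pi 1)) (iter m Kop z) = ip (toL2 (L2_cst pi 1)) z.
    by rewrite -Ks uK.
  have e2 : ip (toL2 (L2_cst pi 1)) c = 0.
    by rewrite ips cE ipl one1 (ips _ (toL2 _)) oneh; ring.
  rewrite {1}cE ipl e1 e2 mulr0 add0r -Ks ips cE ipl e1 oneh; ring.
have n20 : (0 < 2 * n)%N by rewrite muln_gt0.
have KI := iter_Kop_indic (n + n) mA.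
rewrite addnn -mul2n in KI *.
have mK : measurable_fun setT (iter (2 * n) Kop (indic mA)) by exact: measurable_funPT.
have -> : ip (indic mA) (iter (2 * n) Kop (indic mA)) - p ^+ 2 =
    \int[pi]_x (indic mA x * (iter (2 * n) Kop (indic mA) x - p)).
  rewrite -[RHS]/(inner pi (indic mA) _) inner_subcst; [|exact: LfunP..].
  by rewrite -/p expr2.
have M20 : 0 <= M * r ^+ (2 * n) by rewrite mulr_ge0 ?exprn_ge0.
apply: (@le_trans _ _ (\int[pi]_x (M * r ^+ (2 * n)))); last first.
  by rewrite /Rintegral integral_prob_cst.
rewrite /Rintegral; apply: fine_le.
- apply: integrable_fin_num => //; apply: L2_mul; first exact: LfunP.
  by apply: L2_subcst; exact: LfunP.
- by rewrite integral_prob_cst.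
have [N [mN N0 hN]] := hA _ n20.
rewrite (negligible_integral mN) //; last first.
  apply: L2_mul; first exact: LfunP.
  by apply: L2_subcst; exact: LfunP.
rewrite [leRHS](negligible_integral mN)//; last first.
  exact: (L2_integrable (L2_cst pi _)).
apply: le_integral => //; first exact: measurableD.
- apply: (integrableS measurableT) => //; first exact: measurableD.
  apply: L2_mul; first exact: LfunP.
  by apply: L2_subcst; exact: LfunP.
- apply: (integrableS measurableT) => //; first exact: measurableD.
  exact: (L2_integrable (L2_cst pi _)).
move=> x; rewrite inE => -[_ /= nN]; rewrite lee_fin KI pE /= indicE.
case: (boolP (x \in A)) => xA; last by rewrite mul0r.
rewrite mul1r; apply: contrapT => h; apply: nN; apply: hN => /= /(_ (set_mem xA)).
exact: h.
Qed.

Lemma geometric_bounded_on : geometrically_ergodic Q pi ->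
  exists2 r, 0 <= r < 1 & bounded_on ip Lop `[- r, r].
Proof.
move=> /geometrically_ergodic_rate[r [W [r01 hW]]]; exists r => //.
have /andP[r0 r1] := r01.
pose E (M : nat) := [set x | W x <= M%:R].
have /choice[B hB] := fun M => measurable_hull pi (E M).
(* Hulls chosen separately need not increase with [M]; the tail intersections do, and they still
   contain the sublevel sets of [W]. *)
pose B' M := \bigcap_(k in [set k | (M <= k)%N]) B k.
have mB' M : measurable (B' M) by apply: bigcap_measurable; [exists M => /=|move=> k _; case: (hB k)].
have B'B M : B' M `<=` B M by move=> x; apply => /=.
have EB' x M : W x <= M%:R -> B' M x.
  move=> WM k /= Mk; case: (hB k) => _ + _; apply.
  by rewrite /E /= (le_trans WM)// ler_nat.
have decay A M (mA : measurable (A `&` B' M)) : geometric_decay r (indic mA).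
  apply: (@geometric_decay_indic r M%:R) => // n n0.
  pose D x := fine (kernel_iter Q n x (A `&` B' M)) - fine (pi (A `&` B' M)).
  have mD : measurable_fun setT D.
    apply: measurable_funB => //; apply: measurableT_comp => //.
    exact: (measurable_kernel (kernel_iter Q n)).
  (* Where the bound fails, [W x > M]. So this measurable subset of the hull misses [E M], and it is
     null by the choice of the hull. *)
  exists ((A `&` B' M) `&` D @^-1` `]M%:R * r ^+ n, +oo[); split.
  - by apply: measurableI => //; rewrite -[X in measurable X]setTI; exact: mD.
  - case: (hB M) => mBM EBM; apply.
    + by apply: measurableI => //; rewrite -[X in measurable X]setTI; exact: mD.
    + by move=> x [[_ /B'B]].
    + apply/seteqP; split => // x [[_ /=]]; rewrite in_itv/= andbT ltNge => /negP h Ex; apply: h.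
      by apply: (le_trans (hW n x _ n0 mA)); rewrite ler_wpM2r ?exprn_ge0.
  - move=> x /= /not_implyP[ABx /negP]; rewrite -ltNge => h; split => //.
    by rewrite /= in_itv/= andbT.
apply: (decay_bounded_on ips ipl ipp Ls (Lop_contr hrev) r0).
apply: L2_dense.
- have -> : 0 = (-1) *: toL2 (L2_cst pi 1) + toL2 (L2_cst pi 1) by rewrite scaleN1r addNr.
  by apply: geometric_decay_lin => //; exact: geometric_decay_cst1.
- by move=> a u v; exact: geometric_decay_lin.
move=> A mA e e0.
have [M hM] : exists M, (pi (A `\` B' M) < (e ^+ 2)%:E)%E.
  apply: measure_decreasing_small.
  - by move=> M; exact: measurableD.
  - move=> m n mn x [Ax nB]; split => // Bx; apply: nB => k /= nk; apply: Bx => /=.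
    exact: leq_trans nk.
  rewrite (_ : \bigcap_n _ = set0) ?measure0 ?lte_fin ?exprn_gt0//.
  (* Every point lies in some [B' M] because [W] is finite, so the sets [A] minus [B' M] decrease to
     the empty set. *)
  apply/seteqP; split => // x /(_ (Num.bound `|W x|) I)[_]; apply; apply: EB'.
  by rewrite (le_trans (ler_norm _))// ltW// archi_boundP.
have mAB : measurable (A `&` B' M) by exact: measurableI.
exists (indic mAB); last exact: decay.
rewrite (nrm_le ips ipp); last exact: ltW.
rewrite -lee_fin; apply: le_trans (ltW hM).
rewrite /L2ip inner_sqrE ?LfunP// -[leRHS]/(pi _) -[X in (_ <= pi X)%E]setIT -integral_indic//; last exact: measurableD.
rewrite le_eqVlt; apply/orP; left; apply/eqP; apply: eq_integral => x _.
rewrite L2_funBE !toL2E !indicE in_setD in_setI; case: (x \in A); case: (x \in B' M) => /=.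
all: by rewrite ?subrr ?subr0 ?expr0n ?expr1n.
Qed.

End geometric_ergodicity.

Theorem proposition1 (R : realType) (S : completeMetricType R)
    (hsep : separable S)
    (Q : R.-pker (borel S) ~> (borel S)) (pi : probability (borel S) R)
    (hrev : reversible pi Q)
    (g : borel S -> R) (mg : measurable_fun setT g)
    (hg : (\int[pi]_x ((g x) ^+ 2)%:E < +oo)%E)
    (d : measure_display) (Omega : measurableType d) (P : probability Omega R)
    (X : nat -> {mfun Omega >-> borel S}) (hX : markov_chain Q pi P X) :
  let gamma := autocov P X g in
  let Gamma := fun k : nat => (gamma (2 * k)%N%:Z + gamma (2 * k + 1)%N%:Z)%E in
  let Q0 := centered_op pi Q in
  let sigma := spectrum pi Q0 in
  let sigma2 := spectrum pi (Q0 \o Q0) in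
  [/\ (exists2 F : {finite_measure set (measurableTypeR R) -> \bar R},
         regular_measure F &
         forall k : int, gamma k =
           (\int[F]_(x in [set x : R | sigma (real_complex R x)])
              (x ^+ `|k|%N)%:E)%E) /\
      (sigma `<=` range (real_complex R) /\
       sigma `<=` real_complex R @` `[-1, 1]),
      (exists2 G : {finite_measure set (measurableTypeR R) -> \bar R},
         regular_measure G &
         forall k : nat, Gamma k =
           (\int[G]_(x in [set x : R | sigma2 (real_complex R x)])
              (x ^+ k)%:E)%E) /\
      sigma2 `<=` real_complex R @` `[0, 1]
    & forall psi : {measure set (borel S) -> \bar R},
        psi_irreducible Q psi -> aperiodic Q psi ->
        positive Q -> harris_recurrent Q psi ->
        geometrically_ergodic Q pi ->
        exists delta0 : R, [/\ 0 < delta0 <= 1,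
          sigma `<=` real_complex R @` `[-1 + delta0, 1 - delta0]
        & sigma2 `<=` real_complex R @` `[0, (1 - delta0) ^+ 2]]].
Proof.
move=> gamma Gamma Q0 sigma sigma2.
have gL : g \in Lfun pi 2%:E by apply/L2P.
have ips := @ip_sym _ _ _ pi; have ipl := @ip_lin _ _ _ pi; have ipp := @ip_ge0 _ _ _ pi.
have Ls := Lop_sym hrev; have Lc := Lop_contr hrev.
have gammaE k : gamma k = (L2ip (centered gL) (iter `|k|%N (centeredL2 hrev) (centered gL)))%:E.
  exact: autocovE.
have b1 : bounded_on (@L2ip _ _ _ pi) (centeredL2 hrev) `[- 1, 1].
  by apply: bounded_on_itv.
split.
- split.
    have [F hF] := spectral_moments ips ipl ipp Ls Lc (centered gL).
    exists F; first exact: finite_measure_regular.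
    by move=> k; rewrite gammaE hF real_spectrumE.
  have s11 := spectrum_sub (lexx 1) b1.
  by split => // l /s11[x _ <-]; exists x.
- split.
    have [G hG] := spectral_even_moments ips ipl ipp Ls Lc (centered gL).
    exists G; first exact: finite_measure_regular.
    by move=> k; rewrite /Gamma !gammaE -EFinD hG real_spectrum2E.
  have := @spectrum2_sub _ _ _ pi Q hrev 1 _ b1; rewrite expr1n; apply.
  by rewrite ler01 lexx.
- move=> psi _ _ _ _ /(geometric_bounded_on hrev)[r /andP[r0 r1] br].
  exists (1 - r); split.
  + by rewrite subr_gt0 r1 gerBl.
  + rewrite (_ : -1 + (1 - r) = - r); last by ring.
    rewrite (_ : 1 - (1 - r) = r); last by ring.
    exact: spectrum_sub (ltW r1) br.
  + rewrite (_ : 1 - (1 - r) = r); last by ring.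
    by apply: spectrum2_sub br; rewrite r0 ltW.
Qed.
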